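(* Let $(S,\mathfrak m,K)$ be a Noetherian local ring with maximal ideal $\mathfrak m$ and residue field $K=S/\mathfrak m$, let $M$ be a finitely generated $S$-module with Krull dimension $m=\dim(M)\ge 0$, and let $I\subset S$ be a proper ideal such that $\mathfrak m^n M \subset IM$ for some $n\geq 1$. Then $$e(M,I) = m!\, \operatorname{Res}_{z=m+1}\zeta^1_{M,I}(z).$$
   Context: Let $\operatorname{gr}_I(M)=\bigoplus_{n\ge 0}I^nM/I^{n+1}M$, a graded module over $\operatorname{gr}_I(S)=\bigoplus_{n\ge0}I^n/I^{n+1}$; it has $\dim \operatorname{gr}_I(M)=m$. Let $H(\operatorname{gr}_I(M),n)$ be the length over $S$ of $I^nM/I^{n+1}M$, and $\chi_M(n)=H_1(\operatorname{gr}_I(M),n)=\sum_{i=0}^nH(\operatorname{gr}_I(M),i)$, the length of $M/I^{n+1}M$ (the Hilbert-Samuel function of $M$ with respect to $I$). The multiplicity of $M$ with respect to $I$ is $e(M,I):=e(\operatorname{gr}_I(M))$, i.e. $e(M,I)=h(1)$, where $\sum_{n\ge0}H(\operatorname{gr}_I(M),n)t^n=\frac{h(t)}{(1-t)^m}$ with $h\in\mathbb Z[t]$, $h(1)\neq 0$. Define, for real $w>0$, $\zeta^1_{M,I}(z,w)=\sum_{n=0}^\infty\frac{\chi_M(n)}{(n+w)^z}$ and $\zeta^1_{M,I}(z)=\lim_{w\searrow0}\bigl(\zeta^1_{M,I}(z,w)-\chi_M(0)w^{-z}\bigr)=\sum_{n=1}^\infty\frac{\chi_M(n)}{n^z}$;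 the series converges absolutely for $\operatorname{Re} z>m+1$ and extends to a meromorphic function on $\mathbb C$, whose residue is meant. *)

(* Defs.v *)
From mathcomp Require Import all_boot all_order all_algebra.
From mathcomp Require Import ring_quotient complex.
From mathcomp Require Import all_classical all_reals all_analysis.

Set Implicit Arguments.
Unset Strict Implicit.
Unset Printing Implicit Defensive.

Import Order.TTheory GRing.Theory Num.Theory.
Import numFieldNormedType.Exports.

Local Open Scope classical_set_scope.
Local Open Scope ring_scope.
Local Open Scope complex_scope.

Definition submodule (S : comNzRingType) (M : lmodType S) : set (set M) :=
  [set N : set M | submod_closed [in N]].

Definition submodule_span (S : comNzRingType) (M : lmodType S) (X : set M) :
    set M :=
  smallest (@submodule S M) X.

(* Ideals, the unit ideal included, are the submodules of the regular module;
   [idealr_closed] also requires that 1 is not in the ideal. *)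
Definition is_ideal (S : comNzRingType) : set (set S) := @submodule S S^o.

Definition is_proper_ideal (S : comNzRingType) : set (set S) :=
  [set J : set S | idealr_closed [in J]].

Definition is_prime_ideal (S : comNzRingType) : set (set S) :=
  [set P : set S | is_proper_ideal P /\ prime_idealr_closed [in P]].

Definition is_maximal_ideal (S : comNzRingType) : set (set S) :=
  [set J : set S | is_proper_ideal J /\
           forall J', is_proper_ideal J' -> J `<=` J' -> J' = J].

Definition noetherian_ring (S : comNzRingType) : Prop :=
  forall J : set S, is_ideal J ->
    exists s : seq S, J = @submodule_span S S^o [set` s].

Definition local_ring (S : comNzRingType) (mm : set S) : Prop :=
  is_maximal_ideal mm /\ forall J : set S, is_maximal_ideal J -> J = mm.

Definition finitely_generated (S : comNzRingType) (M : lmodType S) : Prop :=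
  exists s : seq M, submodule_span [set` s] = setT.

Definition ideal_smul (S : comNzRingType) (M : lmodType S)
    (J : set S) (N : set M) : set M :=
  submodule_span [set a *: x | a in J & x in N].

Fixpoint ideal_exp (S : comNzRingType) (J : set S) (n : nat) : set S :=
  if n is k.+1 then @ideal_smul S S^o J (ideal_exp J k) else setT.

Definition annihilator (S : comNzRingType) (M : lmodType S) : set S :=
  [set a | forall x : M, a *: x = 0].

Definition has_chain (T : Type) (F : set (set T)) (n : nat) : Prop :=
  exists C : nat -> set T,
    (forall i, (i <= n)%N -> F (C i)) /\
    (forall i, (i < n)%N -> C i `<` C i.+1).

Definition max_chain_length (T : Type) (F : set (set T)) (n : nat) : Prop :=
  has_chain F n /\ forall k, has_chain F k -> (k <= n)%N.

(* dim M = dim (S / Ann M).  The zero module has no dimension in nat. *)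
Definition krull_dim (S : comNzRingType) (M : lmodType S) (m : nat) : Prop :=
  max_chain_length [set P : set S | is_prime_ideal P /\ annihilator M `<=` P] m.

(* Length of the subquotient A / B, whose submodules are the N / B with
   B <= N <= A; the default value 0 is used for infinite length. *)
Definition subquotient_length (S : comNzRingType) (M : lmodType S)
    (A B : set M) : nat :=
  xget 0%N
    (max_chain_length [set N : set M | submodule N /\ B `<=` N /\ N `<=` A]).

(* H(gr_I(M), n) *)
Definition hilbert_gr (S : comNzRingType) (M : lmodType S) (I : set S)
    (n : nat) : nat :=
  subquotient_length (ideal_smul (ideal_exp I n) [set: M])
                     (ideal_smul (ideal_exp I n.+1) [set: M]).

(* chi_M(n) *)
Definition hilbert_samuel (S : comNzRingType) (M : lmodType S) (I : set S)
    (n : nat) : nat :=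
  (\sum_(0 <= i < n.+1) hilbert_gr M I i)%N.

(* sum_n H n t^n = h(t) / (1 - t)^m as formal power series, with the
   denominator cleared. *)
Definition hilbert_series_eq (H : nat -> nat) (m : nat) (h : {poly int}) :
    Prop :=
  forall n : nat,
    \sum_(0 <= i < n.+1) ((1 - 'X) ^+ m : {poly int})`_i * (H (n - i)%N)%:Z
    = h`_n.

(* e(M, I), for a module M of dimension m. *)
Definition multiplicity (S : comNzRingType) (M : lmodType S) (I : set S)
    (m : nat) : int :=
  xget 0 [set e : int | exists h : {poly int},
    [/\ hilbert_series_eq (hilbert_gr M I) m h, h.[1] != 0 & e = h.[1]]].

(* n ^ z = exp (z ln n), for n > 0. *)
Definition natcpow (R : realType) (n : nat) (z : R[i]) : R[i] :=
  (expR (complex.Re z * ln n%:R))%:C *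
  (cos (complex.Im z * ln n%:R) +i* sin (complex.Im z * ln n%:R)).

Definition holomorphic_near (R : realType) (g : R[i]^o -> R[i]^o)
    (a : R[i]^o) : Prop :=
  \forall z \near a, derivable g z 1.

Definition meromorphic (R : realType) (F : R[i]^o -> R[i]^o) : Prop :=
  forall a : R[i]^o, exists (k : nat) (g : R[i]^o -> R[i]^o),
    holomorphic_near g a /\
    \forall z \near a^', (z - a) ^+ k * F z = g z.

(* r is the coefficient of (z - a)^-1 in the Laurent expansion of F at a: up
   to a function holomorphic at a, F is a polynomial p in (z - a)^-1, and
   r = p_1 (the constant term of p does not matter). *)
Definition is_residue (R : realType) (F : R[i]^o -> R[i]^o) (a : R[i]^o)
    (r : R[i]) : Prop :=
  exists (p : {poly R[i]}) (g : R[i]^o -> R[i]^o),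
    [/\ holomorphic_near g a,
        \forall z \near a^', F z = p.[(z - a)^-1] + g z
      & r = p`_1].

Definition residue (R : realType) (F : R[i]^o -> R[i]^o) (a : R[i]^o) : R[i] :=
  xget 0 (is_residue F a).

(* F is meromorphic on the plane and F z = sum_(n >= 1) chi_M(n) / n^z for
   Re z > m + 1. *)
Definition zeta1_extension (R : realType) (S : comNzRingType) (M : lmodType S)
    (I : set S) (m : nat) (F : R[i]^o -> R[i]^o) : Prop :=
  meromorphic F /\
  forall z : R[i]^o, m.+1%:R < complex.Re z ->
    (\sum_(1 <= k < n.+1) (hilbert_samuel M I k)%:R / natcpow k z : R[i]^o)
      @[n --> \oo] --> F z.

(* The meromorphic extension is unique up to its values at isolated points,
   which do not affect the residues. *)
Definition zeta1 (R : realType) (S : comNzRingType) (M : lmodType S)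
    (I : set S) (m : nat) : R[i]^o -> R[i]^o :=
  xget (fun=> 0) (@zeta1_extension R S M I m).
Arguments zeta1 R {S} M I m _.

(* Main.v *)
Require Import Defs.
From mathcomp Require Import all_boot all_order all_algebra.
From mathcomp Require Import complex ring lra zify.
From mathcomp Require Import all_classical all_reals all_analysis.

Set Implicit Arguments.
Unset Strict Implicit.
Unset Printing Implicit Defensive.

Import Order.TTheory GRing.Theory Num.Theory.
Import numFieldNormedType.Exports.

Local Open Scope classical_set_scope.
Local Open Scope ring_scope.
Local Open Scope complex_scope.

(* By Hilbert's argument on gr_I(M), the series of the lengths H n is
   h(t) / (1 - t)^d for some d, so chi_M agrees for large n with a polynomial P.
   Instead of proving that deg P = m, compare both sides in the two cases.
   If deg P > m, no numerator exists over (1 - t)^m, and the Dirichlet series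
   diverges at m + 3/2: both sides are the default value 0.  If deg P <= m, the
   m-th difference of chi_M is eventually m! P_m, which is h(1) for the numerator
   h over (1 - t)^m; and the Dirichlet series is, up to finitely many terms, the
   sum of the P_j zeta(z - j), whose residue at m + 1 is P_m.  The zeta function
   is continued through eta(s) = (1 - 2^(1 - s)) zeta(s) and Euler's transform.

   The extension selected by the definition of zeta1 is arbitrary, hence the
   identity theorem is needed for functions that are only assumed to be complex
   differentiable: Goursat's lemma gives a primitive, and a primitive is twice
   differentiable, which is enough for an elementary four-point maximum
   principle. *)

(** * The Hilbert series of [gr_I(M)] *)

(** No quotient module is formed. [gr_I(M)] is the pair of families [I ^ n M] and [I ^ (n + 1) M] of
    submodules of [M], and a graded subquotient is any pair of families stable under the generators
    of [I]. The kernel and the cokernel of multiplication by a generator are again such pairs, so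
    the induction on the number of generators never leaves [M]. Finite generation over the
    polynomial ring becomes the property that every intermediate stable family is generated in
    bounded degrees, which both pairs inherit. On the analytic side the only integral is that of a
    continuous function on a real segment: a contour integral is a combination of primitives along
    horizontal and vertical lines. The maximum principle is proved on squares and used on discs,
    which costs constant factors in the radii. They are harmless: the principle is applied to
    functions containing an [n]-th power, and a factor independent of [n] disappears in the limit.
    In this way it yields the identity theorem, and Lipschitz estimates that play the part of
    Cauchy's. *)

Section Submodules.
Variables (S : comNzRingType) (M : lmodType S).
Implicit Types (A B C N P : set M) (x a : S) (u v : M) (xs : seq S).

Lemma submoduleP N :
  submodule N <-> N 0 /\ forall a u v, N u -> N v -> N (a *: u + v).
Proof.
split=> [[N0 Nl]|[N0 Nl]]; split.
- by move: N0; rewrite inE.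
- by move=> a u v Nu Nv; have := Nl a u v; rewrite !inE; apply.
- by rewrite inE.
- by move=> a u v; rewrite !inE; exact: Nl.
Qed.

Lemma submodule0 N : submodule N -> N 0.
Proof. by case/submoduleP. Qed.

Lemma submoduleD N u v : submodule N -> N u -> N v -> N (u + v).
Proof. by case/submoduleP=> _ h Nu Nv; rewrite -[u]scale1r; apply: h. Qed.

Lemma submoduleZ N a u : submodule N -> N u -> N (a *: u).
Proof. by case/submoduleP=> N0 h Nu; rewrite -[_ *: _]addr0; apply: h. Qed.

Lemma submoduleB N u v : submodule N -> N u -> N v -> N (u - v).
Proof.
by move=> sN Nu Nv; apply: submoduleD => //; rewrite -scaleN1r; apply: submoduleZ.
Qed.

Lemma submoduleT : submodule [set: M].
Proof. by apply/submoduleP. Qed.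

Lemma submoduleI N P : submodule N -> submodule P -> submodule (N `&` P).
Proof.
move=> /submoduleP[N0 Nl] /submoduleP[P0 Pl]; apply/submoduleP; split=> // a u v.
by move=> [? ?] [? ?]; split; [apply: Nl|apply: Pl].
Qed.

Lemma submodule_spanP (X : set M) : submodule (submodule_span X).
Proof.
apply/submoduleP; split=> [N [/submodule0]//|a u v hu hv N [sN XN]].
by apply: submoduleD => //; [apply: submoduleZ => //; apply: hu|apply: hv].
Qed.

Lemma submodule_span_sub (X : set M) N :
  submodule N -> X `<=` N -> submodule_span X `<=` N.
Proof. by move=> sN XN u; apply. Qed.

Lemma sub_submodule_span (X : set M) : X `<=` submodule_span X.
Proof. by move=> u Xu N [_]; apply. Qed.

Definition addm A B : set M := [set u + v | u in A & v in B].
Definition scm x A : set M := [set x *: u | u in A].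
Definition cycm u : set M := [set a *: u | a in [set: S]].
(** The product of [A] with the ideal spanned by [xs], when [A] is a submodule; the recursion lets
    inclusions be checked one generator at a time. *)
Definition mspan xs A : set M := foldr (fun x D => addm (scm x A) D) [set 0] xs.
Definition lspan (s : seq M) : set M :=
  foldr (fun u D => addm (cycm u) D) [set 0] s.

Lemma submodule_0 : submodule [set (0 : M)].
Proof.
by apply/submoduleP; split=> // a u v -> ->; rewrite scaler0 addr0.
Qed.

Lemma addm_submodule A B : submodule A -> submodule B -> submodule (addm A B).
Proof.
move=> sA sB; apply/submoduleP; split.
  by exists 0; [exact: submodule0|exists 0; [exact: submodule0|rewrite addr0]].
move=> a _ _ [u Au [v Bv <-]] [u' Au' [v' Bv' <-]].
exists (a *: u + u'); first by apply: submoduleD => //; apply: submoduleZ.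
exists (a *: v + v'); first by apply: submoduleD => //; apply: submoduleZ.
by rewrite scalerDr addrACA.
Qed.

Lemma scm_submodule x A : submodule A -> submodule (scm x A).
Proof.
move=> sA; apply/submoduleP; split.
  by exists 0; [exact: submodule0|rewrite scaler0].
move=> a _ _ [u Au <-] [v Av <-]; exists (a *: u + v).
  by apply: submoduleD => //; apply: submoduleZ.
by rewrite scalerDr !scalerA mulrC.
Qed.

Lemma cycm_submodule u : submodule (cycm u).
Proof.
apply/submoduleP; split; first by exists 0 => //; rewrite scale0r.
by move=> a _ _ [b _ <-] [c _ <-]; exists (a * b + c) => //;
  rewrite scalerDl scalerA.
Qed.

Lemma mspan_submodule xs A : submodule A -> submodule (mspan xs A).
Proof.
move=> sA; elim: xs => [|x xs IH] /=; first exact: submodule_0.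
by apply: addm_submodule => //; apply: scm_submodule.
Qed.

Lemma lspan_submodule s : submodule (lspan s).
Proof.
elim: s => [|u s IH] /=; first exact: submodule_0.
by apply: addm_submodule => //; apply: cycm_submodule.
Qed.

Lemma addm_subl A B : submodule B -> A `<=` addm A B.
Proof. by move=> sB u Au; exists u => //; exists 0; rewrite ?addr0//; apply: submodule0. Qed.

Lemma addm_subr A B : submodule A -> B `<=` addm A B.
Proof. by move=> sA u Au; exists 0; [apply: submodule0|exists u; rewrite ?add0r]. Qed.

Lemma addm_sub A B C : submodule C -> A `<=` C -> B `<=` C -> addm A B `<=` C.
Proof.
by move=> sC hA hB _ [u Au [v Bv <-]]; apply: submoduleD => //; [apply: hA|apply: hB].
Qed.

Lemma addmS A A' B B' : A `<=` A' -> B `<=` B' -> addm A B `<=` addm A' B'.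
Proof.
by move=> hA hB _ [u Au [v Bv <-]]; exists u; [apply: hA|exists v => //; apply: hB].
Qed.

Lemma scmS x A A' : A `<=` A' -> scm x A `<=` scm x A'.
Proof. by move=> AA _ [u Au <-]; exists u => //; apply: AA. Qed.

Lemma mspan_sub xs A C : submodule C ->
  (forall x, x \in xs -> scm x A `<=` C) -> mspan xs A `<=` C.
Proof.
move=> sC; elim: xs => [|x xs IH] h /=; first by move=> _ ->; exact: submodule0.
apply: addm_sub => //; first by apply: h; rewrite mem_head.
by apply: IH => y ys; apply: h; rewrite inE ys orbT.
Qed.

Lemma sub_mspan xs x A : submodule A -> x \in xs -> scm x A `<=` mspan xs A.
Proof.
move=> sA; elim: xs => //= y xs IH; rewrite inE => /orP[/eqP ->|xs_x].
  by apply: addm_subl; exact: mspan_submodule.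
apply: subset_trans (IH xs_x) _.
by apply: addm_subr; apply: scm_submodule.
Qed.

Lemma mem_cycm u : cycm u u.
Proof. by exists 1 => //; rewrite scale1r. Qed.

Lemma mem_lspan s u : u \in s -> lspan s u.
Proof.
elim: s => //= v s IH; rewrite inE => /orP[/eqP ->|us].
  by apply: addm_subl; [exact: lspan_submodule|exact: mem_cycm].
by apply: addm_subr; [exact: cycm_submodule|exact: IH].
Qed.

Lemma lspan_sub s N : submodule N -> (forall u, u \in s -> N u) -> lspan s `<=` N.
Proof.
move=> sN; elim: s => [|v s IH] h /=; first by move=> _ ->; exact: submodule0.
apply: addm_sub => //.
  by move=> _ [a _ <-]; apply: submoduleZ => //; apply: h; rewrite mem_head.
by apply: IH => u us; apply: h; rewrite inE us orbT.
Qed.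

Lemma submodule_spanE s : submodule_span [set` s] = lspan s.
Proof.
apply/seteqP; split.
  by apply: submodule_span_sub; [exact: lspan_submodule|move=> u /= /mem_lspan].
apply: lspan_sub; first exact: submodule_spanP.
by move=> u us; apply: sub_submodule_span.
Qed.

End Submodules.

(** * Finitely generated modules over a noetherian ring *)

Section NoetherianModules.
Variables (S : comNzRingType) (M : lmodType S).
Implicit Types (N : set M) (xs : seq S).

Definition noeth_module := forall N, submodule N -> exists s, N = lspan s.

(** The coefficients of [u] in the elements of [N], modulo the span of [s], form an ideal [L].
    Generators of [N] are lifts of generators of [L], together with generators of [N] intersected
    with the span of [s]. *)
Lemma noeth_fg_submodule : noetherian_ring S ->
  forall (s : seq M) N, submodule N -> N `<=` lspan s -> exists t, N = lspan t.
Proof.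
move=> noeS; elim=> [|u s IH] N sN Ns.
  exists [::]; apply/seteqP; split=> //= v ->; exact: submodule0.
pose L : set S := [set a | exists2 v, lspan s v & N (a *: u + v)].
have sL : @submodule S S^o L.
  apply/(@submoduleP S S^o); split.
    exists 0; first by apply: submodule0; exact: lspan_submodule.
    by rewrite scale0r addr0; exact: submodule0.
  move=> a b c [v sv Nv] [w sw Nw]; exists (a *: v + w).
    apply: submoduleD => //; first exact: lspan_submodule.
    by apply: submoduleZ => //; exact: lspan_submodule.
  have -> : (a *: (b : S^o) + c) *: u + (a *: v + w) =
      a *: (b *: u + v) + (c *: u + w).
    by rewrite scalerDl scalerDr scalerA addrACA.
  by apply: submoduleD => //; exact: submoduleZ.
have [l Ll] := noeS L sL.
rewrite (@submodule_spanE S S^o) in Ll.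
have [t Nt] : exists t, N `&` lspan s = lspan t.
  by apply: IH; [apply: submoduleI => //; exact: lspan_submodule|move=> v []].
(* [r] lifts the generators of [L] to [N]: every element of [L] is the coefficient of [u] in some
   element of the span of [r]. *)
have [r [rN rP]] : exists r : seq M, (forall v, v \in r -> N v) /\
    forall a, @lspan S S^o l a ->
      exists2 v, lspan r v & exists2 w, lspan s w & v = a *: u + w.
  have : forall a, a \in l -> L a by move=> a al; rewrite Ll; apply: mem_lspan.
  elim: l {Ll} => [|b l IHl] lL.
    exists [::]; split=> // a /= ->; exists 0 => //; exists 0.
      by apply: submodule0; exact: lspan_submodule.
    by rewrite scale0r addr0.
  have [|r [rN rP]] := IHl; first by move=> a al; apply: lL; rewrite inE al orbT.
  have [w sw Nw] := lL b (mem_head _ _).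
  exists ((b *: u + w) :: r); split.
    by move=> v; rewrite inE => /orP[/eqP -> //|]; apply: rN.
  move=> _ [_ [c _ <-] [d ld <-]].
  have [v rv [w' sw' vE]] := rP d ld.
  exists (c *: (b *: u + w) + v).
    exists (c *: (b *: u + w)); first by exists c.
    by exists v.
  exists (c *: w + w').
    apply: submoduleD => //; first exact: lspan_submodule.
    by apply: submoduleZ => //; exact: lspan_submodule.
  by rewrite vE scalerDl scalerDr scalerA addrACA.
exists (r ++ t).
apply/seteqP; split; last first.
  apply: lspan_sub => // v; rewrite mem_cat => /orP[/rN//|/mem_lspan].
  by rewrite -Nt => -[].
move=> n Nn; have [_ [a _ <-] [w sw nE]] := Ns n Nn.
have La : L a by exists w => //; rewrite nE.
rewrite Ll in La; have [v rv [w' sw' vE]] := rP a La.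
have Nv : N v by move: rv; apply: lspan_sub.
have rtS : submodule (lspan (r ++ t)) by exact: lspan_submodule.
have -> : n = v + (n - v) by rewrite addrC subrK.
apply: submoduleD => //.
  by move: rv; apply: lspan_sub => // z zr; apply: mem_lspan; rewrite mem_cat zr.
have : lspan t (n - v).
  rewrite -Nt; split; first exact: submoduleB.
  rewrite -nE vE opprD addrACA subrr add0r.
  by apply: submoduleB => //; exact: lspan_submodule.
by apply: lspan_sub => // z zt; apply: mem_lspan; rewrite mem_cat zt orbT.
Qed.

Lemma noeth_fg : noetherian_ring S -> finitely_generated M -> noeth_module.
Proof.
move=> noeS [s sT] N sN; apply: (noeth_fg_submodule noeS (s := s)) => //.
by rewrite -submodule_spanE sT.
Qed.

Lemma noeth_acc (N_ : nat -> set M) : noeth_module ->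
  (forall k, submodule (N_ k)) -> (forall k, N_ k `<=` N_ k.+1) ->
  exists k0, forall k, N_ k `<=` N_ k0.
Proof.
move=> noeM sN incN.
have mono k l : (k <= l)%N -> N_ k `<=` N_ l.
  elim: l => [|l IH]; first by rewrite leqn0 => /eqP ->.
  rewrite leq_eqVlt => /orP[/eqP -> //|]; rewrite ltnS => /IH kl.
  exact: subset_trans (incN l).
pose U := \bigcup_k N_ k.
have sU : submodule U.
  apply/submoduleP; split; first by exists 0%N => //; apply: submodule0.
  move=> a u v [k _ Nu] [l _ Nv]; exists (maxn k l) => //.
  apply: submoduleD => //.
    by apply: submoduleZ => //; apply: (mono k) => //; exact: leq_maxl.
  by apply: (mono l) => //; exact: leq_maxr.
have [s Us] := noeM U sU.
have [k0 hk0] : exists k0, forall u, u \in s -> N_ k0 u.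
  have : forall u, u \in s -> U u by move=> u us; rewrite Us; apply: mem_lspan.
  elim: s {Us} => [|u s IH] h; first by exists 0%N.
  have [v vs|k hk] := IH; first by apply: h; rewrite inE vs orbT.
  have [l _ Nu] := h u (mem_head _ _); exists (maxn k l) => v.
  rewrite inE => /orP[/eqP ->|/hk Nv].
    by apply: (mono l) => //; exact: leq_maxr.
  by apply: (mono k) => //; exact: leq_maxl.
exists k0 => k; apply: (@subset_trans _ U); first by move=> u Nu; exists k.
by rewrite Us; apply: lspan_sub.
Qed.

End NoetherianModules.

(** * Graded modules over polynomial rings, as families of submodules *)

Section GradedNoetherian.
Variables (S : comNzRingType) (M : lmodType S).
Implicit Types (x a : S) (u v : M) (xs : seq S).

(** A graded module over a polynomial ring over [S], whose variables act as the elements of [xs] and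
    raise the degree by one. *)
Definition stable_family xs (C : nat -> set M) :=
  (forall n, submodule (C n)) /\
  (forall x, x \in xs -> forall n, scm x (C n) `<=` C n.+1).

(** Noetherianity of the graded module with components [A n / B n], reduced to its graded part:
    every graded submodule is generated in bounded degrees. Finiteness within one degree is the
    business of [noeth_module]. *)
Definition graded_noeth xs (A B : nat -> set M) := forall C,
  stable_family xs C -> (forall n, B n `<=` C n) -> (forall n, C n `<=` A n) ->
  exists n0, forall n, (n0 <= n)%N ->
    C n.+1 `<=` addm (mspan xs (C n)) (B n.+1).

(* [rees xs n] is [J ^ n M] for the ideal [J] spanned by [xs], as the sum of
   the [x ^ k J' ^ (n - k) M] when [xs = x :: xs'] and [xs'] spans [J']. *)
Fixpoint rees xs n : set M :=
  if xs is x :: xs' then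
    (fix F n := if n is n'.+1 then addm (rees xs' n) (scm x (F n'))
                else rees xs' 0) n
  else if n is 0 then [set: M] else [set 0].

Lemma rees_consS x xs n :
  rees (x :: xs) n.+1 = addm (rees xs n.+1) (scm x (rees (x :: xs) n)).
Proof. by []. Qed.

Lemma rees0 xs : rees xs 0 = [set: M].
Proof. by elim: xs. Qed.

Lemma rees_stable xs : stable_family xs (rees xs).
Proof.
elim: xs => [|x xs [sX hX]].
  by split=> // -[|n]; [exact: submoduleT|exact: submodule_0].
have sR n : submodule (rees (x :: xs) n).
  elim: n => [|n IH]; first by rewrite rees0; exact: submoduleT.
  by rewrite rees_consS; apply: addm_submodule => //; exact: scm_submodule.
split=> // y; rewrite inE => /predU1P[->|yxs] n.
  by rewrite rees_consS; apply: addm_subr.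
elim: n => [|n IH].
  rewrite rees0 rees_consS; apply: (subset_trans _ (addm_subl _)); last first.
    by apply: scm_submodule; rewrite rees0; exact: submoduleT.
  have := hX y yxs 0%N; rewrite rees0; exact.
rewrite 2!rees_consS => _ [_ [u Xu [_ [v Rv <-] <-]] <-].
exists (y *: u); first by apply: (hX y yxs); exists u.
exists (x *: (y *: v)); first by exists (y *: v) => //; apply: IH; exists v.
by rewrite scalerDr !scalerA mulrC.
Qed.

(** The union of the chain is a stable family, hence generated in degrees at most some [n0]. The
    finitely many degrees up to [n0] become stationary at a common index, and the higher degrees
    follow by generation. *)
Lemma graded_acc xs (A : nat -> set M) (L : nat -> nat -> set M) :
  noeth_module M -> graded_noeth xs A (fun=> [set 0]) ->
  (forall k, stable_family xs (L k)) -> (forall k n, L k n `<=` A n) ->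
  (forall k n, L k n `<=` L k.+1 n) -> exists k0, forall k n, L k n `<=` L k0 n.
Proof.
move=> noeM EG sL LA incL.
have mono k l n : (k <= l)%N -> L k n `<=` L l n.
  elim: l => [|l IH]; first by rewrite leqn0 => /eqP ->.
  rewrite leq_eqVlt => /orP[/eqP -> //|]; rewrite ltnS => /IH.
  by move/subset_trans; apply; exact: incL.
have stab n : exists k0, forall k, L k n `<=` L k0 n.
  by apply: noeth_acc => // k; have [] := sL k.
pose U n := \bigcup_k L k n.
have sU : stable_family xs U.
  split=> [n|x xxs n _ [u [k _ Lu] <-]].
    have [k0 hk0] := stab n.
    suff -> : U n = L k0 n by have [] := sL k0.
    by apply/seteqP; split=> u; [move=> [k _ /hk0]|exists k0].
  by exists k => //; have [_ h] := sL k; apply: (h x xxs); exists u.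
have [||n0 hn0] := EG U sU.
- by move=> n _ ->; exists 0%N => //; apply: submodule0; have [] := sL 0%N.
- by move=> n u [k _ /LA].
have [k0 hk0] : exists k0, forall n, (n <= n0)%N -> forall k, L k n `<=` L k0 n.
  elim: n0 {hn0} => [|n [k1 hk1]].
    by have [k0 hk0] := stab 0%N; exists k0 => n; rewrite leqn0 => /eqP ->.
  have [k2 hk2] := stab n.+1; exists (maxn k1 k2) => m.
  rewrite leq_eqVlt ltnS => /orP[/eqP ->|mn] k.
    by apply: (subset_trans _ (mono k2 _ _ (leq_maxr _ _))); exact: hk2.
  by apply: (subset_trans _ (mono k1 _ _ (leq_maxl _ _))); exact: hk1.
exists k0 => k n.
have [nn0|nn0] := leqP n n0; first exact: hk0.
apply: (@subset_trans _ (U n)); first by move=> u Lu; exists k.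
rewrite -(subnKC (ltnW nn0)); elim: (n - n0)%N => [|d IH].
  by rewrite addn0 => u [l _]; apply: hk0.
rewrite addnS; apply: subset_trans (hn0 _ (leq_addr _ _)) _.
have [sk hk] := sL k0.
apply: addm_sub => //; last by move=> _ ->; apply: submodule0.
apply: mspan_sub => // x xxs.
by apply: (subset_trans _ (hk x xxs _)); apply: scmS.
Qed.

(* Hilbert's basis theorem.  Filter [rees (x :: xs) n] by the degree in [x],
   [F k n] being the part of degree less than [k]; [L k] collects the leading
   coefficients of the elements of degree [k] of a stable family [C]. *)
Lemma rees_noeth xs : noeth_module M -> graded_noeth xs (rees xs) (fun=> [set 0]).
Proof.
move=> noeM; elim: xs => [|x xs IH] C [sC hC] C0 CR.
  exists 0%N => n _ u /CR /= ->; exists 0 => //; exists 0 => //.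
  by rewrite addr0.
have [sX hX] := rees_stable xs.
pose F := fix F k n : set M := if k is k'.+1 then
  (if n is n'.+1 then addm (rees xs n) (scm x (F k' n')) else rees xs 0)
  else [set 0].
have sF k n : submodule (F k n).
  elim: k n => [|k IHk] [|n] /=; try exact: submodule_0.
    by rewrite rees0; exact: submoduleT.
  by apply: addm_submodule => //; exact: scm_submodule.
have Fxs k y n : y \in xs -> scm y (F k n) `<=` F k n.+1.
  move=> yxs; elim: k n => [|k IHk] n.
    by move=> _ [u -> <-] /=; rewrite scaler0.
  case: n => [|n] /=.
    apply: (subset_trans _ (addm_subl _)); first exact: hX.
    exact: scm_submodule.
  move=> _ [_ [u Xu [_ [v Rv <-] <-]] <-].
  exists (y *: u); first by apply: (hX y yxs); exists u.
  exists (x *: (y *: v)); first by exists (y *: v) => //; apply: IHk; exists v.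
  by rewrite scalerDr !scalerA mulrC.
have Fx k n : scm x (F k n) `<=` F k.+1 n.+1 by apply: addm_subr.
have RF n : rees (x :: xs) n `<=` F n.+1 n.
  elim: n => [//|n IHn]; rewrite rees_consS.
  by apply: addmS => //; exact: scmS.
(* an element of degree [k] is [x ^ k] times its leading coefficient, up to
   lower degree; when [n < k] there is no leading coefficient *)
have Flead k n u : F k.+1 n u -> (n < k)%N /\ F k n u \/
    exists d, n = (d + k)%N /\ exists2 a, rees xs d a & F k n (u - x ^+ k *: a).
  elim: k n u => [|k IHk] [|n] u.
  - move=> Xu; right; exists 0%N; split=> //; exists u => //.
    by rewrite expr0 scale1r subrr.
  - move=> [v Xv [_ [_ -> <-] <-]]; right; exists n.+1; rewrite addn0; split=> //.
    exists v => //; by rewrite scaler0 addr0 expr0 scale1r subrr.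
  - by move=> Xu; left.
  - move=> [v Xv [_ [w Fw <-] <-]].
    case: (IHk _ _ Fw) => [[nk Fkw]|[d [nE [a Xa Fa]]]].
      by left; split=> //; exists v => //; exists (x *: w) => //; exists w.
    right; exists d; split; first by rewrite nE addnS.
    exists a => //; exists v => //.
    exists (x *: (w - x ^+ k *: a)); first by exists (w - x ^+ k *: a).
    by rewrite scalerBr scalerA -exprS addrA.
pose L k n : set M :=
  rees xs n `&` [set a | addm (C (n + k)%N) (F k (n + k)%N) (x ^+ k *: a)].
have sCF k n : submodule (addm (C n) (F k n)) by apply: addm_submodule.
have xpow k a u : x ^+ k *: (a *: u) = a *: (x ^+ k *: u).
  by rewrite !scalerA mulrC.
have xsX y : y \in xs -> y \in x :: xs by rewrite inE => ->; rewrite orbT.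
have sL k : stable_family xs (L k).
  split=> [n|y yxs n _ [u [Xu [c Cc [f Ff cf]]] <-]].
    apply: submoduleI => //; apply/submoduleP; split.
      by rewrite /= scaler0; exact: submodule0.
    move=> a u v /= hu hv; rewrite scalerDr xpow.
    by apply: submoduleD => //; exact: submoduleZ.
  split; first by apply: (hX y yxs); exists u.
  rewrite /= xpow -cf scalerDr; exists (y *: c).
    by apply: (hC y (xsX _ yxs) (n + k)%N); exists c.
  by exists (y *: f) => //; apply: (Fxs k y _ yxs); exists f.
have incL k n : L k n `<=` L k.+1 n.
  move=> u [Xu [c Cc [f Ff cf]]]; split=> //=.
  rewrite exprS -scalerA -cf scalerDr addnS; exists (x *: c).
    by apply: (hC x (mem_head _ _) (n + k)%N); exists c.
  by exists (x *: f) => //; apply: Fx; exists f.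
have LX k n : L k n `<=` rees xs n by move=> u [].
have [k0 hk0] := graded_acc noeM IH sL LX incL.
(* By the choice of [k0] only finitely many of the families [L k] matter, so that one degree bound
   serves them all. *)
have [N hN] : exists N, forall k, (k <= k0)%N -> forall n, (N <= n)%N ->
    L k n.+1 `<=` mspan xs (L k n).
  have EG k : exists n0, forall n, (n0 <= n)%N -> L k n.+1 `<=` mspan xs (L k n).
    have [|n0 hn0] := IH (L k) (sL k) _ (LX k).
      by move=> n _ ->; apply: submodule0; have [] := sL k.
    exists n0 => n /hn0 h; apply: subset_trans h _.
    have sm : submodule (mspan xs (L k n)).
      by apply: mspan_submodule; have [] := sL k.
    by apply: addm_sub => // _ ->; exact: submodule0.
  elim: k0 {hk0} => [|k [N1 hN1]].
    by have [N hN] := EG 0%N; exists N => k; rewrite leqn0 => /eqP ->.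
  have [N2 hN2] := EG k.+1; exists (maxn N1 N2) => l.
  rewrite leq_eqVlt ltnS => /orP[/eqP ->|lk] n.
    by rewrite geq_max => /andP[_]; exact: hN2.
  by rewrite geq_max => /andP[n1 _]; exact: hN1.
(* For an element of [C n.+1] with leading degree [k <= k0] in [x], the leading coefficient has
   degree [n + 1 - k > N], where [L k] is generated by its preceding degree. *)
exists (N + k0)%N => n hn.
set G := mspan (x :: xs) (C n).
have sG : submodule G by exact: mspan_submodule.
have GC : G `<=` C n.+1 by apply: mspan_sub => // y /hC; exact.
suff CF k c : C n.+1 c -> F k n.+1 c -> G c.
  move=> c Cc; exists c; last by exists 0 => //; rewrite addr0.
  by apply: (CF n.+2) => //; apply: RF; exact: CR.
elim: k c => [|k IHk] c Cc; first by move=> ->; exact: submodule0.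
case/Flead => [[_]|[d [nE [a Xa Fa]]]]; first exact: IHk.
(* It suffices to find in [G] an element with the leading term of [c]: the difference has smaller
   degree in [x]. *)
suff [g Gg Fg] : exists2 g, G g & F k n.+1 (c - g).
  rewrite -[c](subrK g); apply: submoduleD => //.
  by apply: IHk => //; apply: submoduleB => //; exact: GC.
have La : L k d a.
  split=> //=; rewrite -nE; exists c => //.
  exists (x ^+ k *: a - c); last by rewrite addrC subrK.
  by rewrite -opprB -scaleN1r; exact: submoduleZ.
have [kk0|kk0] := leqP k k0.
  have dE : d = d.-1.+1 by lia.
  have nE' : n = (d.-1 + k)%N by lia.
  rewrite dE in La; have Nd : (N <= d.-1)%N by lia.
  have /= La' := hN k kk0 _ Nd _ La.
  suff [g Gg Fg] : exists2 g, G g & F k n.+1 (x ^+ k *: a - g).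
    exists g => //; rewrite -[c](subrK (x ^+ k *: a)) -addrA.
    exact: submoduleD.
  pose W : set M := [set b | exists2 g, G g & F k n.+1 (x ^+ k *: b - g)].
  suff : mspan xs (L k d.-1) `<=` W by apply.
  apply: mspan_sub.
    apply/submoduleP; split.
      by exists 0; [exact: submodule0|rewrite scaler0 subr0; exact: submodule0].
    move=> b u v [g Gg Fg] [g' Gg' Fg']; exists (b *: g + g').
      by apply: submoduleD => //; exact: submoduleZ.
    rewrite scalerDr xpow opprD addrACA -scalerBr.
    by apply: submoduleD => //; exact: submoduleZ.
  move=> y yxs _ [b [Xb [e Ce [f Ff ef]]] <-]; exists (y *: e).
    apply: (@sub_mspan _ _ (x :: xs) y) => //; first exact: xsX.
    by exists e => //; rewrite nE'.
  rewrite xpow -ef scalerDr addrAC subrr add0r nE'.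
  by apply: (Fxs k y _ yxs); exists f.
(* Beyond [k0] the chain is stationary: [a] is already the leading coefficient of some [e] in [C n]
   whose degree in [x] is one less, and [x *: e] has the required leading term. *)
case: k => // k in IHk Fa La nE kk0 *.
have [_ [e Ce [f Ff ef]]] : L k d a.
  have : L k0 d a by exact: hk0 La.
  have : (k0 <= k)%N by [].
  elim: (k) => [|j IHj]; first by rewrite leqn0 => /eqP ->.
  by rewrite leq_eqVlt ltnS => /orP[/eqP -> //|/IHj h /h]; exact: incL.
have nE' : n = (d + k)%N by lia.
exists (x *: e).
  apply: (@sub_mspan _ _ (x :: xs) x) => //; first exact: mem_head.
  by exists e => //; rewrite nE'.
rewrite -[c](subrK (x ^+ k.+1 *: a)) -addrA; apply: submoduleD => //.
rewrite exprS -scalerA -ef scalerDr addrAC subrr add0r nE'.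
by apply: Fx; exists f.
Qed.

Lemma graded_noeth_sub xs (A A' B : nat -> set M) :
  graded_noeth xs A (fun=> [set 0]) -> (forall n, A' n `<=` A n) ->
  (forall n, submodule (B n)) -> graded_noeth xs A' B.
Proof.
move=> EG AA sB C sC BC CA.
have [||n0 hn0] := EG C sC.
- by move=> n _ ->; apply: submodule0; have [] := sC.
- by move=> n; apply: subset_trans (CA n) _.
exists n0 => n /hn0 h; apply: subset_trans h _.
by apply: addmS => // _ ->; exact: submodule0.
Qed.

End GradedNoetherian.

(** * Maximal lengths of chains of sets *)

Section Chains.
Variable T : Type.
Implicit Types (F : set (set T)) (X Y : set T).

(** The top of the chain is recorded so that the chain can be prolonged. *)
Definition chain_to F n X := exists C : nat -> set T,
  [/\ forall i, (i <= n)%N -> F (C i), forall i, (i < n)%N -> C i `<` C i.+1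
    & C n = X].

Lemma chain_toW F n X : chain_to F n X -> has_chain F n.
Proof. by move=> [C [CF Clt _]]; exists C. Qed.

Lemma chain_to0 F X : F X -> chain_to F 0 X.
Proof. by move=> FX; exists (fun=> X). Qed.

Lemma chain_toS F n X Y : chain_to F n X -> F Y -> X `<` Y -> chain_to F n.+1 Y.
Proof.
move=> [C [CF Clt CX]] FY XY.
exists (fun i => if (i <= n)%N then C i else Y); split=> [i _|i|].
- by case: ifP => // ?; exact: CF.
- rewrite ltnS => ilen; have := ilen.
  rewrite {1}leq_eqVlt => /orP[/eqP ->|iltn]; first by rewrite /= leqnn ltnn CX.
  by rewrite /= (ltnW iltn) iltn; exact: Clt.
- by rewrite /= ltnn.
Qed.

Lemma has_chain0 F X : F X -> has_chain F 0.
Proof. by move=> /chain_to0 /chain_toW. Qed.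

Lemma has_chainW F m n : (m <= n)%N -> has_chain F n -> has_chain F m.
Proof.
move=> mn [C [CF Clt]]; exists C; split=> i im; first by apply: CF; lia.
by apply: Clt; lia.
Qed.

Lemma max_chain_length_uniq F m n :
  max_chain_length F m -> max_chain_length F n -> m = n.
Proof.
move=> [cm hm] [cn hn]; apply/eqP; rewrite eqn_leq.
by apply/andP; split; [exact: hn|exact: hm].
Qed.

Lemma max_chain_length_bounded F X (n : nat) : F X ->
  (forall k, has_chain F k -> (k <= n)%N) ->
  exists m, max_chain_length F m.
Proof.
move=> FX; elim: n => [|n IH] h.
  by exists 0%N; split=> //; exact: has_chain0 FX.
have [hn|hn] := pselect (has_chain F n.+1); first by exists n.+1.
apply: IH => k hk; rewrite leqNgt; apply/negP => nk.
by apply: hn; exact: has_chainW hk.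
Qed.

(** Each of the two strictly increasing maps carries chains to chains of the same length, so neither
    family has longer chains than the other. *)
Lemma max_chain_length_transfer (U : Type) F (G : set (set U))
    (f : set T -> set U) (g : set U -> set T) (n : nat) :
  (forall X, F X -> G (f X)) -> (forall Z, G Z -> F (g Z)) ->
  (forall X Y, F X -> F Y -> X `<` Y -> f X `<` f Y) ->
  (forall Z W, G Z -> G W -> Z `<` W -> g Z `<` g W) ->
  max_chain_length F n -> max_chain_length G n.
Proof.
move=> FG GF fS gS [[C [CF Clt]] maxn]; split.
  exists (f \o C); split=> i ilt /=; first by apply: FG; exact: CF.
  by apply: fS; [apply: CF; lia|apply: CF; lia|exact: Clt].
move=> k [D [DG Dlt]]; apply: maxn; exists (g \o D); split=> i ilt /=.
  by apply: GF; exact: DG.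
by apply: gS; [apply: DG; lia|apply: DG; lia|exact: Dlt].
Qed.

End Chains.

(** * Lengths of subquotients *)

Section Lengths.
Variables (S : comNzRingType) (M : lmodType S).
Implicit Types (A B C P : set M) (x a : S) (u v : M).

Definition between A B : set (set M) :=
  [set N | submodule N /\ B `<=` N /\ N `<=` A].

Definition len A B n := max_chain_length (between A B) n.
Definition finlen A B := exists n, len A B n.

Lemma len_subquotient A B n : len A B n -> subquotient_length A B = n.
Proof.
move=> h; apply: (@max_chain_length_uniq _ (between A B)) => //.
by rewrite /subquotient_length; apply: xgetPex; exists n.
Qed.

Lemma len_refl A : submodule A -> len A A 0.
Proof.
move=> sA; split; first by apply: (@has_chain0 _ _ A); split=> //; split.
case=> [//|k [C [CF /(_ 0%N isT) [_ []]]]].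
have [_ [_ h]] := CF 1%N isT; have [_ [h' _]] := CF 0%N isT.
exact: subset_trans h h'.
Qed.

(* By the modular law, a strict inclusion remains strict after intersecting with
   [C] or after adding [C]. *)
Lemma chain_split A B C k (N : nat -> set M) :
  submodule A -> submodule B -> submodule C -> B `<=` C -> C `<=` A ->
  (forall i, (i <= k)%N -> between A B (N i)) ->
  (forall i, (i < k)%N -> N i `<` N i.+1) ->
  exists i j, [/\ (k <= i + j)%N, chain_to (between C B) i (N k `&` C)
     & chain_to (between A C) j (addm (N k) C)].
Proof.
move=> sA sB sC BC CA NF Nlt.
have bI i : (i <= k)%N -> between C B (N i `&` C).
  move=> /NF[sN [BN NA]]; split; first exact: submoduleI.
  by split=> [u Bu|u []//]; split; [exact: BN|exact: BC].
have bD i : (i <= k)%N -> between A C (addm (N i) C).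
  move=> /NF[sN [BN NA]]; split; first exact: addm_submodule.
  by split; [exact: addm_subr|exact: addm_sub].
suff H : forall l, (l <= k)%N ->
    exists i j, [/\ (l <= i + j)%N, chain_to (between C B) i (N l `&` C)
     & chain_to (between A C) j (addm (N l) C)] by exact: H.
elim=> [|l IH] lk.
  exists 0%N, 0%N; split=> //; apply: chain_to0; [exact: bI|exact: bD].
have [i [j [lij ci cj]]] := IH (ltnW lk).
have [sub nsub] := Nlt l lk.
have [sN1 _] := NF _ (ltnW lk); have [sN2 _] := NF _ lk.
have subI : N l `&` C `<=` N l.+1 `&` C by move=> u [/sub ? ?].
have subD : addm (N l) C `<=` addm (N l.+1) C by apply: addmS.
have [eqI|neI] := pselect (N l.+1 `&` C `<=` N l `&` C); last first.
  have ci' : chain_to (between C B) i.+1 (N l.+1 `&` C).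
    by apply: chain_toS ci _ _; [exact: bI|split].
  have [eqD|neD] := pselect (addm (N l.+1) C `<=` addm (N l) C).
    exists i.+1, j; split=> //.
    by have -> : addm (N l.+1) C = addm (N l) C by apply/seteqP; split.
  exists i.+1, j.+1; split=> //; first by lia.
  by apply: chain_toS cj _ _; [exact: bD|split].
have eqI' : N l.+1 `&` C = N l `&` C by apply/seteqP; split.
exists i, j.+1; split; [by lia|by rewrite eqI'|].
apply: chain_toS cj _ _; [exact: bD|split=> // subD'; apply: nsub].
move=> u Nu; have [v Nv [w Cw vw]] : addm (N l) C u.
  by apply: subD'; exact: addm_subl.
suff [Nw _] : (N l `&` C) w by rewrite -vw; exact: submoduleD.
apply: eqI; split=> //.
have -> : w = u - v by rewrite -vw addrC addKr.
by apply: submoduleB => //; exact: sub.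
Qed.

(** Chains below and above [C] are glued at [C], which gives one inequality; [chain_split] gives the
    other. *)
Lemma len_add A B C p q : submodule A -> submodule B -> submodule C ->
  B `<=` C -> C `<=` A -> len A C p -> len C B q -> len A B (q + p)%N.
Proof.
move=> sA sB sC BC CA [[Y [YF Ylt]] maxp] [[X [XF Xlt]] maxq]; split.
  exists (fun i => if (i <= q)%N then X i else Y (i - q)%N); split=> i ilt.
    case: leqP => iq.
      by have [? [? h]] := XF i iq; split=> //; split=> //; exact: subset_trans CA.
    have [|? [h ?]] := YF (i - q)%N; first by lia.
    by split=> //; split=> //; exact: subset_trans h.
  case: (ltngtP i q) => iq.
  - exact: Xlt.
  - by rewrite subSn; [apply: Ylt; lia|exact: ltnW].
  - rewrite iq subSn// subnn.
    have p0 : (0 < p)%N by lia.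
    have [_ [_ XC]] := XF q (leqnn q); have [_ [CY _]] := YF 0%N isT.
    have [YY nYY] := Ylt 0%N p0; split.
      by apply: subset_trans XC _; exact: subset_trans YY.
    move=> h; apply: nYY; apply: subset_trans h _; exact: subset_trans CY.
move=> k [N [NF Nlt]].
have [i [j [kij /chain_toW/maxq iq /chain_toW/maxp jp]]] :=
  chain_split sA sB sC BC CA NF Nlt.
by lia.
Qed.

Lemma finlen_trans A B C : submodule A -> submodule B -> submodule C ->
  B `<=` C -> C `<=` A -> finlen A C -> finlen C B -> finlen A B.
Proof.
by move=> sA sB sC BC CA [p hp] [q hq]; exists (q + p)%N; exact: len_add hp hq.
Qed.

Lemma finlen_sub A B C D : submodule C -> submodule D ->
  B `<=` D -> D `<=` C -> C `<=` A -> finlen A B -> finlen C D.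
Proof.
move=> sC sD BD DC CA [n [_ maxn]].
apply: (@max_chain_length_bounded _ _ C n) => [|k [N [NF Nlt]]].
  by split=> //; split.
apply: maxn.
exists N; split=> // i /NF[sN [DN NC]]; split=> //.
by split; [exact: subset_trans DN|exact: subset_trans CA].
Qed.

(** Multiplication by [x] induces an isomorphism from [A / K], with [K] the part of [A] sent into
    [N], onto [(x A + N) / N]. Only its effect on intermediate submodules is used: [f] is the image
    and [g] the preimage. *)
Lemma len_scm A B (N : set M) x n :
  submodule A -> submodule B -> submodule N -> B `<=` A -> scm x B `<=` N ->
  len A (A `&` [set u | N (x *: u)]) n -> len (addm (scm x A) N) N n.
Proof.
move=> sA sB sN BA xBN.
have sK : submodule [set u | N (x *: u)].
  apply/submoduleP; split; first by rewrite /= scaler0; exact: submodule0.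
  move=> a u v /= Nu Nv; rewrite scalerDr scalerA mulrC -scalerA.
  by apply: submoduleD => //; exact: submoduleZ.
set K := A `&` _.
pose f P := addm (scm x P) N; pose g (P : set M) := A `&` [set u | P (x *: u)].
have bf P : between A K P -> between (addm (scm x A) N) N (f P).
  move=> [sP [KP PA]]; split.
    by apply: addm_submodule => //; exact: scm_submodule.
  split; first by apply: addm_subr; exact: scm_submodule.
  by apply: addmS => //; exact: scmS.
have bg P : between (addm (scm x A) N) N P -> between A K (g P).
  move=> [sP [NP PA]]; split.
    apply: submoduleI => //; apply/submoduleP; split.
      by rewrite /= scaler0; exact: submodule0.
    move=> a u v /= Pu Pv; rewrite scalerDr scalerA mulrC -scalerA.
    by apply: submoduleD => //; exact: submoduleZ.
  by split=> [u [Au Nu]|u []//]; split=> //; exact: NP.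
apply: (max_chain_length_transfer bf bg).
  move=> P Q [sP [KP PA]] [sQ [KQ QA]] [PQ nQP]; split.
    by apply: addmS => //; exact: scmS.
  move=> h; apply: nQP => u Qu.
  have [_ [v Pv <-] [w Nw vw]] : f P (x *: u).
    by apply: h; apply: addm_subl => //; exists u.
  rewrite -[u](subrK v); apply: submoduleD => //; apply: KP; split.
    by apply: submoduleB => //; [exact: QA|exact: PA].
  by rewrite /= scalerBr -vw addrC addKr.
move=> P Q [sP [NP PA]] [sQ [NQ QA]] [PQ nQP]; split.
  by move=> u [Au Pu]; split=> //; exact: PQ.
move=> h; apply: nQP => q Qq.
have [_ [u Au <-] [w Nw uw]] := QA q Qq.
rewrite -uw; apply: submoduleD => //; last exact: NP.
have [] // : g P u; apply: h; split=> //=.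
have -> : x *: u = q - w by rewrite -uw addrK.
by apply: submoduleB => //; exact: NQ.
Qed.

End Lengths.

(** * Products of ideals and submodules *)

Section IdealProducts.
Variables (S : comNzRingType) (M : lmodType S).
Implicit Types (J K : set S) (N P : set M).

Lemma ideal_smul_submodule J N : submodule (ideal_smul J N).
Proof. exact: submodule_spanP. Qed.

Lemma mem_ideal_smul J N a u : J a -> N u -> ideal_smul J N (a *: u).
Proof. by move=> Ja Nu; apply: sub_submodule_span; exists a => //; exists u. Qed.

Lemma ideal_smul_sub J N P : submodule P ->
  (forall a u, J a -> N u -> P (a *: u)) -> ideal_smul J N `<=` P.
Proof.
by move=> sP h; apply: submodule_span_sub => // _ [a Ja [u Nu <-]]; exact: h.
Qed.

Lemma ideal_smulS J K N P : J `<=` K -> N `<=` P -> ideal_smul J N `<=` ideal_smul K P.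
Proof.
move=> JK NP; apply: ideal_smul_sub; first exact: ideal_smul_submodule.
by move=> a u Ja Nu; apply: mem_ideal_smul; [exact: JK|exact: NP].
Qed.

Lemma ideal_smulC J K : @ideal_smul S S^o J K = @ideal_smul S S^o K J.
Proof.
congr (@submodule_span S S^o _); apply/seteqP; split=> _ [a Ja [b Kb <-]];
  by exists b => //; exists a => //; rewrite /GRing.scale /= mulrC.
Qed.

(** In both directions the elements that are multiplied into the other side form a submodule [W], so
    generators are enough. *)
Lemma ideal_smulA J K N :
  @ideal_smul S M (@ideal_smul S S^o J K) N = ideal_smul J (ideal_smul K N).
Proof.
apply/seteqP; split.
  apply: ideal_smul_sub; first exact: ideal_smul_submodule.
  move=> c u Jc Nu.
  pose W : set S := [set c | ideal_smul J (ideal_smul K N) (c *: u)].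
  suff : @ideal_smul S S^o J K `<=` W by apply.
  apply: (@submodule_span_sub S S^o).
    apply/(@submoduleP S S^o); split.
      by rewrite /W /= scale0r; exact: (submodule0 (ideal_smul_submodule _ _)).
    move=> a b d; rewrite /W /= => hb hd.
    have -> : (a *: (b : S^o) + d) *: u = a *: (b *: u) + d *: u.
      by rewrite scalerDl scalerA.
    by apply: (submoduleD (ideal_smul_submodule _ _)) => //;
      exact: (submoduleZ _ (ideal_smul_submodule _ _)).
  move=> _ [a Ja [b Kb <-]]; rewrite /W /= -scalerA.
  by apply: mem_ideal_smul Ja _; exact: mem_ideal_smul.
apply: ideal_smul_sub; first exact: ideal_smul_submodule.
move=> a v Ja Kv.
pose W : set M := [set v | @ideal_smul S M (@ideal_smul S S^o J K) N (a *: v)].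
suff : ideal_smul K N `<=` W by apply.
apply: ideal_smul_sub.
  apply/submoduleP; split.
    by rewrite /W /= scaler0; exact: (submodule0 (ideal_smul_submodule _ _)).
  move=> b u w; rewrite /W /= => hu hw.
  rewrite scalerDr scalerA mulrC -scalerA.
  by apply: (submoduleD (ideal_smul_submodule _ _)) => //;
    exact: (submoduleZ _ (ideal_smul_submodule _ _)).
move=> b u Kb Nu; rewrite /W /= scalerA.
by apply: mem_ideal_smul Nu; apply: sub_submodule_span; exists a => //; exists b.
Qed.

End IdealProducts.

(** * Finite length from a power of the maximal ideal *)

Section FiniteLength.
Variables (S : comNzRingType) (M : lmodType S) (mm : set S).
Implicit Types (A B P : set M) (a : S) (u v : M).

Lemma maximal_comaximal a : is_maximal_ideal mm -> ~ mm a ->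
  exists2 b, mm b & exists c, b + c * a = 1.
Proof.
move=> [[m0 m1 ml] maxm] ma; apply: contrapT => no.
pose J : set S := [set x | exists2 b, mm b & exists c, x = b + c * a].
have mJ : mm `<=` J by move=> b mb; exists b => //; exists 0; rewrite mul0r addr0.
have Ja : J a.
  by exists 0; [move: m0; rewrite inE|exists 1; rewrite mul1r add0r].
apply: ma; rewrite -(maxm J) => //; split.
- by rewrite inE; apply: mJ; move: m0; rewrite inE.
- apply/negP; rewrite inE => -[b mb [c cE]].
  by apply: no; exists b => //; exists c.
- move=> x _ _ /[!inE] -[b mb [c ->]] [d md [e ->]]; exists (x * b + d).
    by have := ml x b d; rewrite !inE; apply.
  by exists (x * c + e); rewrite mulrDl mulrDr mulrA addrACA.
Qed.

(** The quotient is cyclic and killed by [mm], so its length is at most 1. In a chain of length 2,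
    an element of the middle term outside the bottom one is [p + a u] with [a] outside [mm]; then
    [a] is invertible modulo [mm], the middle term contains [u], and it is everything. *)
Lemma finlen_cyclic P u : is_maximal_ideal mm -> submodule P ->
  (forall a, mm a -> P (a *: u)) -> finlen (addm P (cycm u)) P.
Proof.
move=> maxm sP mu; have sc := cycm_submodule u.
apply: (@max_chain_length_bounded _ _ P 1).
  by split=> //; split=> //; exact: addm_subl.
move=> k [N [NF Nlt]]; rewrite leqNgt; apply/negP => k1.
have [_ [PN0 _]] := NF 0%N isT; have [sN1 [PN1 _]] := NF 1%N (ltnW k1).
have [_ nN10] := Nlt 0%N (ltnW k1); have [_ nN21] := Nlt 1%N k1.
apply: nN10 => w Nw; apply: contrapT => nw.
have [_ [_ Nw']] := NF 1%N (ltnW k1).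
have [p Pp [_ [a _ <-] wE]] := Nw' w Nw.
have ma : ~ mm a.
  move=> ma; apply: nw; apply: PN0; rewrite -wE; apply: submoduleD => //.
  exact: mu.
have [b mb [c bc]] := maximal_comaximal maxm ma.
have Nu : N 1%N u.
  have -> : u = b *: u + c *: (w - p).
    by rewrite -wE [p + _]addrC addrK scalerA -scalerDl bc scale1r.
  apply: submoduleD => //; first by apply: PN1; exact: mu.
  by apply: submoduleZ => //; apply: submoduleB => //; exact: PN1.
have [_ [_ N2]] := NF 2%N k1.
apply: nN21; apply: subset_trans N2 _; apply: addm_sub => // _ [d _ <-].
exact: submoduleZ.
Qed.

Lemma finlen_killed (s : seq M) B : is_maximal_ideal mm -> submodule B ->
  (forall a u, mm a -> u \in s -> B (a *: u)) -> finlen (addm B (lspan s)) B.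
Proof.
move=> maxm sB; elim: s => [|u s IH] h.
  exists 0%N; have -> : addm B (lspan [::]) = B.
    apply/seteqP; split; first by apply: addm_sub => // _ ->; exact: submodule0.
    by apply: addm_subl; exact: submodule_0.
  exact: len_refl.
have sl := lspan_submodule s; have sc := cycm_submodule u.
have sBs : submodule (addm B (lspan s)) by exact: addm_submodule.
have -> : addm B (lspan (u :: s)) = addm (addm B (lspan s)) (cycm u).
  apply/seteqP; split.
    move=> _ [b Bb [_ [c uc [w sw <-]] <-]]; exists (b + w).
      by exists b => //; exists w.
    by exists c => //; rewrite -addrA [w + c]addrC.
  move=> _ [_ [b Bb [w sw <-]] [c uc <-]]; exists b => //; exists (c + w).
    by exists c => //; exists w.
  by rewrite -addrA [w + c]addrC.
apply: (@finlen_trans _ _ _ _ (addm B (lspan s))) => //.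
- exact: addm_submodule.
- exact: addm_subl.
- exact: addm_subl.
- apply: finlen_cyclic => // a ma; apply: addm_subl => //.
  by apply: h => //; exact: mem_head.
- by apply: IH => a v ma vs; apply: h => //; rewrite inE vs orbT.
Qed.

(** Insert [mm A + B] between [B] and [A]: the upper quotient is finitely generated and killed by
    [mm], and the lower one is annihilated by one power of [mm] less. *)
Lemma finlen_nilpotent n A B : is_maximal_ideal mm -> noeth_module M ->
  submodule A -> submodule B -> B `<=` A ->
  ideal_smul (ideal_exp mm n) A `<=` B -> finlen A B.
Proof.
move=> maxm noeM; elim: n A => [|n IH] A sA sB BA /= h.
  suff -> : A = B by exists 0%N; exact: len_refl.
  apply/seteqP; split=> // u Au; apply: h; rewrite -[u]scale1r.
  exact: mem_ideal_smul.
have smA := @ideal_smul_submodule _ M mm A.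
have mAA : ideal_smul mm A `<=` A.
  by apply: ideal_smul_sub => // a u _; exact: submoduleZ.
have sC : submodule (addm (ideal_smul mm A) B) by exact: addm_submodule.
have CA : addm (ideal_smul mm A) B `<=` A by exact: addm_sub.
have BC : B `<=` addm (ideal_smul mm A) B by exact: addm_subr.
apply: (@finlen_trans _ _ _ _ (addm (ideal_smul mm A) B)) => //.
  have [s As] := noeM A sA.
  rewrite [X in finlen X](_ : A = addm (addm (ideal_smul mm A) B) (lspan s)).
    apply: finlen_killed => // a u ma us; apply: addm_subl => //.
    by apply: mem_ideal_smul => //; rewrite As; exact: mem_lspan.
  rewrite -As; apply/seteqP; split; first exact: addm_subr.
  exact: addm_sub.
apply: IH => //; apply: ideal_smul_sub => // a _ ma [u mu [v Bv <-]].
rewrite scalerDr; apply: submoduleD => //; last exact: submoduleZ.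
apply: h; rewrite ideal_smulC ideal_smulA.
exact: mem_ideal_smul.
Qed.

End FiniteLength.

(** The coefficient of [t ^ n] in the product of [p] with the power series of coefficients [f]. The
    left-hand side of [hilbert_series_eq] is convertible to it. *)
Definition cprod (R : nzRingType) (p : {poly R}) (f : nat -> R) (n : nat) : R :=
  \sum_(0 <= i < n.+1) p`_i * f (n - i)%N.

Section Convolution.
Variable R : comNzRingType.
Implicit Types (p q : {poly R}) (f g : nat -> R).

(** Truncating the series reduces its algebra to that of polynomials; associativity in [cprodM] is
    obtained in this way. *)
Lemma cprod_poly p f N n : (n < N)%N -> cprod p f n = (p * \poly_(i < N) f i)`_n.
Proof.
move=> nN; rewrite coefM /cprod big_mkord; apply: eq_bigr => i _.
by rewrite coef_poly ifT//; apply: leq_ltn_trans nN; exact: leq_subr.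
Qed.

Lemma eq_cprod p f g : f =1 g -> cprod p f =1 cprod p g.
Proof. by move=> fg n; apply: eq_bigr => i _; rewrite fg. Qed.

Lemma cprodM p q f n : cprod (p * q) f n = cprod p (cprod q f) n.
Proof.
rewrite (@cprod_poly _ _ n.+1)// -mulrA coefM /cprod big_mkord.
apply: eq_bigr => i _; rewrite -cprod_poly//.
by rewrite ltnS leq_subr.
Qed.

Lemma cprodB p f g n : cprod p (fun i => f i - g i) n = cprod p f n - cprod p g n.
Proof. by rewrite -sumrB; apply: eq_bigr => i _; rewrite mulrBr. Qed.

Lemma cprod_coef p q n : cprod p (fun i => q`_i) n = (p * q)`_n.
Proof. by rewrite coefM /cprod big_mkord. Qed.

Lemma cprod1 f n : cprod 1 f n = f n.
Proof.
rewrite (@cprod_poly _ _ n.+1)// mul1r coef_poly ltnSn//.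
Qed.

Lemma cprodXS f n : cprod 'X f n.+1 = f n.
Proof.
by rewrite (@cprod_poly _ _ n.+2)// coefXM /= coef_poly ltnW.
Qed.

Lemma cprodX0 f : cprod 'X f 0 = 0.
Proof. by rewrite (@cprod_poly _ _ 1)// coefXM. Qed.

Lemma cprod1BX f n : cprod (1 - 'X) f n = f n - cprod 'X f n.
Proof.
rewrite !(@cprod_poly _ _ n.+1)// mulrBl mul1r coefB coef_poly ltnSn//.
Qed.

End Convolution.

(** * Rationality of the Hilbert series *)

Section HilbertSeries.
Variables (S : comNzRingType) (M : lmodType S).
Implicit Types (A B : nat -> set M) (xs : seq S).

(* Multiplication by [x] from degree [n] to degree [n + 1] has kernel [K / B] and
   cokernel [A / B'], hence [(1 - t) H_A = H_(A / B') - t H_(K / B)]. *)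
Lemma hilbert_series_noeth xs A B (H : nat -> nat) :
  stable_family xs A -> stable_family xs B -> (forall n, B n `<=` A n) ->
  graded_noeth xs A B -> (forall n, len (A n) (B n) (H n)) ->
  exists h, hilbert_series_eq H (size xs) h.
Proof.
elim: xs A B H => [|x xs IH] A B H [sA hA] [sB hB] BA EG lenH.
  (* Without generators, the condition applied to [A] itself says that [A n = B n] for large [n]:
     the series is a polynomial. *)
  have [n0 hn0] := EG A (conj sA hA) BA (fun n => @subset_refl _ (A n)).
  exists (\poly_(i < n0.+1) (H i)%:Z) => n.
  rewrite expr0 -[LHS]/(cprod _ (fun i => (H i)%:Z) n) cprod1 coef_poly.
  case: ltnP => // n0n; case: n n0n => // n /hn0 /= An.
  have AB : A n.+1 = B n.+1.
    apply/seteqP; split=> //; apply: subset_trans An _.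
    by apply: addm_sub => // _ ->; exact: submodule0.
  congr (_%:Z); apply: (max_chain_length_uniq (lenH n.+1)); rewrite AB.
  exact: len_refl.
pose K n := A n `&` [set u | B n.+1 (x *: u)].
(* Nothing is mapped into degree 0, so the cokernel there is all of [A 0 / B 0]. *)
pose B' n := if n is n'.+1 then addm (scm x (A n')) (B n) else B 0%N.
have xX : x \in x :: xs by exact: mem_head.
have xsX y : y \in xs -> y \in x :: xs by rewrite inE => ->; rewrite orbT.
have KA n : K n `<=` A n by move=> u [].
have BK n : B n `<=` K n.
  by move=> u Bu; split; [exact: BA|apply: (hB x xX n); exists u].
have BB' n : B n `<=` B' n.
  by case: n => //= n; apply: addm_subr; exact: scm_submodule.
have B'A n : B' n `<=` A n.
  by case: n => //= n; apply: addm_sub => //; exact: hA.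
have sK n : submodule (K n).
  apply: submoduleI => //; apply/submoduleP; split.
    by rewrite /= scaler0; exact: submodule0.
  move=> a u v /= Nu Nv; rewrite scalerDr scalerA mulrC -scalerA.
  by apply: submoduleD => //; exact: submoduleZ.
have stK : stable_family xs K.
  split=> // y yxs n _ [u [Au Bu] <-]; split; first by apply: (hA y (xsX _ yxs)); exists u.
  rewrite /= scalerA mulrC -scalerA; apply: (hB y (xsX _ yxs)).
  by exists (x *: u).
have sB' n : submodule (B' n).
  by case: n => //= n; apply: addm_submodule => //; exact: scm_submodule.
have stB' : stable_family xs B'.
  split=> // y yxs [|n]; first exact: subset_trans (hB y (xsX _ yxs) 0%N) (BB' 1%N).
  move=> _ [_ [_ [u Au <-] [v Bv <-]] <-].
  exists (x *: (y *: u)).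
    by exists (y *: u) => //; apply: (hA y (xsX _ yxs)); exists u.
  exists (y *: v); first by apply: (hB y (xsX _ yxs)); exists v.
  by rewrite scalerDr !scalerA mulrC.
(* Multiplication by [x] vanishes on [K / B], so the summand for [x] in [mspan (x :: xs)] is
   absorbed by [B]. The same happens for [A / B'] below. *)
have EGK : graded_noeth xs K B.
  move=> C [sC hC] BC CK.
  have xC n : scm x (C n) `<=` B n.+1 by move=> _ [u /CK[_ ?] <-].
  have [||n0 hn0] := EG C _ BC.
  - split=> // y; rewrite inE => /predU1P[->|/hC//] n.
    exact: subset_trans (xC n) (BC _).
  - by move=> n; exact: subset_trans (CK n) (KA n).
  exists n0 => n /hn0 /= h; apply: subset_trans h _.
  have sm : submodule (mspan xs (C n)) by exact: mspan_submodule.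
  apply: addm_sub; [exact: addm_submodule| |exact: addm_subr].
  apply: addm_sub; [exact: addm_submodule| |exact: addm_subl].
  by apply: subset_trans (xC n) _; exact: addm_subr.
have EGC : graded_noeth xs A B'.
  move=> C [sC hC] BC CA.
  have xC n : scm x (C n) `<=` B' n.+1.
    apply: (@subset_trans _ (scm x (A n))); first exact: scmS.
    exact: addm_subl.
  have [||n0 hn0] := EG C _ _ CA.
  - split=> // y; rewrite inE => /predU1P[->|/hC//] n.
    exact: subset_trans (xC n) (BC _).
  - by move=> n; exact: subset_trans (BB' n) (BC n).
  exists n0 => n /hn0 h; apply: subset_trans h _.
  have sm : submodule (mspan xs (C n)) by exact: mspan_submodule.
  apply: addm_sub; [exact: addm_submodule| |].
    apply: addm_sub; [exact: addm_submodule| |exact: addm_subl].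
    by apply: subset_trans (xC n) _; exact: addm_subr.
  by apply: subset_trans (BB' _) _; exact: addm_subr.
have /choice[HK lenK] : forall n, exists k, len (K n) (B n) k.
  by move=> n; apply: (@finlen_sub _ _ (A n) (B n)) => //; exists (H n).
have /choice[HC lenC] : forall n, exists k, len (A n) (B' n) k.
  by move=> n; apply: (@finlen_sub _ _ (A n) (B n)) => //; exists (H n).
have /choice[Q lenQ] : forall n, exists k, len (A n) (K n) k.
  by move=> n; apply: (@finlen_sub _ _ (A n) (B n)) => //; exists (H n).
(* [Q n] is the length of the image of multiplication by [x]. It is counted in degree [n] as
   [A n / K n], and in degree [n + 1], through [len_scm], as [B' n.+1 / B n.+1]; eliminating it
   gives the identity of series. *)
have H_K n : H n = (HK n + Q n)%N.
  exact: (max_chain_length_uniq (lenH n)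
    (len_add (sA n) (sB n) (sK n) (BK n) (@KA n) (lenQ n) (lenK n))).
have H_C n : H n.+1 = (Q n + HC n.+1)%N.
  apply: (max_chain_length_uniq (lenH n.+1)).
  apply: (len_add (sA _) (sB _) (sB' _) (BB' n.+1) (B'A n.+1) (lenC _)).
  by apply: (@len_scm _ _ _ (B n)) => //; exact: hB.
have H_0 : H 0%N = HC 0%N by exact: (max_chain_length_uniq (lenH 0%N) (lenC 0%N)).
have [hK hKE] := IH K B HK stK (conj sB (fun y yxs => hB y (xsX y yxs))) BK EGK lenK.
have [hC hCE] := IH A B' HC (conj sA (fun y yxs => hA y (xsX y yxs))) stB' B'A EGC lenC.
exists (hC - 'X * hK) => n.
pose fH n := (H n)%:Z; pose fK n := (HK n)%:Z; pose fC n := (HC n)%:Z.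
have DH k : cprod (1 - 'X) fH k = fC k - cprod 'X fK k.
  rewrite cprod1BX; case: k => [|k]; first by rewrite !cprodX0 /fH H_0.
  rewrite !cprodXS /fH /fC /fK H_C H_K; lia.
rewrite -[LHS]/(cprod _ fH n) exprS mulrC cprodM (eq_cprod _ DH) cprodB.
rewrite -cprodM mulrC cprodM coefB -cprod_coef; congr (_ - _).
  exact: hCE.
by apply: eq_cprod => k; exact: hKE.
Qed.

Lemma hilbert_gr_rational (mm I : set S) : noetherian_ring S ->
  local_ring mm -> finitely_generated M -> is_proper_ideal I ->
  (exists2 n : nat, (1 <= n)%N &
     ideal_smul (ideal_exp mm n) [set: M] `<=` ideal_smul I [set: M]) ->
  exists d h, hilbert_series_eq (hilbert_gr M I) d h.
Proof.
move=> noeS [maxm _] fgM [I0 _ Il] [n _ mI].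
have noeM := noeth_fg noeS fgM.
have sI : @submodule S S^o I.
  apply/(@submoduleP S S^o); split; first by move: I0; rewrite inE.
  by move=> a u v Iu Iv; have := Il a u v; rewrite !inE; apply.
have [xs Ixs] := noeS I sI; rewrite (@submodule_spanE S S^o) in Ixs.
pose A k := ideal_smul (ideal_exp I k) [set: M].
have A0 : A 0%N = [set: M].
  apply/seteqP; split=> // u _; rewrite -[u]scale1r.
  exact: mem_ideal_smul.
have sA k : submodule (A k) by exact: ideal_smul_submodule.
have AS k : A k.+1 = ideal_smul I (A k) by rewrite /A /= ideal_smulA.
have Ixs_sub (N : set M) : submodule N -> ideal_smul I N `<=` mspan xs N.
  move=> sN; apply: ideal_smul_sub; first exact: mspan_submodule.
  move=> a u Ia Nu; rewrite Ixs in Ia.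
  pose W : set S := [set a | mspan xs N (a *: u)].
  suff : @lspan S S^o xs `<=` W by apply.
  apply: (@lspan_sub S S^o).
    apply/(@submoduleP S S^o); split.
      by rewrite /W /= scale0r; exact: (submodule0 (mspan_submodule _ _)).
    move=> b c d; rewrite /W /= => hc hd.
    have -> : (b *: (c : S^o) + d) *: u = b *: (c *: u) + d *: u.
      by rewrite scalerDl scalerA.
    by apply: (submoduleD (mspan_submodule _ _)) => //;
      exact: (submoduleZ _ (mspan_submodule _ _)).
  by move=> x xxs; apply: (sub_mspan sN xxs); exists u.
have stA : stable_family xs A.
  split=> // x xxs k _ [u Au <-]; rewrite AS; apply: mem_ideal_smul => //.
  by rewrite Ixs; exact: (@mem_lspan S S^o).
have Adec k : A k.+1 `<=` A k.
  by rewrite AS; apply: ideal_smul_sub => // a u _; exact: submoduleZ.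
(* The basis theorem holds for the families [rees], so the powers of [I] are bounded by them. *)
have Arees k : A k `<=` @rees S M xs k.
  have [sR hR] := @rees_stable S M xs.
  elim: k => [|k IHk]; first by rewrite rees0.
  rewrite AS; apply: subset_trans (Ixs_sub _ (sA k)) _.
  apply: mspan_sub => // x xxs.
  move=> u /(scmS IHk); exact: (hR x xxs k).
(* [mm ^ n I ^ k M = I ^ k (mm ^ n M)] is contained in [I ^ k (I M)], so a power of [mm] kills each
   quotient. *)
have flA k : finlen (A k) (A k.+1).
  apply: (finlen_nilpotent (n := n) maxm) => //.
  rewrite /A -ideal_smulA ideal_smulC ideal_smulA.
  apply: subset_trans (ideal_smulS (@subset_refl _ _) mI) _.
  by rewrite -ideal_smulA ideal_smulC.
exists (size xs).
apply: (@hilbert_series_noeth xs A (fun k => A k.+1)) => //.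
- by split=> // x xxs k; have [_ h] := stA; exact: h.
- apply: (@graded_noeth_sub _ _ _ (@rees S M xs)) => //.
  exact: rees_noeth.
- move=> k; have [l hl] := flA k.
  by rewrite /hilbert_gr (len_subquotient hl).
Qed.

End HilbertSeries.

(** * Complex differentiable functions *)

Section ComplexModulus.
Variable R : realType.
Implicit Types (x y : R) (z w : R[i]).

(** The norm of [R[i]] takes its values in [R[i]]; a modulus in [R] brings the estimates within
    reach of [lra]. *)
Definition cn (z : R[i]) : R := Normc.normc z.

Lemma normE z : `|z| = (cn z)%:C :> R[i].
Proof. by []. Qed.

Lemma cn0 : cn 0 = 0. Proof. exact: Normc.normc0. Qed.
Lemma cn1 : cn 1 = 1. Proof. exact: Normc.normc1. Qed.
Lemma cnM z w : cn (z * w) = cn z * cn w. Proof. exact: Normc.normcM. Qed.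
Lemma cnV z : cn z^-1 = (cn z)^-1. Proof. exact: Normc.normcV. Qed.
Lemma cnN z : cn (- z) = cn z. Proof. exact: normcN. Qed.
Lemma cnX z n : cn (z ^+ n) = cn z ^+ n.
Proof. by elim: n => [|n IH]; rewrite ?expr0 ?cn1// !exprS cnM IH. Qed.
Lemma cn_real x : cn x%:C = `|x|.
Proof. by rewrite /cn /= expr0n addr0 sqrtr_sqr. Qed.
Lemma cn_i : cn 'i = 1.
Proof. by rewrite /cn /= expr0n add0r expr1n sqrtr1. Qed.
Lemma cnD z w : cn (z + w) <= cn z + cn w. Proof. exact: le_normcD. Qed.
Lemma cnB z w : cn (z - w) <= cn z + cn w.
Proof. by rewrite -(cnN w); exact: cnD. Qed.
Lemma cn_ge0 z : 0 <= cn z.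
Proof. by case: z => a b; exact: sqrtr_ge0. Qed.
Lemma cn_eq0 z : (cn z == 0) = (z == 0).
Proof.
by apply/eqP/eqP => [/Normc.eq0_normc//|->]; exact: cn0.
Qed.
Lemma cn_gt0 z : (0 < cn z) = (z != 0).
Proof. by rewrite lt_def cn_eq0 cn_ge0 andbT. Qed.
Lemma cnBC z w : cn (z - w) = cn (w - z).
Proof. by rewrite -cnN opprB. Qed.
Lemma cn_tri z w u : cn (z - w) <= cn (z - u) + cn (u - w).
Proof. by rewrite -(subrKA u z (- w)); apply: cnD. Qed.
Lemma cn_leB z w : cn z - cn w <= cn (z - w).
Proof. by rewrite lerBlDr; apply: le_trans (cnD _ _); rewrite subrK. Qed.
Lemma cn_leD z w : cn z <= cn w + cn (z - w).
Proof. by rewrite -lerBlDl; exact: cn_leB. Qed.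
Lemma Re_cn z : `|complex.Re z| <= cn z.
Proof.
by case: z => a b; rewrite /cn /= -sqrtr_sqr ler_wsqrtr// lerDl sqr_ge0.
Qed.
Lemma Im_cn z : `|complex.Im z| <= cn z.
Proof.
by case: z => a b; rewrite /cn /= -sqrtr_sqr ler_wsqrtr// lerDr sqr_ge0.
Qed.
Lemma ReD z w : complex.Re (z + w) = complex.Re z + complex.Re w.
Proof. by case: z w => [? ?] [? ?]. Qed.
Lemma ReN z : complex.Re (- z) = - complex.Re z.
Proof. by case: z. Qed.
Lemma ReB z w : complex.Re (z - w) = complex.Re z - complex.Re w.
Proof. by rewrite ReD ReN. Qed.
Lemma ImD z w : complex.Im (z + w) = complex.Im z + complex.Im w.
Proof. by case: z w => [? ?] [? ?]. Qed.
Lemma ImN z : complex.Im (- z) = - complex.Im z.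
Proof. by case: z. Qed.
Lemma ImB z w : complex.Im (z - w) = complex.Im z - complex.Im w.
Proof. by rewrite ImD ImN. Qed.
Lemma cn_ReIm z : cn z <= `|complex.Re z| + `|complex.Im z|.
Proof.
rewrite [z in cn z]complexE; apply: le_trans (cnD _ _) _.
by rewrite cnM cn_i mul1r !cn_real.
Qed.

End ComplexModulus.
Arguments cn {R} z : simpl never.

(** * Complex derivatives in epsilon-delta form *)

Section Differentiability.
Variable R : realType.
Implicit Types (f g : R[i] -> R[i]) (z w a b l : R[i]) (r e d : R).

Definition ccont f z := forall e, 0 < e ->
  exists2 d, 0 < d & forall w, cn (w - z) < d -> cn (f w - f z) <= e.

(** Stated without a quotient, so that [w = z] is no exception and products and compositions need no
    case distinction. *)
Definition cder f z l := forall e, 0 < e ->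
  exists2 d, 0 < d & forall w, cn (w - z) < d ->
    cn (f w - f z - l * (w - z)) <= e * cn (w - z).

Definition hol f z := exists l, cder f z l.

Lemma ltC_real (x : R[i]) : 0 < x -> exists2 r, 0 < r & x = r%:C.
Proof.
by move=> x0; have /complex_realP[r xr] := gtr0_real x0; exists r => //;
  move: x0; rewrite xr ltcR.
Qed.

Lemma nearC (a : R[i]^o) (P : R[i] -> Prop) :
  (\forall z \near a, P z) <-> exists2 r, 0 < r & forall z, cn (z - a) < r -> P z.
Proof.
split=> [/nbhs_normP[x /= /ltC_real[r r0 ->] h]|[r r0 h]].
  by exists r => // z zr; apply: h; rewrite /= distrC normE ltcR.
apply/nbhs_normP; exists r%:C; first by rewrite /= ltcR.
by move=> z /=; rewrite distrC normE ltcR; exact: h.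
Qed.

Lemma dnearC (a : R[i]^o) (P : R[i] -> Prop) :
  (\forall z \near a^', P z) <->
  exists2 r, 0 < r & forall z, cn (z - a) < r -> z != a -> P z.
Proof.
rewrite near_withinE; split=> [h|[r r0 h]].
  by have /nearC[r r0 hr] : \forall z \near a, z != a -> P z := h; exists r.
by apply/nearC; exists r.
Qed.

Lemma cder_derivable f (z : R[i]^o) :
  derivable (f : R[i]^o -> R[i]^o) z 1 <-> hol f z.
Proof.
split=> [/cvg_ex[/= l]|[l hl]].
  move=> /cvgrPdist_le h; exists l => e e0.
  have /h /dnearC[d d0 hd] : 0 < e%:C :> R[i] by rewrite ltcR.
  exists d => // w wz; have [->|wnz] := eqVneq w z.
    by rewrite !subrr mulr0 subr0 cn0 mulr0.
  have := hd (w - z); rewrite !subr0 subr_eq0 wnz => /(_ wz isT).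
  rewrite /= normE lecR => le_e.
  have wz0 : w - z != 0 by rewrite subr_eq0.
  have -> : f w - f z - l * (w - z) =
    - (w - z) * (l - (w - z)^-1 *: (f ((w - z) *: 1 + z) - f z)).
    rewrite /GRing.scale /= mulr1 subrK.
    by field.
  by rewrite cnM cnN mulrC ler_wpM2r ?cn_ge0.
apply/cvg_ex; exists l => /=; apply/cvgrPdist_le => x /ltC_real[e e0 ->].
have [d d0 hd] := hl e e0; apply/dnearC; exists d => // h; rewrite subr0 => hd' h0.
rewrite normE lecR.
have -> : l - h^-1 *: (f (h *: 1 + z) - f z) =
    - (h^-1 * (f (h + z) - f z - l * (h + z - z))).
  rewrite /GRing.scale /= mulr1 addrK.
  by field.
rewrite cnN cnM cnV mulrC ler_pdivrMr ?cn_gt0//.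
by have := hd (h + z); rewrite addrK; apply.
Qed.

Lemma holomorphic_nearP f (a : R[i]^o) : holomorphic_near f a <->
  exists2 r, 0 < r & forall z, cn (z - a) < r -> hol f z.
Proof.
rewrite /holomorphic_near nearC.
by split=> -[r r0 h]; exists r => // z /h /cder_derivable.
Qed.

Lemma cder_ccont f z l : cder f z l -> ccont f z.
Proof.
move=> h e e0; have [d d0 hd] := h 1 ltr01.
pose L := 1 + cn l; have L0 : 0 < L by rewrite ltr_wpDr ?cn_ge0.
exists (Num.min d (e / L)); first by rewrite lt_min d0 divr_gt0.
move=> w; rewrite lt_min => /andP[wd we].
rewrite -[f w - f z](subrK (l * (w - z))).
apply: le_trans (cnD _ _) _; rewrite cnM.
apply: (@le_trans _ _ (L * cn (w - z))).
  by rewrite mulrDl mul1r lerD// -[leRHS]mul1r hd.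
by rewrite mulrC -ler_pdivlMr// ltW.
Qed.

Lemma hol_ccont f z : hol f z -> ccont f z.
Proof. by move=> [l]; exact: cder_ccont. Qed.

Lemma cder_near f g z l r : 0 < r ->
  (forall w, cn (w - z) < r -> f w = g w) -> cder f z l -> cder g z l.
Proof.
move=> r0 fg hf e e0; have [d d0 hd] := hf e e0.
exists (Num.min d r); first by rewrite lt_min d0.
move=> w; rewrite lt_min => /andP[wd wr].
by rewrite -!fg ?subrr ?cn0//; exact: hd.
Qed.

Lemma hol_near f g z r : 0 < r ->
  (forall w, cn (w - z) < r -> f w = g w) -> hol f z -> hol g z.
Proof. by move=> r0 fg [l hl]; exists l; exact: (cder_near r0 fg hl). Qed.

Lemma cder_cst c z : cder (fun=> c) z 0.
Proof.
move=> e e0; exists 1 => // w _.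
by rewrite subrr mul0r subr0 cn0 mulr_ge0 ?cn_ge0// ltW.
Qed.

Lemma cder_id z : cder id z 1.
Proof.
move=> e e0; exists 1 => // w _.
by rewrite mul1r subrr cn0 mulr_ge0 ?cn_ge0// ltW.
Qed.

Lemma cderD f g z l m : cder f z l -> cder g z m ->
  cder (fun w => f w + g w) z (l + m).
Proof.
move=> hf hg e e0; have e20 : 0 < e / 2 by rewrite divr_gt0.
have [d d0 hd] := hf _ e20; have [d' d'0 hd'] := hg _ e20.
exists (Num.min d d'); first by rewrite lt_min d0.
move=> w; rewrite lt_min => /andP[wd wd'].
have -> : f w + g w - (f z + g z) - (l + m) * (w - z) =
  (f w - f z - l * (w - z)) + (g w - g z - m * (w - z)) by ring.
apply: le_trans (cnD _ _) _; rewrite [e]splitr mulrDl.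
by rewrite lerD ?hd ?hd'.
Qed.

Lemma cderM f g z l m : cder f z l -> cder g z m ->
  cder (fun w => f w * g w) z (l * g z + f z * m).
Proof.
move=> hf hg e e0.
pose K := 1 + cn (g z) + cn l + cn (f z).
have K0 : 0 < K by rewrite /K -!addrA ltr_wpDr ?addr_ge0 ?cn_ge0.
have eK0 : 0 < e / K by rewrite divr_gt0.
have [d1 d10 h1] := hf _ eK0; have [d2 d20 h2] := hg _ eK0.
have [d3 d30 h3] := cder_ccont hg eK0; have [d4 d40 h4] := cder_ccont hg ltr01.
exists (Num.min (Num.min d1 d2) (Num.min d3 d4)).
  by rewrite !lt_min d10 d20 d30.
move=> w; rewrite !lt_min => /andP[/andP[/h1 w1 /h2 w2] /andP[/h3 w3 /h4 w4]].
have -> : f w * g w - f z * g z - (l * g z + f z * m) * (w - z) =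
  (f w - f z - l * (w - z)) * g w + (g w - g z) * (l * (w - z)) +
  (g w - g z - m * (w - z)) * f z by ring.
have gw : cn (g w) <= 1 + cn (g z).
  by apply: le_trans (cn_leD _ (g z)) _; rewrite addrC lerD2r.
have -> : e * cn (w - z) = e / K * cn (w - z) * (1 + cn (g z)) +
    e / K * (cn l * cn (w - z)) + e / K * cn (w - z) * cn (f z).
  rewrite -[e in LHS](divfK (lt0r_neq0 K0)) /K; ring.
apply: le_trans (cnD _ _) _; rewrite lerD//; last first.
  by rewrite cnM ler_wpM2r ?cn_ge0.
apply: le_trans (cnD _ _) _; rewrite lerD// !cnM.
  by apply: ler_pM; rewrite ?cn_ge0.
by rewrite ler_wpM2r ?mulr_ge0 ?cn_ge0.
Qed.

Lemma hol_cst c z : hol (fun=> c) z. Proof. by exists 0; exact: cder_cst. Qed.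
Lemma hol_id z : hol id z. Proof. by exists 1; exact: cder_id. Qed.
Lemma holD f g z : hol f z -> hol g z -> hol (fun w => f w + g w) z.
Proof. by move=> [l hl] [m hm]; exists (l + m); exact: cderD. Qed.
Lemma holM f g z : hol f z -> hol g z -> hol (fun w => f w * g w) z.
Proof. by move=> [l hl] [m hm]; exists (l * g z + f z * m); exact: cderM. Qed.

Lemma cderZ c f z l : cder f z l -> cder (fun w => c * f w) z (c * l).
Proof.
by move=> h; have := cderM (cder_cst c z) h; rewrite mul0r add0r.
Qed.

Lemma cderN f z l : cder f z l -> cder (fun w => - f w) z (- l).
Proof.
move=> /(cderZ (-1)); rewrite mulN1r => h; apply: cder_near ltr01 _ h.
by move=> w _; rewrite mulN1r.
Qed.

Lemma cderB f g z l m : cder f z l -> cder g z m ->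
  cder (fun w => f w - g w) z (l - m).
Proof. by move=> hf hg; apply: cderD => //; exact: cderN. Qed.

Lemma holB f g z : hol f z -> hol g z -> hol (fun w => f w - g w) z.
Proof. by move=> [l hl] [m hm]; exists (l - m); exact: cderB. Qed.

Lemma holX f n z : hol f z -> hol (fun w => f w ^+ n) z.
Proof.
move=> hf; elim: n => [|n IH]; first exact: hol_cst.
have := holM hf IH; apply: (hol_near ltr01) => w _.
by rewrite exprS.
Qed.

Lemma cder_comp f g z l m : cder f z l -> cder g (f z) m ->
  cder (g \o f) z (m * l).
Proof.
move=> hf hg e e0.
pose K := 1 + cn l + cn m.
have K0 : 0 < K by rewrite /K -!addrA ltr_wpDr ?addr_ge0 ?cn_ge0.
have eK0 : 0 < e / (2 * K) by rewrite divr_gt0// mulr_gt0.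
have [d1 d10 h1] := hg _ eK0.
have [d2 d20 h2] := hf 1 ltr01.
have [d3 d30 h3] := hf _ eK0.
have d120 : 0 < d1 / 2 by rewrite divr_gt0.
have [d4 d40 h4] := cder_ccont hf d120.
exists (Num.min d2 (Num.min d3 d4)); first by rewrite !lt_min d20 d30.
move=> w; rewrite !lt_min => /andP[/h2 w2 /andP[/h3 w3 /h4 w4]].
have w1 : cn (f w - f z) < d1 by apply: le_lt_trans w4 _; lra.
have -> : (g \o f) w - (g \o f) z - m * l * (w - z) =
   (g (f w) - g (f z) - m * (f w - f z)) + m * (f w - f z - l * (w - z)).
  by rewrite /=; ring.
set D := cn (w - z) in w2 w3 *.
have D0 : 0 <= D := cn_ge0 _.
have fD : cn (f w - f z) <= K * D.
  rewrite -[f w - f z](subrK (l * (w - z))).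
  apply: le_trans (cnD _ _) _; rewrite cnM -/D.
  have : 0 <= cn m * D by rewrite mulr_ge0 ?cn_ge0.
  rewrite /K; lra.
have mK : cn m <= K by rewrite /K; move: (cn_ge0 l); lra.
apply: le_trans (cnD _ _) _; rewrite cnM.
have -> : e * D = e / (2 * K) * (K * D) + K * (e / (2 * K) * D).
  by field; rewrite gt_eqF.
rewrite lerD//.
  apply: le_trans (h1 _ w1) _; rewrite ler_wpM2l//.
  by rewrite ltW// divr_gt0// mulr_gt0.
by apply: ler_pM; rewrite ?cn_ge0.
Qed.

Lemma cder_shift f z v l : cder f (z + v) l -> cder (fun w => f (w + v)) z l.
Proof.
move=> h e /h[d d0 hd]; exists d => // w wz.
have E : w + v - (z + v) = w - z by ring.
by have := hd (w + v); rewrite E; exact.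
Qed.

(** The quadratic polynomial is a primitive of an affine approximation; subtracting it leaves a
    small remainder in Goursat's lemma and in Taylor's formula. *)
Lemma cder_quadratic b l z z0 :
  cder (fun w => b * w + l / 2 * (w - z0) ^+ 2) z (b + l * (z - z0)).
Proof.
have h1 := cderB (cder_id z) (cder_cst z0 z).
have h2 := cderD (cderZ b (cder_id z)) (cderZ (l / 2) (cderM h1 h1)).
have -> : b + l * (z - z0) =
    b * 1 + l / 2 * ((1 - 0) * (z - z0) + (z - z0) * (1 - 0)) by field.
by apply: cder_near ltr01 _ h2 => w _; rewrite expr2.
Qed.

Lemma hol_comp f g z : hol f z -> hol g (f z) -> hol (g \o f) z.
Proof. by move=> [l hl] [m hm]; exists (m * l); exact: cder_comp. Qed.

Lemma cderV z : z != 0 -> cder (fun w => w^-1) z (- z^-2).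
Proof.
move=> z0 e e0; have c0 : 0 < cn z by rewrite cn_gt0.
(* The remainder is [(w - z) ^ 2 / (w z ^ 2)], and [cn w >= cn z / 2] bounds its denominator from
   below by [cn z ^ 3 / 2]. *)
exists (Num.min (cn z / 2) (e * (cn z ^+ 3 / 2))).
  by rewrite lt_min !(divr_gt0, mulr_gt0, exprn_gt0).
move=> w; rewrite lt_min => /andP[w1 w2].
have wz : cn z / 2 <= cn w.
  have := cn_leD z w; rewrite cnBC; lra.
have w0 : w != 0 by rewrite -cn_gt0; apply: lt_le_trans wz; rewrite divr_gt0.
have -> : w^-1 - z^-1 - - z^-2 * (w - z) = (w - z) * (w - z) / (w * z ^+ 2).
  by field; rewrite z0.
rewrite !cnM cnV cnM cnX -mulrA mulrC ler_wpM2r ?cn_ge0//.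
rewrite ler_pdivrMr; last by rewrite mulr_gt0 ?exprn_gt0// cn_gt0.
apply: le_trans (ltW w2) _; rewrite ler_wpM2l ?(ltW e0)//.
have -> : cn z ^+ 3 / 2 = cn z / 2 * cn z ^+ 2 by rewrite exprS; ring.
by rewrite ler_wpM2r// exprn_ge0// cn_ge0.
Qed.

Lemma holV f z : hol f z -> f z != 0 -> hol (fun w => (f w)^-1) z.
Proof.
move=> hf fz0; apply: (@hol_comp f (fun w => w^-1)) => //.
by eexists; exact: cderV.
Qed.

Lemma hol_sum I (s : seq I) (F : I -> R[i] -> R[i]) z :
  (forall i, hol (F i) z) -> hol (fun w => \sum_(i <- s) F i w) z.
Proof.
move=> hF; elim: s => [|i s IH].
  by apply: hol_near ltr01 _ (hol_cst 0 z) => w _; rewrite big_nil.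
by apply: hol_near ltr01 _ (holD (hF i) IH) => w _; rewrite big_cons.
Qed.

End Differentiability.

(** * Complex-valued functions of a real variable *)

Section RealVariable.
Variable R : realType.
Implicit Types (x y a b e d M : R) (z w l : R[i]).

Definition rcont (k : R -> R[i]) x := forall e, 0 < e ->
  exists2 d, 0 < d & forall y, `|y - x| < d -> cn (k y - k x) <= e.

Definition rder (K : R -> R[i]) x l := forall e, 0 < e ->
  exists2 d, 0 < d & forall y, `|y - x| < d ->
    cn (K y - K x - l * (y - x)%:C) <= e * `|y - x|.

Lemma nearR a (P : R -> Prop) :
  (\forall x \near a, P x) <-> exists2 r, 0 < r & forall x, `|x - a| < r -> P x.
Proof.
split=> [/nbhs_normP[r /= r0 h]|[r r0 h]].
  by exists r => // x xr; apply: h; rewrite /= distrC.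
by apply/nbhs_normP; exists r => // x /=; rewrite distrC; exact: h.
Qed.

Lemma is_deriveP (f : R -> R) x (l : R) : is_derive x 1 f l <->
  forall e, 0 < e -> exists2 d, 0 < d & forall y, `|y - x| < d ->
    `|f y - f x - l * (y - x)| <= e * `|y - x|.
Proof.
split=> [df e e0|h].
  have cl : (fun h => h^-1 *: ((f \o shift x) (h *: 1) - f x)) @ 0^' --> l.
    by have [ex <-] := df; exact: ex.
  move/cvgrPdist_le : cl => /(_ e e0).
  rewrite near_withinE => /nearR[d d0 hd]; exists d => // y yx.
  have [->|ynx] := eqVneq y x; first by rewrite !subrr mulr0 subr0 normr0 mulr0.
  have yx0 : y - x != 0 by rewrite subr_eq0.
  have := hd (y - x); rewrite subr0 => /(_ yx yx0).
  rewrite /= /GRing.scale /= mulr1 subrK => le_e.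
  have -> : f y - f x - l * (y - x) = - (y - x) * (l - (y - x)^-1 * (f y - f x)).
    by field.
  by rewrite normrM normrN mulrC ler_wpM2r.
have cl : (fun h => h^-1 *: ((f \o shift x) (h *: 1) - f x)) @ 0^' --> l.
  apply/cvgrPdist_le => e e0; rewrite near_withinE.
  have [d d0 hd] := h e e0; apply/nearR; exists d => // t; rewrite subr0 => td t0.
  rewrite /GRing.scale /= mulr1.
  have -> : l - t^-1 * (f (t + x) - f x) = - (t^-1 * (f (t + x) - f x - l * (t + x - x))).
    by rewrite addrK; field.
  rewrite normrN normrM normfV mulrC ler_pdivrMr ?normr_gt0//.
  by have := hd (t + x); rewrite addrK; apply.
split; first by apply/cvg_ex; exists l.
exact: cvg_lim.
Qed.

Lemma rder_rcont K x l : rder K x l -> rcont K x.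
Proof.
move=> h e e0; have [d d0 hd] := h 1 ltr01.
pose L := 1 + cn l; have L0 : 0 < L by rewrite ltr_wpDr ?cn_ge0.
exists (Num.min d (e / L)); first by rewrite lt_min d0 divr_gt0.
move=> w; rewrite lt_min => /andP[wd we].
rewrite -[K w - K x](subrK (l * (w - x)%:C)).
apply: le_trans (cnD _ _) _; rewrite cnM cn_real.
apply: (@le_trans _ _ (L * `|w - x|)).
  by rewrite mulrDl mul1r lerD// -[leRHS]mul1r hd.
by rewrite mulrC -ler_pdivlMr// ltW.
Qed.

Lemma rder_Re K x l c : rder K x l ->
  is_derive x 1 (fun t => complex.Re (c * K t)) (complex.Re (c * l)).
Proof.
move=> h; apply/is_deriveP => e e0.
pose L := 1 + cn c; have L0 : 0 < L by rewrite ltr_wpDr ?cn_ge0.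
have [|d d0 hd] := h (e / L); first by rewrite divr_gt0.
exists d => // y /hd yx.
have -> : complex.Re (c * K y) - complex.Re (c * K x) -
    complex.Re (c * l) * (y - x) =
    complex.Re (c * (K y - K x - l * (y - x)%:C)).
  rewrite -[_ * (y - x)]/(_) !(mulrBr, ReB); congr (_ - _ - _).
  rewrite mulrA; case: (c * l) => p q /=; by rewrite mulr0 subr0 -?mulrBr.
apply: le_trans (Re_cn _) _; rewrite cnM.
apply: (@le_trans _ _ (L * (e / L * `|y - x|))).
  by rewrite ler_pM ?cn_ge0// /L lerDr.
by rewrite mulrA mulrCA divff ?mulr1// gt_eqF.
Qed.

(** The mean value theorem fails for complex values. It is applied to the real part of [c * K] with
    [c] the conjugate of [D = K b - K a], whose increment is the square of the modulus of [D]. *)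
Lemma MVI (K k : R -> R[i]) a b M : a <= b ->
  (forall x, a <= x <= b -> rder K x (k x)) ->
  (forall x, a <= x <= b -> cn (k x) <= M) ->
  cn (K b - K a) <= M * (b - a).
Proof.
move=> ab hK hM.
set D := K b - K a.
have [->|D0] := eqVneq D 0.
  rewrite cn0 mulr_ge0 ?subr_ge0//; apply: le_trans (hM a _); rewrite ?cn_ge0//.
  by rewrite lexx.
pose c := (D^*)%C.
have dF x : a <= x <= b ->
    is_derive x 1 (fun t => complex.Re (c * K t)) (complex.Re (c * k x)).
  by move=> /hK; exact: rder_Re.
have [||t tab tE] := @MVT_segment R (fun t => complex.Re (c * K t))
    (fun t => complex.Re (c * k t)) a b ab.
- by move=> x; rewrite in_itv /= => /andP[/ltW ? /ltW ?]; apply: dF; apply/andP.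
- apply: derivable_within_continuous => x; rewrite in_itv /= => /dF h.
  exact: ex_derive.
have cD : cn c = cn D by rewrite /c; case: (D) => p q; rewrite /cn /= sqrrN.
have E : complex.Re (c * K b) - complex.Re (c * K a) = cn D ^+ 2.
  rewrite -ReB -mulrBr -/D /c /cn; case: (D) => p q /=.
  rewrite sqr_sqrtr ?addr_ge0 ?sqr_ge0//; ring.
rewrite E in tE.
rewrite in_itv /= in tab.
have Dp : 0 < cn D by rewrite cn_gt0.
rewrite -(ler_pM2l Dp) -expr2 tE mulrA ler_wpM2r ?subr_ge0//.
apply: le_trans (ler_norm _) _; apply: le_trans (Re_cn _) _.
by rewrite cnM cD ler_wpM2l ?hM ?cn_ge0.
Qed.

(** The integral from a fixed base point [a] is differentiated at interior points only, whence the
    restriction [a < x], and the lower bounds [xm] and [ym] in Goursat's lemma. *)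
Lemma primitive_real (f : R -> R) a : continuous f ->
  exists F : R -> R, forall x, a < x -> is_derive x 1 F (f x).
Proof.
move=> cf; exists (fun x => (\int[lebesgue_measure]_(t in [set` Interval (BLeft a) (BRight x)]) (f t))%R).
move=> x ax.
have xu : x < x + 1 by rewrite ltrDl.
have ig : lebesgue_measure.-integrable
    [set` Interval (BLeft a) (BRight (x + 1))] (EFin \o f).
  apply: continuous_compact_integrable; first exact: segment_compact.
  exact: continuous_subspaceT.
have [||dF FE] := continuous_FTC1 xu ig.
- by rewrite /= lte_fin.
- exact: cf.
by rewrite -FE derive1E; exact: derivableP.
Qed.

Lemma primitive_complex (k : R -> R[i]) a : (forall x, rcont k x) ->
  exists K : R -> R[i], forall x, a < x -> rder K x (k x).
Proof.
move=> ck.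
have cRe : continuous (fun x => complex.Re (k x)).
  move=> x; apply/cvgrPdist_le => e e0; apply/nearR.
  have [d d0 hd] := ck x e e0; exists d => // y /hd; rewrite cnBC => yx.
  by apply: le_trans yx; rewrite -ReB Re_cn.
have cIm : continuous (fun x => complex.Im (k x)).
  move=> x; apply/cvgrPdist_le => e e0; apply/nearR.
  have [d d0 hd] := ck x e e0; exists d => // y /hd; rewrite cnBC => yx.
  by apply: le_trans yx; rewrite -ImB Im_cn.
have [F hF] := primitive_real a cRe; have [G hG] := primitive_real a cIm.
exists (fun x => F x +i* G x) => x ax e e0.
have e20 : 0 < e / 2 by rewrite divr_gt0.
have /is_deriveP/(_ _ e20)[d d0 hd] := hF x ax.
have /is_deriveP/(_ _ e20)[d' d'0 hd'] := hG x ax.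
exists (Num.min d d'); first by rewrite lt_min d0.
move=> y; rewrite lt_min => /andP[/hd yd /hd' yd'].
apply: le_trans (cn_ReIm _) _.
rewrite !(ReB, ImB) /=; case: (k x) yd yd' => p q /= yd yd'.
rewrite !(mulr0, mul0r, subr0, add0r, addr0) [e]splitr mulrDl.
by rewrite lerD.
Qed.

End RealVariable.

(** * Bisection of rectangles *)

Section Bisection.
Variable R : realType.
Implicit Types (x y a b c d : R).

Lemma half_pow_small (w d : R) : 0 < d -> exists n, w / 2 ^+ n < d.
Proof.
move=> d0; exists (Num.bound `|w / d|); rewrite ltr_pdivrMr ?exprn_gt0//.
rewrite mulrC -ltr_pdivrMr//.
apply: le_lt_trans (ler_norm _) _; apply: lt_trans (archi_boundP (normr_ge0 _)) _.
by rewrite -natrX ltr_nat ltn_expl.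
Qed.

(** If [P] failed, it would fail on some quarter, and so on; the nested rectangles shrink to a
    point, around which [P] holds for all small rectangles. *)
Lemma rect_ind (P : R -> R -> R -> R -> Prop) x0 x1 y0 y1 :
  x0 <= x1 -> y0 <= y1 ->
  (forall a b c d, x0 <= a -> a <= b -> b <= x1 -> y0 <= c -> c <= d -> d <= y1 ->
    P a ((a + b) / 2) c ((c + d) / 2) -> P ((a + b) / 2) b c ((c + d) / 2) ->
    P a ((a + b) / 2) ((c + d) / 2) d -> P ((a + b) / 2) b ((c + d) / 2) d ->
    P a b c d) ->
  (forall x y, x0 <= x <= x1 -> y0 <= y <= y1 -> exists2 e, 0 < e &
    forall a b c d, x0 <= a -> a <= x -> x <= b -> b <= x1 ->
      y0 <= c -> c <= y -> y <= d -> d <= y1 -> b - a < e -> d - c < e ->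
      P a b c d) ->
  P x0 x1 y0 y1.
Proof.
move=> x01 y01 step small; apply: contrapT => nP.
pose ok (q : R * R * R * R) :=
  [/\ x0 <= q.1.1.1, q.1.1.1 <= q.1.1.2 & q.1.1.2 <= x1] /\
  [/\ y0 <= q.1.2, q.1.2 <= q.2 & q.2 <= y1].
pose bad (q : R * R * R * R) := ok q /\ ~ P q.1.1.1 q.1.1.2 q.1.2 q.2.
pose sub (q r : R * R * R * R) := [/\ q.1.1.1 <= r.1.1.1, r.1.1.2 <= q.1.1.2,
  q.1.2 <= r.1.2 & r.2 <= q.2] /\
  (r.1.1.2 - r.1.1.1 = (q.1.1.2 - q.1.1.1) / 2 /\
   r.2 - r.1.2 = (q.2 - q.1.2) / 2).
(* [choice] asks for a witness at every [q], so badness is a premise inside the existential. *)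
have ex q : exists r, bad q -> bad r /\ sub q r.
  have [bq|] := pselect (bad q); last by exists q.
  case: q bq => [[[a b] c] d] [[[/= xa ab bx] [yc cd dy]] nPq].
  apply: contrapT => no; apply: nPq; apply: step => //;
    apply: contrapT => nPr; apply: no.
  - exists (a, (a + b) / 2, c, (c + d) / 2) => _.
    by do !split => //=; lra.
  - exists ((a + b) / 2, b, c, (c + d) / 2) => _.
    by do !split => //=; lra.
  - exists (a, (a + b) / 2, (c + d) / 2, d) => _.
    by do !split => //=; lra.
  - exists ((a + b) / 2, b, (c + d) / 2, d) => _.
    by do !split => //=; lra.
have [f hf] := choice ex.
pose q n := iter n f (x0, x1, y0, y1).
have badq n : bad (q n).
  elim: n => [|n IH]; first by split=> //; split.
  by rewrite /q iterS; have [] := hf _ IH.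
have subq n : sub (q n) (q n.+1) by have [] := hf _ (badq n).
have monoq m n : (m <= n)%N -> [/\ (q m).1.1.1 <= (q n).1.1.1,
    (q n).1.1.2 <= (q m).1.1.2, (q m).1.2 <= (q n).1.2 & (q n).2 <= (q m).2].
  elim: n => [|n IH]; first by rewrite leqn0 => /eqP ->.
  rewrite leq_eqVlt => /orP[/eqP -> //|]; rewrite ltnS => /IH[? ? ? ?].
  have [[? ? ? ?] _] := subq n.
  by split; apply: le_trans; eassumption.
have widq n : (q n).1.1.2 - (q n).1.1.1 = (x1 - x0) / 2 ^+ n /\
    (q n).2 - (q n).1.2 = (y1 - y0) / 2 ^+ n.
  elim: n => [|n [IHx IHy]]; first by rewrite expr0 !divr1.
  have [_ [-> ->]] := subq n; rewrite IHx IHy exprS.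
  by split; field; rewrite expf_neq0.
have nest (u v : nat -> R) : (forall m n, (m <= n)%N -> u m <= u n) ->
    (forall m n, (m <= n)%N -> v n <= v m) -> (forall n, u n <= v n) ->
    exists x, forall n, u n <= x <= v n.
  move=> uS vS uv; pose E := [set u n | n in [set: nat]].
  have ubE n : ubound E (v n).
    move=> _ [m _ <-]; have [mn|/ltnW nm] := leqP m n.
      exact: le_trans (uS _ _ mn) (uv n).
    exact: le_trans (uv m) (vS _ _ nm).
  exists (sup E) => n; apply/andP; split.
    by apply: ub_le_sup; [exists (v 0%N); exact: ubE|exists n].
  by apply: ge_sup; [exists (u 0%N); exists 0%N|exact: ubE].
have [||n|x hx] := nest (fun n => (q n).1.1.1) (fun n => (q n).1.1.2).
- by move=> m n /monoq[].
- by move=> m n /monoq[].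
- by have [[[]]] := badq n.
have [||n|y hy] := nest (fun n => (q n).1.2) (fun n => (q n).2).
- by move=> m n /monoq[].
- by move=> m n /monoq[].
- by have [[_ []]] := badq n.
have [||e e0 he] := small x y; [exact: (hx 0%N)|exact: (hy 0%N)|].
have [n hn] := half_pow_small (x1 - x0) e0.
have [m hm] := half_pow_small (y1 - y0) e0.
pose N := maxn n m.
have pw (w : R) k : 0 <= w -> (k <= N)%N -> w / 2 ^+ N <= w / 2 ^+ k.
  move=> w0 kN; rewrite ler_wpM2l// lef_pV2 ?posrE ?exprn_gt0//.
  by rewrite ler_weXn2l ?ler1n.
have [[[? ? ?] [? ? ?]]] := badq N; apply.
have /andP[? ?] := hx N; have /andP[? ?] := hy N; have [wx wy] := widq N.
apply: he => //.
  by rewrite wx; apply: le_lt_trans hn; apply: pw; rewrite ?subr_ge0 ?leq_maxl.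
by rewrite wy; apply: le_lt_trans hm; apply: pw; rewrite ?subr_ge0 ?leq_maxr.
Qed.

End Bisection.

(** * Goursat's lemma *)

Section Primitive.
Variable R : realType.
Implicit Types (x y a b c d e M : R) (z w l v : R[i]) (f g : R[i] -> R[i]).

Lemma rderB (K L : R -> R[i]) x l m : rder K x l -> rder L x m ->
  rder (fun t => K t - L t) x (l - m).
Proof.
move=> hK hL e e0; have e20 : 0 < e / 2 by rewrite divr_gt0.
have [d d0 hd] := hK _ e20; have [d' d'0 hd'] := hL _ e20.
exists (Num.min d d'); first by rewrite lt_min d0.
move=> y; rewrite lt_min => /andP[yd yd'].
have -> : K y - L y - (K x - L x) - (l - m) * (y - x)%:C =
  (K y - K x - l * (y - x)%:C) - (L y - L x - m * (y - x)%:C) by ring.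
apply: le_trans (cnB _ _) _; rewrite [e]splitr mulrDl.
by rewrite lerD ?hd ?hd'.
Qed.

Lemma rderZ z (K : R -> R[i]) x l : rder K x l -> rder (fun t => z * K t) x (z * l).
Proof.
move=> hK e e0; pose L := 1 + cn z.
have L0 : 0 < L by rewrite ltr_wpDr ?cn_ge0.
have [|d d0 hd] := hK (e / L); first by rewrite divr_gt0.
exists d => // y /hd yx.
have -> : z * K y - z * K x - z * l * (y - x)%:C =
  z * (K y - K x - l * (y - x)%:C) by ring.
rewrite cnM; apply: (@le_trans _ _ (L * (e / L * `|y - x|))).
  by rewrite ler_pM ?cn_ge0// /L lerDr.
by rewrite mulrA mulrCA divff ?mulr1// gt_eqF.
Qed.

Lemma rder_cder f z v x l : cder f (z + x%:C * v) l ->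
  rder (fun t => f (z + t%:C * v)) x (l * v).
Proof.
move=> hf e e0; pose L := 1 + cn v.
have L0 : 0 < L by rewrite ltr_wpDr ?cn_ge0.
have [|d d0 hd] := hf (e / L); first by rewrite divr_gt0.
exists (d / L); first by rewrite divr_gt0.
move=> y yx.
have E : z + y%:C * v - (z + x%:C * v) = (y - x)%:C * v by rewrite rmorphB; ring.
have le1 : cn ((y - x)%:C * v) <= L * `|y - x|.
  by rewrite cnM cn_real mulrC ler_wpM2r// /L lerDr.
have := hd (z + y%:C * v); rewrite E => /(_ _)/le_trans h.
rewrite -mulrA [v * _]mulrC; apply: h.
  by apply: le_lt_trans le1 _; rewrite mulrC -ltr_pdivlMr.
apply: (@le_trans _ _ (e / L * (L * `|y - x|))).
  by rewrite ler_wpM2l// ltW// divr_gt0.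
by rewrite mulrA divfK// gt_eqF.
Qed.

Lemma complex_addi x y : x +i* y = x%:C + y%:C * 'i.
Proof. by simpc. Qed.

Lemma rder_h f x y l : cder f (x +i* y) l -> rder (fun t => f (t +i* y)) x l.
Proof.
rewrite complex_addi addrC -[x%:C]mulr1 => /rder_cder; rewrite mulr1.
by under eq_fun do rewrite mulr1 addrC -complex_addi.
Qed.

Lemma rder_v f x y l : cder f (x +i* y) l -> rder (fun t => f (x +i* t)) y ('i * l).
Proof.
rewrite complex_addi => /rder_cder; rewrite mulrC.
by under eq_fun do rewrite -complex_addi.
Qed.

Lemma MVI_sym (K k : R -> R[i]) a b M :
  (forall x, `|x - a| <= `|b - a| -> rder K x (k x)) ->
  (forall x, `|x - a| <= `|b - a| -> cn (k x) <= M) ->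
  cn (K b - K a) <= M * `|b - a|.
Proof.
move=> hK hM; case/orP: (le_total a b) => [ab|ba].
  rewrite [X in M * X]ger0_norm ?subr_ge0//; apply: (MVI ab (k := k)) => x /andP[ax xb];
  [apply: hK|apply: hM]; by rewrite !ger0_norm ?subr_ge0// lerD2r.
rewrite cnBC distrC [X in M * X]ger0_norm ?subr_ge0//.
by apply: (MVI ba (k := k)) => x /andP[bx xa]; [apply: hK|apply: hM];
  rewrite distrC [leRHS]distrC !ger0_norm ?subr_ge0// lerD2l lerN2.
Qed.

Variables (g : R[i] -> R[i]) (xm ym : R) (A B : R -> R -> R[i]).
Hypothesis hA : forall y x, xm < x -> rder (A y) x (g (x +i* y)).
Hypothesis hB : forall x y, ym < y -> rder (B x) y (g (x +i* y)).

(** The integral of [g] along the boundary of the rectangle, with [A y] a primitive along the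
    horizontal line at height [y] and [B x] along the vertical line at [x], where [dz = 'i dy]. *)
Let rectI a b c d := A c b - A c a + 'i * (B b d - B b c)
  - (A d b - A d a) - 'i * (B a d - B a c).

Lemma goursat_le x0 x1 y0 y1 : xm < x0 -> x0 <= x1 -> ym < y0 -> y0 <= y1 ->
  (forall x y, x0 <= x <= x1 -> y0 <= y <= y1 -> hol g (x +i* y)) ->
  rectI x0 x1 y0 y1 = 0.
Proof.
move=> xm0 x01 ym0 y01 hg.
(* The square of the half-perimeter is divided by 4 for each quarter of a rectangle, so the bounds
   for the four quarters add up to the bound for the whole. *)
suff H e : 0 < e -> cn (rectI x0 x1 y0 y1) <= e * (x1 - x0 + (y1 - y0)) ^+ 2.
  apply/eqP; rewrite -cn_eq0 eq_le cn_ge0 andbT; apply/ler_addgt0Pl => e e0.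
  rewrite addr0; set W := (x1 - x0 + (y1 - y0)) ^+ 2 in H.
  have W0 : 0 <= W by exact: sqr_ge0.
  have W1 : 0 < W + 1 by rewrite ltr_wpDl.
  have eW : 0 < e / (W + 1) by rewrite divr_gt0.
  apply: le_trans (H _ eW) _; rewrite mulrAC ler_pdivrMr// ler_wpM2l ?(ltW e0)//.
  by rewrite lerDl.
move=> e0.
apply: (rect_ind (P := fun a b c d => cn (rectI a b c d) <= e * (b - a + (d - c)) ^+ 2)) => //.
  move=> a b c d _ _ _ _ _ _ h1 h2 h3 h4.
  set m := (a + b) / 2 in h1 h2 h3 h4; set n := (c + d) / 2 in h1 h2 h3 h4.
  have -> : rectI a b c d = rectI a m c n + rectI m b c n + (rectI a m n d + rectI m b n d).
    rewrite /rectI; ring.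
  apply: le_trans (cnD _ _) _.
  apply: le_trans (lerD (cnD _ _) (cnD _ _)) _.
  apply: le_trans (lerD (lerD h1 h2) (lerD h3 h4)) _.
  by rewrite le_eqVlt; apply/orP; left; apply/eqP; rewrite /m /n; field.
move=> x y hx hy; have [l hl] := hg x y hx hy.
set z0 := x +i* y in hl.
have e20 : 0 < e / 2 by rewrite divr_gt0.
have [del del0 hdel] := hl _ e20.
exists (del / 2); first by rewrite divr_gt0.
move=> a b c d xa ax xb bx yc cy yd dy ba dc.
set W := b - a + (d - c).
have W0 : 0 <= W by rewrite /W; lra.
(* The affine part [T] has the primitive [Phi] and contributes nothing to the closed contour. What
   remains is at most [e / 2 * W] on a contour of length [2 * W]. *)
pose T z := g z0 + l * (z - z0).
pose Phi z := g z0 * z + l / 2 * (z - z0) ^+ 2.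
have dPhi z : cder Phi z (T z) by exact: cder_quadratic.
have near_T t u : a <= t <= b -> c <= u <= d ->
    cn (g (t +i* u) - T (t +i* u)) <= e / 2 * W.
  move=> /andP[at_ tb] /andP[cu ud].
  have le1 : cn (t +i* u - z0) <= W.
    apply: le_trans (cn_ReIm _) _; rewrite /z0 /W /= lerD// ler_norml;
    by apply/andP; split; lra.
  rewrite /T opprD addrA; apply: le_trans (hdel _ _) _.
    by apply: le_lt_trans le1 _; rewrite /W; lra.
  by rewrite ler_wpM2l// ltW.
have hor u : c <= u <= d ->
    cn (A u b - A u a - (Phi (b +i* u) - Phi (a +i* u))) <= e / 2 * W * (b - a).
  move=> hu.
  have -> : A u b - A u a - (Phi (b +i* u) - Phi (a +i* u)) =
    (A u b - Phi (b +i* u)) - (A u a - Phi (a +i* u)) by ring.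
  apply: (@MVI _ (fun t => A u t - Phi (t +i* u))
                 (fun t => g (t +i* u) - T (t +i* u))); first by lra.
    move=> t /andP[at_ tb]; apply: rderB; first by apply: hA; lra.
    exact: rder_h.
  by move=> t ht; exact: near_T.
have ver t : a <= t <= b ->
    cn ('i * (B t d - B t c) - (Phi (t +i* d) - Phi (t +i* c))) <= e / 2 * W * (d - c).
  move=> ht.
  have -> : 'i * (B t d - B t c) - (Phi (t +i* d) - Phi (t +i* c)) =
    ('i * B t d - Phi (t +i* d)) - ('i * B t c - Phi (t +i* c)) by ring.
  apply: (@MVI _ (fun u => 'i * B t u - Phi (t +i* u))
                 (fun u => 'i * g (t +i* u) - 'i * T (t +i* u))); first by lra.
    move=> u /andP[cu ud]; apply: rderB; last exact: rder_v.
    by apply: rderZ; apply: hB; lra.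
  by move=> u hu; rewrite -mulrBr cnM cn_i mul1r; exact: near_T.
have hc : c <= c <= d by rewrite lexx; lra.
have hd : c <= d <= d by rewrite lexx andbT; lra.
have ha : a <= a <= b by rewrite lexx; lra.
have hb : a <= b <= b by rewrite lexx andbT; lra.
have -> : rectI a b c d =
  (A c b - A c a - (Phi (b +i* c) - Phi (a +i* c))) +
  ('i * (B b d - B b c) - (Phi (b +i* d) - Phi (b +i* c))) -
  ((A d b - A d a - (Phi (b +i* d) - Phi (a +i* d))) +
  ('i * (B a d - B a c) - (Phi (a +i* d) - Phi (a +i* c)))).
  by rewrite /rectI; ring.
apply: le_trans (cnB _ _) _.
apply: le_trans (lerD (cnD _ _) (cnD _ _)) _.
apply: le_trans (lerD (lerD (hor c hc) (ver b hb)) (lerD (hor d hd) (ver a ha))) _.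
by rewrite le_eqVlt; apply/orP; left; apply/eqP; rewrite /W; field.
Qed.

Lemma goursat x0 x1 y0 y1 : xm < x0 -> xm < x1 -> ym < y0 -> ym < y1 ->
  (forall x y, Num.min x0 x1 <= x <= Num.max x0 x1 ->
     Num.min y0 y1 <= y <= Num.max y0 y1 -> hol g (x +i* y)) ->
  rectI x0 x1 y0 y1 = 0.
Proof.
move=> x0m x1m y0m y1m hg.
case/orP: (le_total x0 x1) => x01; case/orP: (le_total y0 y1) => y01.
- apply: goursat_le => // x y hx hy; apply: hg.
    by rewrite (min_idPl x01) (max_idPr x01).
  by rewrite (min_idPl y01) (max_idPr y01).
- have -> : rectI x0 x1 y0 y1 = - rectI x0 x1 y1 y0 by rewrite /rectI; ring.
  rewrite goursat_le ?oppr0// => x y hx hy; apply: hg.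
    by rewrite (min_idPl x01) (max_idPr x01).
  by rewrite (min_idPr y01) (max_idPl y01).
- have -> : rectI x0 x1 y0 y1 = - rectI x1 x0 y0 y1 by rewrite /rectI; ring.
  rewrite goursat_le ?oppr0// => x y hx hy; apply: hg.
    by rewrite (min_idPr x01) (max_idPl x01).
  by rewrite (min_idPl y01) (max_idPr y01).
- have -> : rectI x0 x1 y0 y1 = rectI x1 x0 y1 y0 by rewrite /rectI; ring.
  rewrite goursat_le// => x y hx hy; apply: hg.
    by rewrite (min_idPr x01) (max_idPl x01).
  by rewrite (min_idPr y01) (max_idPl y01).
Qed.

End Primitive.

(** * Local primitives of holomorphic functions *)

Section PrimitiveNear.
Variable R : realType.
Implicit Types (x y a b c d e M s : R) (z w l v : R[i]) (f g : R[i] -> R[i]).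

(** The primitive integrates [g] from the centre along a horizontal, then a vertical segment.
    Continuity on the whole plane is what [primitive_complex] asks for on every line. *)
Lemma primitive_box g p q s : (forall z, ccont g z) ->
  (forall x y, `|x - p| < s -> `|y - q| < s -> hol g (x +i* y)) ->
  exists G, forall x y, `|x - p| < s -> `|y - q| < s ->
    cder G (x +i* y) (g (x +i* y)).
Proof.
move=> cg hg.
have /choice[A hA] : forall y, exists K : R -> R[i], forall x, p - s < x ->
    rder K x (g (x +i* y)).
  move=> y; apply: primitive_complex => x e e0.
  have [d d0 hd] := cg (x +i* y) e e0; exists d => // t tx; apply: hd.
  apply: le_lt_trans tx; apply: le_trans (cn_ReIm _) _.
  by rewrite /= subrr normr0 addr0.
have /choice[B hB] : forall x, exists K : R -> R[i], forall y, q - s < y ->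
    rder K y (g (x +i* y)).
  move=> x; apply: primitive_complex => y e e0.
  have [d d0 hd] := cg (x +i* y) e e0; exists d => // t ty; apply: hd.
  apply: le_lt_trans ty; apply: le_trans (cn_ReIm _) _.
  by rewrite /= subrr normr0 add0r.
exists (fun z => A q (complex.Re z) - A q p +
  'i * (B (complex.Re z) (complex.Im z) - B (complex.Re z) q)).
move=> x y xs ys e e0.
have e20 : 0 < e / 2 by rewrite divr_gt0.
have [d d0 hd] := cg (x +i* y) _ e20.
exists (Num.min d (Num.min (s - `|x - p|) (s - `|y - q|))).
  by rewrite !lt_min d0 !subr_gt0 xs.
case=> x' y'; rewrite !lt_min => /andP[wd /andP[wx wy]].
have xx : `|x' - x| <= cn (x' +i* y' - x +i* y) := Re_cn (x' +i* y' - x +i* y).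
have yy : `|y' - y| <= cn (x' +i* y' - x +i* y) := Im_cn (x' +i* y' - x +i* y).
set D := cn _ in wd wx wy xx yy *.
have xs' : `|x' - p| < s.
  by have := ler_distD x x' p; lra.
have ys' : `|y' - q| < s.
  by have := ler_distD y y' q; lra.
have s0 : 0 < s by apply: le_lt_trans xs.
have lowx t : `|t - p| < s -> p - s < t by rewrite ltr_norml; lra.
have lowy t : `|t - q| < s -> q - s < t by rewrite ltr_norml; lra.
have qs : `|q - q| < s by rewrite subrr normr0.
have btw (t u v r : R) : `|u - r| < s -> `|v - r| < s ->
    Num.min u v <= t <= Num.max u v -> `|t - r| < s.
  rewrite !ltr_norml => hu hv; case/orP: (le_total u v) => uv.
    by rewrite (min_idPl uv) (max_idPr uv); lra.
  by rewrite (min_idPr uv) (max_idPl uv); lra.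
(* Goursat's lemma on the rectangle with corners [x +i* q] and [x' +i* y] moves the horizontal path
   up to height [y], so that the increment of the primitive involves [g] only near [x +i* y]. *)
have rect0 := goursat hA hB (lowx _ xs) (lowx _ xs') (lowy _ qs) (lowy _ ys)
  (fun t u tx uy => hg t u (btw _ _ _ _ xs xs' tx) (btw _ _ _ _ qs ys uy)).
rewrite /=; set Gd := _ - _ - _.
have -> : Gd = (A y x' - A y x - g (x +i* y) * (x' - x)%:C) +
  'i * (B x' y' - B x' y - g (x +i* y) * (y' - y)%:C).
  rewrite -[LHS]subr0 -[X in _ - X]rect0 /Gd.
  have -> : x' +i* y' - x +i* y = (x' - x)%:C + 'i * (y' - y)%:C.
    by rewrite !complex_addi !rmorphB; ring.
  by ring.
have h1 : cn (A y x' - A y x - g (x +i* y) * (x' - x)%:C) <= e / 2 * `|x' - x|.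
  have -> : A y x' - A y x - g (x +i* y) * (x' - x)%:C =
    (A y x' - g (x +i* y) * x'%:C) - (A y x - g (x +i* y) * x%:C).
    by rewrite rmorphB; ring.
  apply: (@MVI_sym _ (fun t => A y t - g (x +i* y) * t%:C)
                     (fun t => g (t +i* y) - g (x +i* y) * 1)).
    move=> t tx; apply: rderB.
      apply: hA; apply: lowx; have := ler_distD x t p; lra.
    apply: rderZ => r r0; exists 1 => // u _.
    by rewrite mul1r rmorphB subrr cn0 mulr_ge0// ltW.
  move=> t tx; rewrite mulr1; apply: hd; apply: le_lt_trans wd.
  apply: le_trans xx; apply: le_trans tx; apply: le_trans (cn_ReIm _) _.
  by rewrite /= subrr normr0 addr0.
have h2 : cn (B x' y' - B x' y - g (x +i* y) * (y' - y)%:C) <= e / 2 * `|y' - y|.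
  have -> : B x' y' - B x' y - g (x +i* y) * (y' - y)%:C =
    (B x' y' - g (x +i* y) * y'%:C) - (B x' y - g (x +i* y) * y%:C).
    by rewrite rmorphB; ring.
  apply: (@MVI_sym _ (fun t => B x' t - g (x +i* y) * t%:C)
                     (fun t => g (x' +i* t) - g (x +i* y) * 1)).
    move=> t ty; apply: rderB.
      apply: hB; apply: lowy; have := ler_distD y t q; lra.
    apply: rderZ => r r0; exists 1 => // u _.
    by rewrite mul1r rmorphB subrr cn0 mulr_ge0// ltW.
  move=> t ty; rewrite mulr1; apply: hd; apply: le_lt_trans wd.
  rewrite /D /cn /= ler_wsqrtr// lerD2l -[leLHS]real_normK ?num_real//.
  by rewrite -[leRHS]real_normK ?num_real// lerXn2r ?nnegrE.
apply: le_trans (cnD _ _) _; rewrite cnM cn_i mul1r.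
apply: le_trans (lerD h1 h2) _.
have -> : e * D = e / 2 * D + e / 2 * D by rewrite -mulrDl -splitr.
by rewrite lerD// ler_wpM2l// ltW.
Qed.

(** The retraction onto a segment: composing with it extends a function from a square to the plane
    and preserves continuity. *)
Definition clamp p s x := Num.max (p - s) (Num.min x (p + s)).

Lemma clamp_id p s x : `|x - p| <= s -> clamp p s x = x.
Proof.
rewrite ler_norml => xp; rewrite /clamp min_l; last by lra.
by rewrite max_r//; lra.
Qed.

Lemma clamp_in p s x : 0 <= s -> `|clamp p s x - p| <= s.
Proof.
move=> s0; rewrite /clamp ler_norml maxEle minEle.
by case: ifPn; case: ifPn => ? ?; apply/andP; split; lra.
Qed.

Lemma clamp_lip p s x y : 0 <= s -> `|clamp p s x - clamp p s y| <= `|x - y|.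
Proof.
move=> s0; have h t : clamp p s t = p - s /\ t <= p - s \/ clamp p s t = p + s /\ p + s <= t
    \/ clamp p s t = t /\ (p - s <= t /\ t <= p + s).
  rewrite /clamp; case/orP: (le_total t (p + s)) => t1.
    rewrite (min_idPl t1); case/orP: (le_total t (p - s)) => t2.
      by rewrite (max_idPl t2); left.
    by rewrite (max_idPr t2); right; right.
  by rewrite (min_idPr t1) max_r; [right; left|lra].
by rewrite ler_norml; case: (h x) => [[-> ?]|[[-> ?]|[-> ?]]];
  case: (h y) => [[-> ?]|[[-> ?]|[-> ?]]]; case: (lerP x y) => ?;
  apply/andP; split; lra.
Qed.

Lemma primitive_near g z r : 0 < r ->
  (forall w, cn (w - z) < r -> hol g w) ->
  exists G, forall w, cn (w - z) < r / 4 -> cder G w (g w).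
Proof.
(* The square of half-side [r / 4] contains the disc of radius [r / 4] and lies in the disc of
   radius [r]. *)
case: z => p q r0 hg; pose s := r / 4; have s0 : 0 < s by rewrite divr_gt0.
pose cl w := clamp p s (complex.Re w) +i* clamp q s (complex.Im w).
have cls w : cn (cl w - (p +i* q)) < r.
  apply: le_lt_trans (cn_ReIm _) _ => /=.
  have := clamp_in p (complex.Re w) (ltW s0); have := clamp_in q (complex.Im w) (ltW s0).
  rewrite /s; lra.
have cll w w' : cn (cl w - cl w') <= 2 * cn (w - w').
  apply: le_trans (cn_ReIm _) _ => /=; rewrite mulr_natl mulr2n lerD//.
    by apply: le_trans (clamp_lip _ _ _ (ltW s0)) _; rewrite -ReB Re_cn.
  by apply: le_trans (clamp_lip _ _ _ (ltW s0)) _; rewrite -ImB Im_cn.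
have clid x y : `|x - p| <= s -> `|y - q| <= s -> cl (x +i* y) = x +i* y.
  by move=> xp yq; rewrite /cl /= !clamp_id.
have cg w : ccont (g \o cl) w.
  move=> e e0; have [d d0 hd] := hol_ccont (hg _ (cls w)) e0.
  exists (d / 2); first by rewrite divr_gt0.
  move=> v vw; apply: hd; apply: le_lt_trans (cll _ _) _.
  by rewrite mulrC -ltr_pdivlMr.
have [x y xp yq|G hG] := primitive_box (p := p) (q := q) (s := s) cg.
  pose m := Num.min (s - `|x - p|) (s - `|y - q|).
  have m0 : 0 < m by rewrite lt_min !subr_gt0 xp.
  apply: (@hol_near _ g _ _ m m0).
    case=> x' y'; rewrite /m lt_min => /andP[wx wy] /=.
    have xx : `|x' - x| <= cn (x' +i* y' - x +i* y) := Re_cn (x' +i* y' - x +i* y).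
    have yy : `|y' - y| <= cn (x' +i* y' - x +i* y) := Im_cn (x' +i* y' - x +i* y).
    rewrite clid//; [have := ler_distD x x' p|have := ler_distD y y' q]; lra.
  apply: hg; apply: le_lt_trans (cn_ReIm _) _ => /=.
  by move: xp yq; rewrite /s; lra.
exists G => -[x y] xy.
have xp : `|x - p| < s by apply: le_lt_trans xy; exact: (Re_cn (x +i* y - p +i* q)).
have yq : `|y - q| < s by apply: le_lt_trans xy; exact: (Im_cn (x +i* y - p +i* q)).
by have := hG x y xp yq; rewrite /= clid// ltW.
Qed.

End PrimitiveNear.

(** * The four-point maximum principle *)

Section MaximumModulus.
Variable R : realType.
Implicit Types (x y p q r s t e d M : R) (z w a l v : R[i]) (f g : R[i] -> R[i]).

Lemma MVI_seg f f' z w M :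
  (forall v, cn (v - z) <= cn (w - z) -> cder f v (f' v)) ->
  (forall v, cn (v - z) <= cn (w - z) -> cn (f' v) <= M) ->
  cn (f w - f z) <= M * cn (w - z).
Proof.
move=> df bf.
have seg t : 0 <= t <= 1 -> cn (z + t%:C * (w - z) - z) <= cn (w - z).
  move=> /andP[t0 t1]; rewrite addrC addKr cnM cn_real ger0_norm//.
  by rewrite ler_piMl// cn_ge0.
have := @MVI _ (fun t => f (z + t%:C * (w - z)))
  (fun t => f' (z + t%:C * (w - z)) * (w - z)) 0 1 (M * cn (w - z)) ler01.
rewrite /= rmorph1 mul1r [z + (w - z)]addrC subrK rmorph0 mul0r addr0 subr0 mulr1; apply.
  by move=> t /seg /df; exact: rder_cder.
by move=> t /seg /bf h; rewrite cnM ler_wpM2r// cn_ge0.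
Qed.

(** The difference of [f] and its quadratic Taylor polynomial has derivative [f' - T], which is
    small compared with [v - z]; the mean value inequality on the segment gains one more factor. *)
Lemma taylor2 f f' z l r : 0 < r ->
  (forall w, cn (w - z) < r -> cder f w (f' w)) -> cder f' z l ->
  forall e, 0 < e -> exists2 d, 0 < d & forall w, cn (w - z) < d ->
    cn (f w - f z - f' z * (w - z) - l / 2 * (w - z) ^+ 2) <= e * cn (w - z) ^+ 2.
Proof.
move=> r0 df dl e e0; have [d d0 hd] := dl e e0.
exists (Num.min d r); first by rewrite lt_min d0.
move=> w; rewrite lt_min => /andP[wd wr].
pose T v := f' z + l * (v - z).
pose Phi v := f' z * v + l / 2 * (v - z) ^+ 2.
have dPhi v : cder Phi v (T v) by exact: cder_quadratic.
have -> : f w - f z - f' z * (w - z) - l / 2 * (w - z) ^+ 2 =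
    (f w - Phi w) - (f z - Phi z).
  by rewrite /Phi subrr; ring.
rewrite expr2 mulrA.
apply: (@MVI_seg (fun v => f v - Phi v) (fun v => f' v - T v)) => v vw.
  by apply: cderB => //; apply: df; apply: le_lt_trans vw _.
rewrite /T opprD addrA; apply: le_trans (hd _ _) _; first exact: le_lt_trans vw _.
by rewrite ler_wpM2l// ltW.
Qed.

(** The discrete Laplacian of step [t] is negligible with respect to [t ^ 2]: a pointwise substitute
    for harmonicity. *)
Definition fourpoint f z := forall e, 0 < e -> exists2 d, 0 < d &
  forall t, 0 < t -> t < d ->
    cn (f (z + t%:C) + f (z - t%:C) + f (z + 'i * t%:C) + f (z - 'i * t%:C)
        - 4 * f z) <= e * t ^+ 2.

(** Over the four steps [t], [-t], ['i t], [-'i t] both the sum of the steps and the sum of their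
    squares vanish, so only the Taylor remainder is left. *)
Lemma fourpoint_C2 f f' z l r : 0 < r ->
  (forall w, cn (w - z) < r -> cder f w (f' w)) -> cder f' z l -> fourpoint f z.
Proof.
move=> r0 df dl e e0.
have e40 : 0 < e / 4 by rewrite divr_gt0.
have [d d0 hd] := taylor2 r0 df dl e40; exists d => // t t0 td.
have cnt : cn t%:C = t :> R by rewrite cn_real gtr0_norm.
have h v : cn v = t -> cn (f (z + v) - f z - f' z * v - l / 2 * v ^+ 2) <= e / 4 * t ^+ 2.
  move=> vt; have := hd (z + v); rewrite addrC addKr vt => /(_ td).
  by rewrite [z + v]addrC.
have -> : f (z + t%:C) + f (z - t%:C) + f (z + 'i * t%:C) + f (z - 'i * t%:C) - 4 * f z =
  (f (z + t%:C) - f z - f' z * t%:C - l / 2 * t%:C ^+ 2) +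
  (f (z + - t%:C) - f z - f' z * - t%:C - l / 2 * (- t%:C) ^+ 2) +
  ((f (z + 'i * t%:C) - f z - f' z * ('i * t%:C) - l / 2 * ('i * t%:C) ^+ 2) +
  (f (z + - ('i * t%:C)) - f z - f' z * - ('i * t%:C) - l / 2 * (- ('i * t%:C)) ^+ 2)).
  by rewrite !sqrrN exprMn sqr_i; ring.
apply: le_trans (cnD _ _) _; apply: le_trans (lerD (cnD _ _) (cnD _ _)) _.
have -> : e * t ^+ 2 = e / 4 * t ^+ 2 + e / 4 * t ^+ 2 + (e / 4 * t ^+ 2 + e / 4 * t ^+ 2).
  by field.
by rewrite !lerD// h// ?cnN// ?cnM ?cn_i ?mul1r.
Qed.

(** If a value exceeded [M], then [cn f] plus a small multiple [e] of the squared distance to the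
    centre would reach its maximum inside the square. This is impossible: over four neighbours at
    distance [t] the quadratic term gains [4 e t ^ 2] in total, while the sum of the moduli loses at
    most [e t ^ 2]. *)
Lemma max_box f p q s M : 0 < s ->
  (forall x y, `|x - p| <= s -> `|y - q| <= s -> ccont f (x +i* y)) ->
  (forall x y, `|x - p| < s -> `|y - q| < s -> fourpoint f (x +i* y)) ->
  (forall x y, `|x - p| <= s -> `|y - q| <= s -> `|x - p| = s \/ `|y - q| = s ->
     cn (f (x +i* y)) <= M) ->
  forall x y, `|x - p| <= s -> `|y - q| <= s -> cn (f (x +i* y)) <= M.
Proof.
move=> s0 cf mf bf x1 y1 hx1 hy1; rewrite leNgt; apply/negP => M1.
(* On the square the quadratic term is at most [e * (2 * s ^+ 2)], which is half of the excess over
   [M]; the boundary values of [u] thus stay below [u x1 y1]. *)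
pose e := (cn (f (x1 +i* y1)) - M) / (4 * s ^+ 2).
have s20 : 0 < s ^+ 2 by rewrite exprn_gt0.
have e0 : 0 < e by rewrite divr_gt0 ?subr_gt0// mulr_gt0.
have eE : e * (2 * s ^+ 2) = (cn (f (x1 +i* y1)) - M) / 2.
  by rewrite /e; field; rewrite gt_eqF.
pose u x y := cn (f (x +i* y)) + e * ((x - p) ^+ 2 + (y - q) ^+ 2).
pose U (z : R * R) := u (clamp p s z.1) (clamp q s z.2).
pose K := [set` `[p - s, p + s]] `*` [set` `[q - s, q + s]].
have Kin (x y : R) : K (x, y) <-> `|x - p| <= s /\ `|y - q| <= s.
  by rewrite /K /= !in_itv /= !ler_norml; split=> -[h1 h2]; split; lra.
have cK : compact K by apply: compact_setX; exact: segment_compact.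
have K0 : K !=set0 by exists (p, q); apply/Kin; rewrite !subrr normr0; split; exact: ltW.
have cU : {within K, continuous U}.
  apply: continuous_subspaceT => -[x y]; apply/cvgrPdist_le => eps eps0.
  pose x' := clamp p s x; pose y' := clamp q s y.
  have hx' : `|x' - p| <= s by apply: clamp_in; exact: ltW.
  have hy' : `|y' - q| <= s by apply: clamp_in; exact: ltW.
  have ep : 0 < eps / 2 by rewrite divr_gt0.
  have [d d0 hd] := cf _ _ hx' hy' _ ep.
  have D0 : 0 < eps / (8 * e * s) by apply: divr_gt0 => //; rewrite mulr_gt0// mulr_gt0.
  pose r := Num.min (d / 2) (eps / (8 * e * s)).
  have r0 : 0 < r by rewrite lt_min D0 divr_gt0.
  exists (ball x r, ball y r); first by split; apply: nbhsx_ballx.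
  case=> X Y [/= hX hY].
  rewrite /ball /= in hX hY.
  have {hX}hX : `|x' - clamp p s X| < r.
    by apply: le_lt_trans hX; apply: clamp_lip; exact: ltW.
  have {hY}hY : `|y' - clamp q s Y| < r.
    by apply: le_lt_trans hY; apply: clamp_lip; exact: ltW.
  rewrite /U /= -/x' -/y' /u.
  have hX' : `|clamp p s X - p| <= s by apply: clamp_in; exact: ltW.
  have hY' : `|clamp q s Y - q| <= s by apply: clamp_in; exact: ltW.
  move: (clamp p s X) (clamp q s Y) hX hY hX' hY' => X' Y' hX hY hX' hY'.
  have [rd re] : r <= d / 2 /\ r <= eps / (8 * e * s).
    by split; rewrite ge_min lexx ?orbT.
  have h1 : cn (f (X' +i* Y') - f (x' +i* y')) <= eps / 2.
    apply: hd; apply: le_lt_trans (cn_ReIm _) _ => /=.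
    rewrite [`|X' - _|]distrC [`|Y' - _|]distrC; lra.
  have sq (m X0 x0 : R) : `|x0 - m| <= s -> `|X0 - m| <= s -> `|x0 - X0| < r ->
      `|(x0 - m) ^+ 2 - (X0 - m) ^+ 2| <= 2 * s * r.
    move=> h2 h3 h4; have -> : (x0 - m) ^+ 2 - (X0 - m) ^+ 2 =
      ((x0 - m) + (X0 - m)) * (x0 - X0) by ring.
    rewrite normrM ler_pM//; last exact: ltW.
    by apply: le_trans (ler_normD _ _) _; lra.
  have hp := sq p X' x' hx' hX' hX; have hq := sq q Y' y' hy' hY' hY.
  have -> : cn (f (x' +i* y')) + e * ((x' - p) ^+ 2 + (y' - q) ^+ 2) -
    (cn (f (X' +i* Y')) + e * ((X' - p) ^+ 2 + (Y' - q) ^+ 2)) =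
    (cn (f (x' +i* y')) - cn (f (X' +i* Y'))) +
    e * (((x' - p) ^+ 2 - (X' - p) ^+ 2) + ((y' - q) ^+ 2 - (Y' - q) ^+ 2)) by ring.
  apply: le_trans (ler_normD _ _) _.
  rewrite [eps]splitr lerD//.
    rewrite ler_norml; have := cn_leB (f (x' +i* y')) (f (X' +i* Y')).
    have := cn_leB (f (X' +i* Y')) (f (x' +i* y')); rewrite cnBC in h1.
    by rewrite (cnBC (f (X' +i* Y'))); lra.
  rewrite normrM (gtr0_norm e0).
  apply: (@le_trans _ _ (e * (2 * s * r + 2 * s * r))).
    rewrite ler_wpM2l ?(ltW e0)//; apply: le_trans (ler_normD _ _) _.
    by rewrite lerD.
  apply: (@le_trans _ _ (e * (4 * s * (eps / (8 * e * s))))).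
    rewrite ler_wpM2l ?(ltW e0)//.
    have -> : 2 * s * r + 2 * s * r = 4 * s * r by ring.
    by rewrite ler_wpM2l// mulr_ge0// ltW.
  by rewrite le_eqVlt; apply/orP; left; apply/eqP; field; rewrite !gt_eqF.
have [[x0 y0] xyK maxU] := compact_EVT_max K0 cK cU.
rewrite inE in xyK; have [hx0 hy0] := (Kin _ _).1 xyK.
have {}maxU x y : `|x - p| <= s -> `|y - q| <= s -> u x y <= u x0 y0.
  move=> hx hy; have := maxU (x, y); rewrite inE => /(_ ((Kin x y).2 (conj hx hy))).
  by rewrite /U /= !clamp_id.
have sqs (x m : R) : `|x - m| <= s -> (x - m) ^+ 2 <= s ^+ 2.
  by move=> h; rewrite -[_ ^+ 2]real_normK ?num_real// lerXn2r ?nnegrE// ltW.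
have u0M : M + e * (2 * s ^+ 2) < u x0 y0.
  apply: lt_le_trans (maxU _ _ hx1 hy1); rewrite /u eE.
  have : 0 <= e * ((x1 - p) ^+ 2 + (y1 - q) ^+ 2).
    by rewrite mulr_ge0 ?(ltW e0)// addr_ge0// sqr_ge0.
  lra.
have nb : ~ (`|x0 - p| = s \/ `|y0 - q| = s).
  move=> /(bf _ _ hx0 hy0) fM; move: u0M; apply/negP; rewrite -leNgt /u lerD//.
  rewrite ler_wpM2l ?(ltW e0)//.
  by have := sqs _ _ hx0; have := sqs _ _ hy0; lra.
have hx : `|x0 - p| < s by rewrite lt_neqAle hx0 andbT; apply/eqP => h; apply: nb; left.
have hy : `|y0 - q| < s by rewrite lt_neqAle hy0 andbT; apply/eqP => h; apply: nb; right.
have [d d0 hd] := mf _ _ hx hy e e0.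
pose m := Num.min d (Num.min (s - `|x0 - p|) (s - `|y0 - q|)).
have m0 : 0 < m by rewrite !lt_min d0 !subr_gt0 hx.
have [md [mx my]] : m <= d /\ m <= s - `|x0 - p| /\ m <= s - `|y0 - q|.
  by rewrite /m !ge_min !lexx !orbT.
pose t := m / 2; have t0 : 0 < t by rewrite divr_gt0.
have tm : t < m by rewrite /t; lra.
have /= := hd t t0 (lt_le_trans tm md).
set z := x0 +i* y0.
have Ez1 : z + t%:C = (x0 + t) +i* y0 by rewrite /z; simpc.
have Ez2 : z - t%:C = (x0 - t) +i* y0 by rewrite /z; simpc.
have Ez3 : z + 'i * t%:C = x0 +i* (y0 + t) by rewrite /z; simpc.
have Ez4 : z - 'i * t%:C = x0 +i* (y0 - t) by rewrite /z; simpc.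
rewrite Ez1 Ez2 Ez3 Ez4 => h4.
have nx (v : R) : v = t \/ v = - t -> `|x0 + v - p| <= s.
  move=> hv; have -> : x0 + v - p = (x0 - p) + v by ring.
  apply: le_trans (ler_normD _ _) _.
  have -> : `|v| = t by case: hv => ->; rewrite ?normrN gtr0_norm.
  lra.
have ny (v : R) : v = t \/ v = - t -> `|y0 + v - q| <= s.
  move=> hv; have -> : y0 + v - q = (y0 - q) + v by ring.
  apply: le_trans (ler_normD _ _) _.
  have -> : `|v| = t by case: hv => ->; rewrite ?normrN gtr0_norm.
  lra.
have U1 := maxU _ _ (nx t (or_introl erefl)) hy0.
have U2 := maxU _ _ (nx (- t) (or_intror erefl)) hy0.
have U3 := maxU _ _ hx0 (ny t (or_introl erefl)).
have U4 := maxU _ _ hx0 (ny (- t) (or_intror erefl)).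
set f1 := f ((x0 + t) +i* y0) in h4 *; set f2 := f ((x0 - t) +i* y0) in h4 *.
set f3 := f (x0 +i* (y0 + t)) in h4 *; set f4 := f (x0 +i* (y0 - t)) in h4 *.
have sum4 : 4 * cn (f z) - e * t ^+ 2 <= cn f1 + cn f2 + cn f3 + cn f4.
  have S := cn_leB (4 * f z) (4 * f z - (f1 + f2 + f3 + f4)).
  have c4 : cn (4 : R[i]) = 4.
    by rewrite -[4 in LHS](rmorph_nat (real_complex R)) cn_real ger0_norm.
  rewrite subKr cnM c4 [cn (4 * f z - _)]cnBC in S.
  have T1 := cnD (f1 + f2 + f3) f4; have T2 := cnD (f1 + f2) f3; have T3 := cnD f1 f2.
  lra.
have et : 0 < e * t ^+ 2 by rewrite mulr_gt0// exprn_gt0.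
have Q : e * ((x0 + t - p) ^+ 2 + (y0 - q) ^+ 2) + e * ((x0 - t - p) ^+ 2 + (y0 - q) ^+ 2)
  + e * ((x0 - p) ^+ 2 + (y0 + t - q) ^+ 2) + e * ((x0 - p) ^+ 2 + (y0 - t - q) ^+ 2) =
  4 * (e * ((x0 - p) ^+ 2 + (y0 - q) ^+ 2)) + 4 * (e * t ^+ 2) by ring.
rewrite /u -/f1 -/f2 -/f3 -/f4 -/z in U1 U2 U3 U4.
lra.
Qed.

End MaximumModulus.

(** * Maximum modulus, identity theorem, limits and derivatives *)

Section Holomorphic.
Variable R : realType.
Implicit Types (x y p q r s t e d M : R) (z w a b l v : R[i]) (f g : R[i] -> R[i]).

Lemma cder_uniq f z l m : cder f z l -> cder f z m -> l = m.
Proof.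
move=> hl hm; apply/eqP; rewrite -subr_eq0 -cn_eq0 eq_le cn_ge0 andbT.
apply/ler_addgt0Pl => e e0; rewrite addr0.
have e20 : 0 < e / 2 by rewrite divr_gt0.
have [d d0 hd] := hl _ e20; have [d' d'0 hd'] := hm _ e20.
pose t := Num.min d d' / 2.
have t0 : 0 < t by rewrite divr_gt0// lt_min d0.
have /andP[td td'] : (t < d) && (t < d').
  by rewrite -lt_min /t ltr_pdivrMr// ltr_pMr ?ltr1n// lt_min d0.
have cnt : cn (z + t%:C - z) = t by rewrite addrC addKr cn_real gtr0_norm.
have := hd (z + t%:C); have := hd' (z + t%:C); rewrite cnt => /(_ td') h2 /(_ td) h1.
rewrite -(ler_pM2r t0) -{1}[t]gtr0_norm// -cn_real -cnM.
have -> : (l - m) * t%:C = (f (z + t%:C) - f z - m * (z + t%:C - z)) -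
   (f (z + t%:C) - f z - l * (z + t%:C - z)) by ring.
by apply: le_trans (cnB _ _) _; rewrite [e]splitr mulrDl lerD.
Qed.

Lemma ccont_bounded f a r : 0 < r -> ccont f a ->
  exists2 s, 0 < s <= r & exists2 M, 0 < M & forall w, cn (w - a) < s -> cn (f w) <= M.
Proof.
move=> r0 cf; have [d d0 hd] := cf 1 ltr01.
exists (Num.min d r); first by rewrite lt_min d0 r0 ge_min lexx orbT.
exists (1 + cn (f a)); first by rewrite ltr_wpDr ?cn_ge0.
move=> w; rewrite lt_min => /andP[/hd h _].
by apply: le_trans (cn_leD _ (f a)) _; rewrite addrC lerD2r.
Qed.

(* The maximum principle holds for the primitive [G] of [g], which is twice
   differentiable, hence for its difference quotients, hence for [g]. *)
Lemma max_modulus g a r M : 0 < r -> (forall w, cn (w - a) < r -> hol g w) ->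
  (forall w, r / 32 <= cn (w - a) -> cn (w - a) < r / 4 -> cn (g w) <= M) ->
  forall w, cn (w - a) < r / 4 -> cn (g w) <= M.
Proof.
move=> r0 hg hM w wa.
have [|small] := lerP (r / 32) (cn (w - a)); first by move=> h; exact: hM.
have [G dG] := primitive_near r0 hg.
apply/ler_addgt0Pr => e e0.
have [d d0 hd] := dG w wa e e0.
(* The boundary of the square of half-side [r / 16] lies between the radii [r / 16] and [r / 8], and
   a step of at most [r / 64] from there stays between [r / 32] and [r / 4], where [g] is bounded by
   [M]. The bound [d / 2] makes the quotient [F w] close to [g w]. *)
pose t := Num.min (d / 2) (r / 64).
have t0 : 0 < t by rewrite lt_min !divr_gt0.
have [td tr] : t <= d / 2 /\ t <= r / 64 by rewrite /t !ge_min !lexx orbT.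
pose h := t%:C : R[i]; have cnh : cn h = t by rewrite cn_real gtr0_norm.
have h0 : h != 0 by rewrite -cn_gt0 cnh.
pose F z := h^-1 * (G (z + h) - G z).
have shift z : cn (z - a) < r / 8 -> cn (z + h - a) < r / 4.
  move=> za; rewrite addrAC; apply: le_lt_trans (cnD _ _) _; rewrite cnh; lra.
have dF z : cn (z - a) < r / 8 -> cder F z (h^-1 * (g (z + h) - g z)).
  move=> za; apply: cderZ; apply: cderB; last by apply: dG; lra.
  by apply: cder_shift; apply/dG/shift.
have FM z : r / 16 <= cn (z - a) -> cn (z - a) < r / 8 -> cn (F z) <= M.
  move=> z1 z2; rewrite /F cnM cnV cnh mulrC ler_pdivrMr//.
  have := @MVI_seg _ G g z (z + h) M; rewrite addrAC subrr add0r cnh; apply.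
    move=> v vz; apply: dG; have := cn_tri v a z; lra.
  move=> v vz; apply: hM; last by have := cn_tri v a z; lra.
  by have := cn_tri z a v; rewrite (cnBC z v); lra.
have wF : cn (F w) <= M.
  case: a hg hM wa small dG shift dF FM => p q hg hM wa small dG shift dF FM.
  case: w wa small hd => x y wa small hd.
  have s0 : 0 < r / 16 by rewrite divr_gt0.
  have box x' y' : `|x' - p| <= r / 16 -> `|y' - q| <= r / 16 ->
      cn (x' +i* y' - p +i* q) <= r / 16 * Num.sqrt 2.
    move=> hx hy; rewrite /cn /=.
    have E : r / 16 * Num.sqrt 2 = Num.sqrt ((r / 16) ^+ 2 + (r / 16) ^+ 2).
      have -> : (r / 16) ^+ 2 + (r / 16) ^+ 2 = (r / 16) ^+ 2 * 2 by ring.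
      by rewrite sqrtrM ?sqr_ge0// sqrtr_sqr ger0_norm// ltW.
    rewrite E ler_wsqrtr// lerD// -[leLHS]real_normK ?num_real// lerXn2r ?nnegrE//;
    exact: ltW.
  have sq2 : Num.sqrt 2 < 2 :> R.
    by rewrite -[ltRHS]gtr0_norm// -sqrtr_sqr ltr_sqrt; lra.
  have box' x' y' : `|x' - p| <= r / 16 -> `|y' - q| <= r / 16 ->
      cn (x' +i* y' - p +i* q) < r / 8.
    move=> hx hy; apply: le_lt_trans (box _ _ hx hy) _.
    have -> : r / 8 = r / 16 * 2 by field.
    by rewrite ltr_pM2l.
  apply: (max_box (p := p) (q := q) (s := r / 16)) => //.
  - by move=> x' y' hx hy; apply: cder_ccont (dF _ (box' _ _ hx hy)).
  - move=> x' y' hx hy.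
    have zr : cn (x' +i* y' - p +i* q) < r / 8 by apply: box'; exact: ltW.
    have [l1 hl1] : hol g (x' +i* y') by apply: hg; lra.
    have [l2 hl2] : hol g (x' +i* y' + h) by apply: hg; have := shift _ zr; lra.
    have rz : 0 < r / 8 - cn (x' +i* y' - p +i* q) by rewrite subr_gt0.
    have dg : cder (fun z => h^-1 * (g (z + h) - g z)) (x' +i* y') (h^-1 * (l2 - l1)).
      by apply: cderZ; apply: cderB => //; exact: cder_shift.
    apply: (fourpoint_C2 rz _ dg) => v vz; apply: dF.
    by have := cn_tri v (p +i* q) (x' +i* y'); lra.
  - move=> x' y' hx hy hxy; apply: FM; last exact: box'.
    by case: hxy => <-; [exact: (Re_cn (x' +i* y' - p +i* q))|exact: (Im_cn (x' +i* y' - p +i* q))].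
  - by apply: le_trans (Re_cn (x +i* y - p +i* q)) _; lra.
  - by apply: le_trans (Im_cn (x +i* y - p +i* q)) _; lra.
have cwh : cn (w + h - w) = t by rewrite addrC addKr.
have td' : t < d by lra.
have := hd (w + h); rewrite cwh => /(_ td') le_e.
have : cn (g w - F w) <= e.
  rewrite -(ler_pM2r t0) -{1}cnh -cnM -cnN; apply: le_trans le_e.
  rewrite le_eqVlt; apply/orP; left; apply/eqP; congr cn.
  by rewrite /F; field.
have := cn_leD (g w) (F w); lra.
Qed.

(** The [n]-th roots of the constants [c] and [e] tend to 1. Concretely, if [y < x], Bernoulli's
    inequality makes [(x / y) ^ n] exceed [e / c]. *)
Lemma pow_le x y c e : 0 < c -> 0 <= y ->
  (forall n, (0 < n)%N -> x ^+ n * c <= y ^+ n * e) -> x <= y.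
Proof.
move=> c0 y0 h; rewrite leNgt; apply/negP => yx.
have x0 : 0 < x by exact: le_lt_trans yx.
have [yz|yp] := eqVneq y 0.
  have := h 1%N isT; rewrite yz expr1 expr1 mul0r; apply/negP.
  by rewrite -ltNge mulr_gt0.
have {yp}yp : 0 < y by rewrite lt_def yp.
have bern n : 1 + (x / y - 1) * n%:R <= (x / y) ^+ n.
  have u0 : 0 <= x / y - 1 by rewrite subr_ge0 ler_pdivlMr// mul1r ltW.
  elim: n => [|n IH]; first by rewrite mulr0 addr0 expr0.
  have E : 1 + (x / y - 1) = x / y by rewrite addrC subrK.
  have hh : (1 + (x / y - 1)) * (1 + (x / y - 1) * n%:R) <= x / y * (x / y) ^+ n.
    by apply: ler_pM => //; [exact: addr_ge0|rewrite addr_ge0// mulr_ge0|rewrite E].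
  rewrite exprS; apply: le_trans hh; rewrite -natr1.
  have : 0 <= (x / y - 1) * (x / y - 1) * n%:R by rewrite !mulr_ge0.
  move: (x / y - 1) => u; lra.
have u0 : 0 < x / y - 1 by rewrite subr_gt0 ltr_pdivlMr// mul1r.
pose B := e / c / (x / y - 1).
pose n := (Num.bound `|B|).+1.
have nB : B < n%:R.
  apply: le_lt_trans (ler_norm _) _; apply: lt_trans (archi_boundP (normr_ge0 _)) _.
  by rewrite ltr_nat.
have := h n isT; apply/negP; rewrite -ltNge.
have yn : 0 < y ^+ n by rewrite exprn_gt0.
have : e / c < (x / y) ^+ n.
  apply: lt_le_trans (bern n); move: nB; rewrite /B ltr_pdivrMr// mulrC; lra.
by rewrite expr_div_n ltr_pdivlMr// mulrAC ltr_pdivrMr// [e * _]mulrC.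
Qed.

(* Apply the maximum modulus principle to [f / (z - b) ^ n], with [b] slightly to
   the right of [a], where [f] vanishes, and let [n] tend to infinity. *)
Lemma identity_half_plane f a r : 0 < r -> (forall w, cn (w - a) < r -> hol f w) ->
  (forall w, cn (w - a) < r -> complex.Re a < complex.Re w -> f w = 0) ->
  exists2 s, 0 < s & forall w, cn (w - a) < s -> f w = 0.
Proof.
move=> r0 hf f0.
have aa : cn (a - a) < r by rewrite subrr cn0.
have [s /andP[s0 sr] [M M0 fM]] := ccont_bounded r0 (hol_ccont (hf a aa)).
(* The disc of radius [tau] around [b] lies in the half-plane where [f] vanishes, and [w] is within
   [2 tau = rho / 32] of [b]. This is the inner radius of the annulus in [max_modulus], so the ratio
   of the [n]-th powers decides. *)
pose tau := s / 128; have tau0 : 0 < tau by rewrite divr_gt0.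
pose b := a + tau%:C; pose rho := s / 2.
have ba : cn (b - a) = tau by rewrite addrC addKr cn_real gtr0_norm.
have rho0 : 0 < rho by rewrite divr_gt0.
have in_s w : cn (w - b) < rho -> cn (w - a) < s.
  by have := cn_tri w a b; rewrite ba /tau /rho; lra.
have near_b w : cn (w - b) < tau -> f w = 0.
  move=> wb; apply: f0.
    by apply: lt_le_trans sr; apply: in_s; move: wb; rewrite /tau /rho; lra.
  have := Re_cn (w - b); rewrite /b ReB ReD /= ler_norml => /andP[h _].
  by move: wb; rewrite -/b; lra.
exists tau => // w wa.
have wb : cn (w - b) < s / 64.
  by have := cn_tri w b a; rewrite [cn (a - b)]cnBC ba /tau in wa *; lra.
have [->|wb0] := eqVneq w b; first by apply: near_b; rewrite subrr cn0.
have wb1 : 0 < cn (w - b) by rewrite cn_gt0 subr_eq0.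
apply/eqP; rewrite -cn_eq0 eq_le cn_ge0 andbT.
have key n : cn (f w) / cn (w - b) ^+ n <= M / (rho / 32) ^+ n.
  pose g z := f z / (z - b) ^+ n.
  rewrite -cnX -cnV -cnM -/(g w).
  apply: (@max_modulus g b rho) => //; last by rewrite /rho; lra.
    move=> z zb; have [-> |znb] := eqVneq z b.
      apply: hol_near tau0 _ (hol_cst 0 b) => v vb.
      by rewrite /g near_b// mul0r.
    apply: holM; first by apply: hf; apply: lt_le_trans sr; exact: in_s.
    apply: holV; last by rewrite expf_neq0// subr_eq0.
    by apply: holX; apply: holB; [exact: hol_id|exact: hol_cst].
  move=> z z1 z2; rewrite /g cnM cnV cnX.
  have q0 : 0 < rho / 32 by rewrite divr_gt0.
  have zb0 : 0 < cn (z - b) by exact: lt_le_trans z1.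
  apply: ler_pM; rewrite ?cn_ge0 ?invr_ge0 ?exprn_ge0 ?cn_ge0//.
    by apply: fM; apply: in_s; lra.
  by rewrite lef_pV2 ?posrE ?exprn_gt0//; apply: lerXn2r; rewrite ?nnegrE// ltW.
rewrite leNgt; apply/negP => fw0.
have : rho / 32 <= cn (w - b).
  apply: (@pow_le _ _ (cn (f w)) M) => // [|n _]; first exact: cn_ge0.
  have q0 : 0 < (rho / 32) ^+ n by rewrite exprn_gt0// divr_gt0.
  have := key n; rewrite ler_pdivrMr ?exprn_gt0// mulrAC ler_pdivlMr//.
  by rewrite mulrC [M * _]mulrC.
by rewrite /rho; lra.
Qed.

(* Apply the maximum modulus principle to [Q ^ n * (w - a)], where [Q] is the
   difference quotient at [a]; it is holomorphic at [a] as soon as [Q] is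
   continuous there. *)
Lemma lipschitz_hol f a r M : 0 < r -> (forall w, cn (w - a) < r -> hol f w) ->
  (forall w, cn (w - a) < r -> cn (f w) <= M) ->
  forall w, cn (w - a) < r / 4 -> cn (f w - f a) <= 64 * M / r * cn (w - a).
Proof.
move=> r0 hf fM w wa.
have aa : cn (a - a) < r by rewrite subrr cn0.
have M0 : 0 <= M by apply: le_trans (fM a aa); exact: cn_ge0.
have [->|wna] := eqVneq w a; first by rewrite !subrr cn0 mulr0.
have wa0 : 0 < cn (w - a) by rewrite cn_gt0 subr_eq0.
rewrite -ler_pdivrMr// -cnV -cnM.
apply: (@pow_le _ _ (cn (w - a)) r) => //; first by rewrite divr_ge0 ?(ltW r0)// mulr_ge0.
move=> n n0; rewrite -cnX -cnM.
pose g z := ((f z - f a) / (z - a)) ^+ n * (z - a).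
apply: (@max_modulus g a r) => //.
  move=> z za; have [->|zna] := eqVneq z a; last first.
    apply: holM; last by apply: holB; [exact: hol_id|exact: hol_cst].
    apply: holX; apply: holM; first by apply: holB; [exact: hf|exact: hol_cst].
    by apply: holV; rewrite ?subr_eq0//; apply: holB; [exact: hol_id|exact: hol_cst].
  have [l hl] := hf a aa; exists (l ^+ n) => e e0.
  have [d d0 hd] : exists2 d, 0 < d & forall v, cn (v - l) < d -> cn (v ^+ n - l ^+ n) <= e.
    have := hol_ccont (holX n (hol_id l)); exact.
  have [d' d'0 hd'] := hl (d / 2) (divr_gt0 d0 (ltr0Sn _ _)).
  exists d' => // v va; have [->|vna] := eqVneq v a.
    by rewrite !subrr mulr0 subr0 cn0 mulr0.
  have va0 : v - a != 0 by rewrite subr_eq0.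
  have -> : g v - g a - l ^+ n * (v - a) =
      (((f v - f a) / (v - a)) ^+ n - l ^+ n) * (v - a).
    by rewrite /g [a - a]subrr mulr0 subr0 [RHS]mulrBl.
  rewrite cnM ler_wpM2r ?cn_ge0//; apply: hd.
  have -> : (f v - f a) / (v - a) - l = (f v - f a - l * (v - a)) / (v - a).
    by field.
  rewrite cnM cnV ltr_pdivrMr ?cn_gt0//; apply: le_lt_trans (hd' v va) _.
  by rewrite ltr_pM2r ?cn_gt0//; lra.
move=> z z1 z2; rewrite /g cnM cnX.
have z0 : 0 < cn (z - a) by apply: lt_le_trans z1; rewrite divr_gt0.
apply: ler_pM; rewrite ?exprn_ge0 ?cn_ge0//; last by lra.
rewrite lerXn2r ?nnegrE ?cn_ge0//; first by rewrite divr_ge0 ?(ltW r0)// mulr_ge0.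
rewrite cnM cnV ler_pdivrMr//.
apply: (@le_trans _ _ (2 * M)).
  apply: le_trans (cnB _ _) _.
  have := fM z; have := fM a aa; have zr : cn (z - a) < r by lra.
  by move=> h1 /(_ zr); lra.
(* The numerator of the quotient is at most [2 M], and the annulus begins at radius [r / 32]. *)
have -> : 2 * M = 64 * M / r * (r / 32) by field; rewrite gt_eqF.
by rewrite ler_wpM2l// divr_ge0 ?(ltW r0)// mulr_ge0.
Qed.

(** The intervals of centre [u n] and radius [e n] meet pairwise, so the supremum of their left ends
    lies in all of them. The error bound is thus explicit at every index. *)
Lemma cauchy_squeeze (u e : nat -> R) : (forall n m, `|u n - u m| <= e n + e m) ->
  exists l : R, forall n, `|u n - l| <= e n.
Proof.
move=> h; pose E := [set u n - e n | n in [set: nat]].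
have ubE m : ubound E (u m + e m).
  by move=> _ [n _ <-]; have := h n m; rewrite ler_norml; lra.
exists (sup E) => n; rewrite ler_norml.
have h1 : u n - e n <= sup E.
  by apply: ub_le_sup; [exists (u 0%N + e 0%N); exact: ubE|exists n].
have h2 : sup E <= u n + e n.
  by apply: ge_sup; [exists (u 0%N - e 0%N); exists 0%N|exact: ubE].
lra.
Qed.

Lemma cauchy_squeezeC (u : nat -> R[i]) (e : nat -> R) :
  (forall n m, cn (u n - u m) <= e n + e m) ->
  exists l, forall n, cn (u n - l) <= 2 * e n.
Proof.
move=> h.
have [|x hx] := @cauchy_squeeze (fun n => complex.Re (u n)) e.
  by move=> n m; rewrite -ReB; apply: le_trans (Re_cn _) (h n m).
have [|y hy] := @cauchy_squeeze (fun n => complex.Im (u n)) e.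
  by move=> n m; rewrite -ImB; apply: le_trans (Im_cn _) (h n m).
exists (x +i* y) => n; apply: le_trans (cn_ReIm _) _.
by rewrite ReB ImB /=; have := hx n; have := hy n; lra.
Qed.

Definition tends0 (e : nat -> R) := forall d, 0 < d -> exists n, e n <= d.

(** Weierstrass's theorem with a rate. [lipschitz_hol] applied to [F n - F m] shows that the
    derivatives form a Cauchy sequence and that the difference quotients converge uniformly, so the
    limits can be exchanged. *)
Lemma hol_lim f (F : nat -> R[i] -> R[i]) a r (e : nat -> R) : 0 < r ->
  (forall n w, cn (w - a) < r -> hol (F n) w) ->
  (forall n w, cn (w - a) < r -> cn (F n w - f w) <= e n) -> tends0 e ->
  exists2 l, cder f a l & forall n l', cder (F n) a l' -> cn (l' - l) <= 128 * e n / r.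
Proof.
move=> r0 hF Ff e_to0.
have aa : cn (a - a) < r by rewrite subrr cn0.
have lipnm n m w : cn (w - a) < r / 4 ->
    cn (F n w - F m w - (F n a - F m a)) <= 64 * (e n + e m) / r * cn (w - a).
  apply: (@lipschitz_hol (fun w => F n w - F m w)) => // z za.
    by apply: holB; exact: hF.
  by apply: le_trans (cn_tri _ _ (f z)) _; rewrite lerD ?Ff// cnBC Ff.
have e0 n : 0 <= e n by apply: le_trans (Ff n a aa); exact: cn_ge0.
have /choice[L hL] : forall n, exists l, cder (F n) a l by move=> n; exact: hF.
have LL n m : cn (L n - L m) <= 64 * e n / r + 64 * e m / r.
  have -> : 64 * e n / r + 64 * e m / r = 64 * (e n + e m) / r by ring.
  apply/ler_addgt0Pr => eps eps0.
  have [d d0 hd] := cderB (hL n) (hL m) eps0.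
  pose t := Num.min (d / 2) (r / 8).
  have t0 : 0 < t by rewrite lt_min !divr_gt0.
  have [td tr] : t <= d / 2 /\ t <= r / 8 by rewrite /t !ge_min !lexx !orbT.
  have cnt : cn (a + t%:C - a) = t by rewrite addrC addKr cn_real gtr0_norm.
  have := hd (a + t%:C); rewrite cnt => /(_ _) h1.
  have {}h1 : t < d -> _ := h1; have td' : t < d by lra.
  have {h1 td'} h1 := h1 td'.
  have := lipnm n m (a + t%:C); rewrite cnt => /(_ _) h2.
  have tr' : t < r / 4 by lra.
  have {h2 tr'} h2 := h2 tr'.
  have key : cn ((L n - L m) * (a + t%:C - a)) <= (64 * (e n + e m) / r + eps) * t.
    rewrite [leRHS]mulrDl; set X := F n _ - F m _ - _ in h1 h2.
    rewrite -(subKr X ((L n - L m) * (a + t%:C - a))).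
    by apply: le_trans (cnB _ _) _; exact: lerD.
  by move: key; rewrite cnM cnt ler_pM2r.
have [l hl] := cauchy_squeezeC LL.
have hl' n : cn (L n - l) <= 128 * e n / r.
  have -> : 128 * e n / r = 2 * (64 * e n / r) by ring.
  exact: hl.
exists l; last by move=> n l' h; rewrite (cder_uniq h (hL n)).
(* The estimate for [F n - F m] passes to the limit in [m]; [K] collects the coefficients of
   [e m]. *)
have lip n w : cn (w - a) < r / 4 ->
    cn (F n w - f w - (F n a - f a)) <= 64 * e n / r * cn (w - a).
  move=> wa; apply/ler_addgt0Pr => eps eps0.
  have c0 := cn_ge0 (w - a).
  pose K := 2 + 64 / r * cn (w - a).
  have K0 : 0 < K by rewrite /K ltr_wpDr// mulr_ge0// divr_ge0// ltW.
  have [m hm] := e_to0 (eps / K) (divr_gt0 eps0 K0).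
  have -> : F n w - f w - (F n a - f a) =
    (F n w - F m w - (F n a - F m a)) + ((F m w - f w) - (F m a - f a)) by ring.
  apply: le_trans (cnD _ _) _.
  have h1 := lipnm n m w wa.
  have h2 : cn (F m w - f w - (F m a - f a)) <= 2 * e m.
    have wr : cn (w - a) < r by lra.
    by apply: le_trans (cnB _ _) _; have := Ff m w wr; have := Ff m a aa; lra.
  have h3 : K * e m <= eps by rewrite mulrC -ler_pdivlMr.
  have E : 64 * (e n + e m) / r * cn (w - a) + 2 * e m =
    64 * e n / r * cn (w - a) + K * e m by rewrite /K; ring.
  lra.
move=> eps eps0.
have e4 : 0 < eps / (2 * (192 / r)) by rewrite divr_gt0// mulr_gt0// divr_gt0.
have [n hn] := e_to0 _ e4.
have [|d d0 hd] := hL n (eps / 2); first by rewrite divr_gt0.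
exists (Num.min d (r / 4)); first by rewrite lt_min d0 divr_gt0.
move=> w; rewrite lt_min => /andP[wd wr].
have -> : f w - f a - l * (w - a) = (F n w - F n a - L n * (w - a)) -
  (F n w - f w - (F n a - f a)) + (L n - l) * (w - a) by ring.
apply: le_trans (cnD _ _) _; rewrite cnM.
apply: (@le_trans _ _ (eps / 2 * cn (w - a) + 64 * e n / r * cn (w - a) +
   128 * e n / r * cn (w - a))).
  rewrite lerD ?ler_wpM2r ?cn_ge0//; apply: le_trans (cnB _ _) _.
  by rewrite lerD ?hd ?lip.
rewrite -!mulrDl ler_wpM2r ?cn_ge0//.
have : 192 / r * e n <= eps / 2.
  have E : eps / 2 = 192 / r * (eps / (2 * (192 / r))) by field; rewrite gt_eqF.
  by rewrite E ler_wpM2l// divr_ge0// ltW.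
have -> : eps / 2 + 64 * e n / r + 128 * e n / r = eps / 2 + 192 / r * e n by ring.
lra.
Qed.

Definition dC f z : R[i] := xget 0 (cder f z).

Lemma cder_dC f z : hol f z -> cder f z (dC f z).
Proof. exact: xgetPex. Qed.

(** With a primitive [G] of [f], the difference quotients [F n] of [G] converge uniformly to [f], so
    by [hol_lim] their derivatives [F' n] converge to that of [f], at a uniform rate. The [F' n] are
    difference quotients of [f], hence holomorphic, and a second use of [hol_lim] concludes. *)
Lemma hol_dC f a r : 0 < r -> (forall w, cn (w - a) < r -> hol f w) -> hol (dC f) a.
Proof.
move=> r0 hf0.
have aa : cn (a - a) < r by rewrite subrr cn0.
have [s /andP[s0 sr] [M M0 fM]] := ccont_bounded r0 (hol_ccont (hf0 a aa)).
have hf w : cn (w - a) < s -> hol f w by move=> h; apply: hf0; exact: lt_le_trans sr.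
have [G dG] := primitive_near s0 hf.
pose h n : R := s / 16 / n.+1%:R.
have h0 n : 0 < h n by rewrite !divr_gt0.
have hs n : h n <= s / 16.
  by rewrite ler_pdivrMr// ler_peMr ?divr_ge0 ?(ltW s0)// ler1n.
have cnh n : cn (h n)%:C = h n by rewrite cn_real gtr0_norm.
have hn0 n : (h n)%:C != 0 :> R[i] by rewrite -cn_gt0 cnh.
pose F n z := ((h n)%:C)^-1 * (G (z + (h n)%:C) - G z).
pose F' n z := ((h n)%:C)^-1 * (f (z + (h n)%:C) - f z).
have shift n z : cn (z - a) < s / 8 -> cn (z + (h n)%:C - a) < s / 4.
  move=> za; rewrite addrAC; apply: le_lt_trans (cnD _ _) _; rewrite cnh.
  by have := hs n; lra.
have dF n z : cn (z - a) < s / 8 -> cder (F n) z (F' n z).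
  move=> za; apply: cderZ; apply: cderB; last by apply: dG; lra.
  by apply: cder_shift; apply/dG/shift.
have hF' n z : cn (z - a) < s / 8 -> hol (F' n) z.
  move=> za; have [l1 hl1] : hol f z by apply: hf; lra.
  have [l2 hl2] : hol f (z + (h n)%:C) by apply: hf; have := shift n z za; lra.
  by exists (((h n)%:C)^-1 * (l2 - l1)); apply: cderZ; apply: cderB => //; exact: cder_shift.
have Ff n z : cn (z - a) < s / 8 -> cn (F n z - f z) <= 128 * M / s * h n.
  move=> za.
  have -> : F n z - f z = ((h n)%:C)^-1 *
      ((G (z + (h n)%:C) - f z * (z + (h n)%:C)) - (G z - f z * z)).
    by rewrite /F; move: ((h n)%:C) (hn0 n) => v v0; field.
  rewrite cnM cnV cnh mulrC ler_pdivrMr//.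
  have := @MVI_seg _ (fun w => G w - f z * w) (fun w => f w - f z * 1) z
     (z + (h n)%:C) (128 * M / s * h n).
  rewrite [z + _]addrC addrK cnh; apply=> v vz; have := hs n => hsn.
    apply: cderB; first by apply: dG; have := cn_tri v a z; lra.
    by apply: cderZ; exact: cder_id.
  rewrite mulr1; have s20 : 0 < s / 2 by rewrite divr_gt0.
  have := @lipschitz_hol f z (s / 2) M s20.
  have -> : 64 * M / (s / 2) = 128 * M / s by field; rewrite gt_eqF.
  move=> lip; apply: le_trans (lip _ _ _ _) _; last first.
  - by rewrite ler_wpM2l// divr_ge0 ?(ltW s0)// mulr_ge0// ltW.
  - lra.
  - by move=> u uz; apply: fM; have := cn_tri u a z; lra.
  - by move=> u uz; apply: hf; have := cn_tri u a z; lra.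
have C0 : 0 < 128 * M / s by rewrite divr_gt0// mulr_gt0.
have small C : 0 < C -> tends0 (fun n => C * h n).
  move=> Cp d d0; have B0 := normr_ge0 (C * (s / 16) / d).
  exists (Num.bound `|C * (s / 16) / d|).
  rewrite /h mulrA ler_pdivrMr// [d * _]mulrC -ler_pdivrMr//.
  apply: le_trans (ler_norm _) _; apply: le_trans (ltW (archi_boundP B0)) _.
  by rewrite ler_nat.
have s16 : 0 < s / 16 by rewrite divr_gt0.
have F'f n z : cn (z - a) < s / 16 -> cn (F' n z - dC f z) <= 128 * (128 * M / s) / (s / 16) * h n.
  move=> za.
  have near w : cn (w - z) < s / 16 -> cn (w - a) < s / 8.
    by have := cn_tri w a z; lra.
  have [||l hl hln] := @hol_lim f F z (s / 16) (fun n => 128 * M / s * h n) s16 _ _ (small _ C0).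
  - by move=> m w /near wa; exists (F' m w); exact: dF.
  - by move=> m w /near; exact: Ff.
  have -> : dC f z = l.
    by apply: cder_uniq hl; apply: cder_dC; apply: hf; lra.
  have zz : cn (z - z) < s / 16 by rewrite subrr cn0.
  apply: le_trans (hln n _ (dF n z (near z zz))) _.
  by rewrite le_eqVlt; apply/orP; left; apply/eqP; field; rewrite gt_eqF.
have C1 : 0 < 128 * (128 * M / s) / (s / 16) by rewrite divr_gt0// mulr_gt0.
have [||l hl _] := @hol_lim (dC f) F' a (s / 16)
   (fun n => 128 * (128 * M / s) / (s / 16) * h n) s16 _ _ (small _ C1).
- by move=> n w wa; apply: hF'; lra.
- by move=> n w wa; exact: F'f.
by exists l.
Qed.

(** The quotient [(f w - f a) / (w - a)], completed by the derivative at [a], is differentiable at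
    [a] by Taylor's formula of order two, with half of the second derivative of [f] as its
    derivative. *)
Lemma removable f a r : 0 < r -> (forall w, cn (w - a) < r -> hol f w) ->
  exists g, (forall w, cn (w - a) < r -> hol g w) /\
    forall w, f w = f a + (w - a) * g w.
Proof.
move=> r0 hf.
exists (fun w => if w == a then dC f a else (f w - f a) / (w - a)); split; last first.
  move=> w; case: eqVneq => [->|wa]; first by rewrite subrr mul0r addr0.
  by rewrite mulrCA divff ?mulr1 ?subr_eq0// addrC subrK.
move=> w wa; have [->|wna] := eqVneq w a; last first.
  have wna0 : 0 < cn (w - a) by rewrite cn_gt0 subr_eq0.
  apply: (@hol_near _ (fun w => (f w - f a) / (w - a)) _ _ _ wna0).
    move=> v vw; case: eqVneq => // va; move: vw.
    by rewrite va cnBC ltxx.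
  apply: holM; first by apply: holB; [exact: hf|exact: hol_cst].
  by apply: holV; rewrite ?subr_eq0//; apply: holB; [exact: hol_id|exact: hol_cst].
have [l hl] := hol_dC r0 hf; exists (l / 2) => e e0.
have [d d0 hd] := taylor2 r0 (fun w wa => cder_dC (hf w wa)) hl e0.
exists d => // v va; rewrite eqxx; case: eqVneq => [->|vna].
  by rewrite !subrr mulr0 subrr cn0 mulr0.
have va0 : 0 < cn (v - a) by rewrite cn_gt0 subr_eq0.
rewrite -(ler_pM2r va0) -cnM -[leRHS]mulrA -[in leRHS]expr2.
have -> : ((f v - f a) / (v - a) - dC f a - l / 2 * (v - a)) * (v - a) =
  f v - f a - dC f a * (v - a) - l / 2 * (v - a) ^+ 2.
  by field; rewrite subr_eq0.
exact: hd.
Qed.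

End Holomorphic.

(** * The Riemann zeta function *)

Section ComplexExponential.
Variable R : realType.
Implicit Types (x y t e d : R) (z w s l : R[i]).

Definition cexp z : R[i] :=
  (expR (complex.Re z))%:C * (cos (complex.Im z) +i* sin (complex.Im z)).

Lemma cexpD z w : cexp (z + w) = cexp z * cexp w.
Proof.
rewrite /cexp ReD ImD expRD cosD sinD rmorphM mulrACA; congr (_ * _).
by case: z w => [a b] [c d] /=; simpc; congr (_ +i* _); ring.
Qed.

Lemma cexp0 : cexp 0 = 1.
Proof. by rewrite /cexp /= expR0 cos0 sin0 mul1r. Qed.

Lemma cn_cexp z : cn (cexp z) = expR (complex.Re z).
Proof.
rewrite cnM cn_real ger0_norm ?expR_ge0//.
by rewrite /cn /= cos2Dsin2 sqrtr1 mulr1.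
Qed.

Lemma cexp_neq0 z : cexp z != 0.
Proof. by rewrite -cn_gt0 cn_cexp expR_gt0. Qed.

Lemma cexpN z : cexp (- z) = (cexp z)^-1.
Proof.
apply: (mulfI (cexp_neq0 z)); rewrite -cexpD subrr cexp0 divff//.
exact: cexp_neq0.
Qed.

Lemma cexp_near0 e : 0 < e -> exists2 d, 0 < d & forall w, cn w < d ->
  cn (cexp w - 1 - w) <= e * cn w.
Proof.
move=> e0; have e8 : 0 < e / 8 by rewrite divr_gt0.
have /is_deriveP/(_ _ e8)[d1 d10 h1] := @is_derive_expR R 0.
have /is_deriveP/(_ _ e8)[d2 d20 h2] := @is_derive_cos R 0.
have /is_deriveP/(_ _ e8)[d3 d30 h3] := @is_derive_sin R 0.
have /is_deriveP/(_ _ ltr01)[d4 d40 h4] := @is_derive_expR R 0.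
exists (Num.min (Num.min (Num.min d1 d2) (Num.min d3 d4)) (Num.min (1 / 2) (e / 8))).
  by rewrite !lt_min d10 d20 d30 d40 divr_gt0.
case=> x y; set w := x +i* y.
have rx : `|x| <= cn w := Re_cn w. have ry : `|y| <= cn w := Im_cn w.
have c0 := cn_ge0 w.
rewrite !lt_min => /andP[/andP[/andP[w1 w2] /andP[w3 w4]] /andP[w5 w6]].
have := h1 x; rewrite !subr0 expR0 mul1r => /(_ (le_lt_trans rx w1)) {}h1.
have := h4 x; rewrite !subr0 expR0 !mul1r => /(_ (le_lt_trans rx w4)) {}h4.
have := h2 y; rewrite !subr0 cos0 sin0 oppr0 mul0r subr0 => /(_ (le_lt_trans ry w2)) {}h2.
have := h3 y; rewrite !subr0 cos0 sin0 mul1r subr0 => /(_ (le_lt_trans ry w3)) {}h3.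
(* The first two terms are controlled by the derivatives at 0 of the three real functions; the last
   is of second order, whence the requirement that [cn w] be below [e / 8]. *)
have -> : cexp w - 1 - w = (expR x - 1 - x)%:C +
    (expR x)%:C * ((cos y - 1) +i* (sin y - y)) + (expR x - 1)%:C * (y%:C * 'i).
  rewrite /cexp /w /=; simpc; congr (_ +i* _); ring.
have ex1 : `|expR x - 1| <= 2 * cn w.
  by rewrite -[expR x - 1](subrK x); apply: le_trans (ler_normD _ _) _; lra.
have ex2 : `|expR x| <= 2.
  by rewrite -[expR x](subrK 1); apply: le_trans (ler_normD _ _) _; rewrite normr1; lra.
have e80 := ltW e8.
have a1 : `|expR x - 1 - x| <= e / 8 * cn w by apply: le_trans h1 _; rewrite ler_wpM2l.
have a2 : cn ((cos y - 1) +i* (sin y - y)) <= e / 4 * cn w.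
  apply: le_trans (cn_ReIm _) _ => /=.
  have -> : e / 4 * cn w = e / 8 * cn w + e / 8 * cn w by field.
  by rewrite lerD//; [apply: le_trans h2 _|apply: le_trans h3 _]; rewrite ler_wpM2l.
apply: le_trans (cnD _ _) _; apply: le_trans (lerD (cnD _ _) (lexx _)) _.
rewrite !cnM !cn_real cn_i mulr1.
have b2 : `|expR x| * cn ((cos y - 1) +i* (sin y - y)) <= 2 * (e / 4 * cn w).
  by apply: ler_pM; rewrite ?cn_ge0.
have b3 : `|expR x - 1| * `|y| <= 2 * (e / 8) * cn w.
  by apply: ler_pM => //; lra.
have ec : 0 <= e * cn w by rewrite mulr_ge0 // ltW.
lra.
Qed.

Lemma cder_cexp z : cder cexp z (cexp z).
Proof.
move=> e e0; have c0 : 0 < cn (cexp z) by rewrite cn_gt0 cexp_neq0.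
have [d d0 hd] := cexp_near0 (divr_gt0 e0 c0).
exists d => // w wz.
have -> : cexp w - cexp z - cexp z * (w - z) = cexp z * (cexp (w - z) - 1 - (w - z)).
  have -> : cexp w = cexp z * cexp (w - z) by rewrite -cexpD addrC subrK.
  ring.
rewrite cnM mulrC; apply: le_trans (ler_wpM2r (ltW c0) (hd _ wz)) _.
by rewrite mulrAC divfK// gt_eqF.
Qed.

(** This is [x ^ (- s)], with the sign of the Dirichlet series. *)
Definition rpow x s : R[i] := cexp (- ((ln x)%:C * s)).

Lemma natcpowV n s : (natcpow n s)^-1 = rpow n%:R s.
Proof.
rewrite /rpow cexpN /natcpow /cexp; case: s => a b /=.
by rewrite !mul0r subr0 addr0 ![_ * ln _]mulrC.
Qed.

Lemma cn_rpow x s : cn (rpow x s) = expR (- (complex.Re s * ln x)).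
Proof.
by rewrite cn_cexp ReN; case: s => a b /=; rewrite mul0r subr0 mulrC.
Qed.

Lemma rpowM x y s : 0 < x -> 0 < y -> rpow (x * y) s = rpow x s * rpow y s.
Proof.
by move=> x0 y0; rewrite /rpow lnM ?posrE// rmorphD mulrDl opprD cexpD.
Qed.

Lemma rpowD x s l : rpow x (s + l) = rpow x s * rpow x l.
Proof. by rewrite /rpow mulrDr opprD cexpD. Qed.

Lemma rpow_nat x n : 0 < x -> rpow x n%:R = (x%:C ^+ n)^-1.
Proof.
move=> x0; elim: n => [|n IH]; first by rewrite /rpow mulr0 oppr0 cexp0 expr0 invr1.
rewrite -natr1 rpowD IH exprSr invfM; congr (_ * _).
rewrite /rpow mulr1 cexpN; congr (_^-1).
by rewrite /cexp /= cos0 sin0 mulr1 lnK.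
Qed.

Lemma rpow_natB x s n : 0 < x -> rpow x (s - n%:R) = x%:C ^+ n * rpow x s.
Proof.
move=> x0; have h : rpow x s = rpow x (s - n%:R) * rpow x n%:R by rewrite -rpowD subrK.
rewrite h rpow_nat// mulrCA mulfV ?mulr1//.
by rewrite expf_neq0// -cn_gt0 cn_real normr_gt0 gt_eqF.
Qed.

Lemma cder_rpow x s : cder (rpow x) s (- (ln x)%:C * rpow x s).
Proof.
have h : cder (fun s => - (ln x)%:C * s) s (- (ln x)%:C * 1).
  by apply: cderZ; exact: cder_id.
have := cder_comp h (cder_cexp _).
have -> : cexp (- (ln x)%:C * s) * (- (ln x)%:C * 1) = - (ln x)%:C * rpow x s.
  by rewrite /rpow mulr1 [RHS]mulrC mulNr.
by apply: (cder_near ltr01) => w _ /=; rewrite /rpow mulNr.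
Qed.

Lemma hol_rpow x s : hol (rpow x) s.
Proof. by eexists; exact: cder_rpow. Qed.

Lemma rder_comp (K : R -> R[i]) (f : R[i] -> R[i]) x l m :
  rder K x l -> cder f (K x) m -> rder (fun t => f (K t)) x (m * l).
Proof.
move=> hf hg e e0.
pose C := 1 + cn l + cn m.
have C0 : 0 < C by rewrite /C -!addrA ltr_wpDr ?addr_ge0 ?cn_ge0.
have eC0 : 0 < e / (2 * C) by rewrite divr_gt0// mulr_gt0.
have [d1 d10 h1] := hg _ eC0.
have [d2 d20 h2] := hf 1 ltr01.
have [d3 d30 h3] := hf _ eC0.
have d120 : 0 < d1 / 2 by rewrite divr_gt0.
have [d4 d40 h4] := rder_rcont hf d120.
exists (Num.min d2 (Num.min d3 d4)); first by rewrite !lt_min d20 d30.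
move=> w; rewrite !lt_min => /andP[/h2 w2 /andP[/h3 w3 /h4 w4]].
have w1 : cn (K w - K x) < d1 by apply: le_lt_trans w4 _; lra.
have -> : f (K w) - f (K x) - m * l * (w - x)%:C =
   (f (K w) - f (K x) - m * (K w - K x)) + m * (K w - K x - l * (w - x)%:C).
  by ring.
set D := `|w - x| in w2 w3 *.
have D0 : 0 <= D := normr_ge0 _.
have fD : cn (K w - K x) <= C * D.
  rewrite -[K w - K x](subrK (l * (w - x)%:C)).
  apply: le_trans (cnD _ _) _; rewrite cnM cn_real -/D.
  have : 0 <= cn m * D by rewrite mulr_ge0 ?cn_ge0.
  rewrite /C; lra.
have mC : cn m <= C by rewrite /C; move: (cn_ge0 l); lra.
apply: le_trans (cnD _ _) _; rewrite cnM.
have -> : e * D = e / (2 * C) * (C * D) + C * (e / (2 * C) * D).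
  by field; rewrite gt_eqF.
rewrite lerD//.
  apply: le_trans (h1 _ w1) _; rewrite ler_wpM2l//.
  by rewrite ltW.
by apply: ler_pM; rewrite ?cn_ge0.
Qed.

Lemma rder_rpow x s : 0 < x -> rder (fun t => rpow t s) x (- s * rpow x (s + 1)).
Proof.
move=> x0.
have h : rder (fun t => (ln t)%:C) x (x^-1)%:C.
  move=> e e0; have /is_deriveP/(_ _ e0)[d d0 hd] := is_derive1_ln x0.
  by exists d => // y /hd; rewrite -rmorphM -!rmorphB cn_real.
have := rder_comp (rderZ (- s) h) (cder_cexp _).
have -> : cexp (- s * (ln x)%:C) * (- s * (x^-1)%:C) = - s * rpow x (s + 1).
  rewrite rpowD -[1]/(1%:R) rpow_nat// expr1 fmorphV /rpow mulNr [s * _]mulrC; ring.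
by under eq_fun do rewrite mulNr mulrC.
Qed.

(** Up to the sign [(-1) ^ k], the [k]-th forward difference of the function sending [t] to
    [t ^ (- s)]. *)
Fixpoint fdiff k x s : R[i] :=
  if k is k'.+1 then fdiff k' x s - fdiff k' (x + 1) s else rpow x s.

Lemma hol_fdiff k x s : hol (fdiff k x) s.
Proof.
elim: k x => [|k IH] x /=; first exact: hol_rpow.
exact: (holB (IH x) (IH (x + 1))).
Qed.

Lemma rder_shift (K : R -> R[i]) x y l : rder K (x + y) l -> rder (fun t => K (t + y)) x l.
Proof.
move=> h e /h[d d0 hd]; exists d => // t tx.
have E : t + y - (x + y) = t - x by ring.
by have := hd (t + y); rewrite E; exact.
Qed.

Lemma rder_fdiff k x s : 0 < x -> rder (fun t => fdiff k t s) x (- s * fdiff k x (s + 1)).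
Proof.
elim: k x => [|k IH] x x0 /=; first exact: rder_rpow.
rewrite mulrBr; apply: rderB; first exact: IH.
exact: (rder_shift (IH _ (addr_gt0 x0 ltr01))).
Qed.

(** The mean value inequality turns each difference into a derivative in [x], which replaces [s] by
    [s + 1] and brings out a factor [- s]. The condition on [Re s + k] makes the resulting power
    decreasing, so its value at [x] bounds it on [[x, x + 1]]. *)
Lemma fdiff_bound k x s : 0 < x -> 0 <= complex.Re s + k%:R ->
  cn (fdiff k x s) <=
    (\prod_(j < k) cn (s + j%:R)) * expR (- ((complex.Re s + k%:R) * ln x)).
Proof.
elim: k x s => [|k IH] x s x0 sk.
  by rewrite big_ord0 mul1r addr0 cn_rpow.
rewrite /= cnBC.
have ReS : complex.Re (s + 1) = complex.Re s + 1 by rewrite ReD.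
have x1 : x <= x + 1 by rewrite lerDl.
have := @MVI _ (fun t => fdiff k t s) (fun t => - s * fdiff k t (s + 1)) x (x + 1)
  ((\prod_(j < k.+1) cn (s + j%:R)) * expR (- ((complex.Re s + k.+1%:R) * ln x))) x1.
rewrite addrAC subrr add0r mulr1; apply=> y /andP[xy _].
  by apply: rder_fdiff; exact: lt_le_trans xy.
have y0 : 0 < y by exact: lt_le_trans xy.
have sk' : 0 <= complex.Re (s + 1) + k%:R by rewrite ReS -addrA nat1r.
rewrite cnM cnN big_ord_recl addr0 -mulrA ler_wpM2l ?cn_ge0//.
apply: le_trans (IH y (s + 1) y0 sk') _; apply: ler_pM.
- by apply: prodr_ge0 => j _; exact: cn_ge0.
- exact: expR_ge0.
- rewrite le_eqVlt; apply/orP; left; apply/eqP; apply: eq_bigr => j _.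
  by rewrite -addrA nat1r.
- rewrite ler_expR lerN2 ReS -addrA nat1r ler_wpM2l// ler_ln ?posrE//.
Qed.

End ComplexExponential.

(** * Limits of complex sequences *)

Section ComplexSequences.
Variable R : realType.
Implicit Types (u v : nat -> R[i]) (l m : R[i]).

Definition clim u l := forall e : R, 0 < e ->
  exists N, forall n, (N <= n)%N -> cn (u n - l) <= e.

Lemma clim_uniq u l m : clim u l -> clim u m -> l = m.
Proof.
move=> hl hm; apply/eqP; rewrite -subr_eq0 -cn_eq0 eq_le cn_ge0 andbT.
apply/ler_addgt0Pr => e e0; rewrite add0r.
have e20 : 0 < e / 2 by rewrite divr_gt0.
have [n hn] := hl _ e20; have [n' hn'] := hm _ e20.
have := hn _ (leq_maxl n n'); have := hn' _ (leq_maxr n n').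
have := cn_tri l m (u (maxn n n')); rewrite (cnBC l (u _)); lra.
Qed.

Lemma climD u v l m : clim u l -> clim v m -> clim (fun n => u n + v n) (l + m).
Proof.
move=> hl hm e e0; have e20 : 0 < e / 2 by rewrite divr_gt0.
have [n hn] := hl _ e20; have [n' hn'] := hm _ e20.
exists (maxn n n') => k; rewrite geq_max => /andP[/hn h1 /hn' h2].
have -> : u k + v k - (l + m) = (u k - l) + (v k - m) by ring.
by apply: le_trans (cnD _ _) _; lra.
Qed.

Lemma climZ c u l : clim u l -> clim (fun n => c * u n) (c * l).
Proof.
move=> hl e e0; pose L := 1 + cn c; have L0 : 0 < L by rewrite ltr_wpDr ?cn_ge0.
have [n hn] := hl _ (divr_gt0 e0 L0); exists n => k /hn h.
rewrite -mulrBr cnM; apply: (@le_trans _ _ (L * (e / L))).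
  by apply: ler_pM; rewrite ?cn_ge0// /L lerDr.
by rewrite mulrC divfK// gt_eqF.
Qed.

Lemma clim_cst l : clim (fun=> l) l.
Proof. by move=> e e0; exists 0%N => n _; rewrite subrr cn0 ltW. Qed.

Lemma clim_sum I (r : seq I) (F : I -> nat -> R[i]) (L : I -> R[i]) :
  (forall i, clim (F i) (L i)) ->
  clim (fun n => \sum_(i <- r) F i n) (\sum_(i <- r) L i).
Proof.
move=> h; elim: r => [|i r IH].
  by rewrite big_nil; under eq_fun do rewrite big_nil; exact: clim_cst.
by rewrite big_cons; under eq_fun do rewrite big_cons; exact: climD.
Qed.

Lemma clim_near u v l N : (forall n, (N <= n)%N -> u n = v n) -> clim u l -> clim v l.
Proof.
move=> uv h e /h[n hn]; exists (maxn N n) => k; rewrite geq_max => /andP[/uv <-].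
exact: hn.
Qed.

Lemma climP u (l : R[i]) :
  ((u : nat -> R[i]^o) @ \oo --> (l : R[i]^o)) <-> clim u l.
Proof.
split=> [/cvgrPdist_le h e e0|h].
  have [|N _ hN] := h e%:C; first by rewrite ltcR.
  by exists N => n /hN; rewrite /= distrC normE lecR.
apply/cvgrPdist_le => _ /ltC_real[e e0 ->].
by have [N hN] := h e e0; exists N => // n /hN; rewrite /= distrC normE lecR.
Qed.

(** Strong induction bounds the sequence; then each passage from [n./2] to [n] multiplies the bound
    on the excess over [d / 2] by [q]. *)
Lemma halving_contraction (e del : nat -> R) (q : R) : 0 <= q -> q < 1 ->
  (forall n, 0 <= e n) ->
  (forall n, e n <= del n + q * e n./2) ->
  (forall d, 0 < d -> exists N, forall n, (N <= n)%N -> del n <= d) ->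
  forall d, 0 < d -> exists N, forall n, (N <= n)%N -> e n <= d.
Proof.
move=> q0 q1 e0 he hdel d d0.
have q10 : 0 < 1 - q by rewrite subr_gt0.
(* With this choice [d / 2] is the fixed point of the map sending [t] to [d1 + q * t]. *)
pose d1 := d / 2 * (1 - q); have d10 : 0 < d1 by rewrite mulr_gt0// divr_gt0.
have [N0 hN0] := hdel d1 d10; pose N := N0.+1.
have hN n : (N <= n)%N -> del n <= d1 by move=> nN; apply: hN0; exact: ltnW.
pose C := \sum_(i < N) e i; have C0 : 0 <= C by exact: sumr_ge0.
pose B := C + d / 2; have B0 : 0 < B by rewrite ltr_wpDl// divr_gt0.
have eB n : e n <= B.
  elim/ltn_ind: n => n IH; have [nN|Nn] := ltnP n N.
    have : e n <= C.
      by rewrite /C (bigD1 (Ordinal nN))//= lerDl sumr_ge0.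
    by move=> h; apply: le_trans h _; rewrite /B lerDl divr_ge0// ltW.
  apply: le_trans (he n) _; have n2 : (n./2 < n)%N by lia.
  have h1 := hN n Nn; have h2 : q * e n./2 <= q * B by rewrite ler_wpM2l// IH.
  have h3 : d1 <= B * (1 - q) by rewrite ler_wpM2r ?(ltW q10)// /B lerDr.
  lra.
have eq j n : (N * 2 ^ j <= n)%N -> e n <= d / 2 + q ^+ j * B.
  elim: j n => [|j IH] n hn.
    by rewrite expr0 mul1r; apply: le_trans (eB n) _; rewrite lerDr divr_ge0// ltW.
  have Nn : (N <= n)%N by apply: leq_trans hn; rewrite leq_pmulr// expn_gt0.
  apply: le_trans (he n) _; have h1 := hN n Nn.
  have h2 : q * e n./2 <= q * (d / 2 + q ^+ j * B).
    rewrite ler_wpM2l// IH//; move: hn; rewrite expnS; lia.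
  rewrite exprS; rewrite /d1 in h1; lra.
have [j hj] : exists j, q ^+ j * B <= d / 2.
  apply: contrapT => no.
  suff : 1 <= q by rewrite leNgt q1.
  apply: (@pow_le _ 1 q (d / 2) B) => // [|j _]; first by rewrite divr_gt0.
  rewrite expr1n mul1r leNgt; apply/negP => h; apply: no; exists j; exact: ltW.
by exists (N * 2 ^ j)%N => n /eq h; lra.
Qed.

End ComplexSequences.

(** * The alternating zeta function as an entire function *)

Section Eta.
Variable R : realType.
Implicit Types (s a z : R[i]) (e d : R).

Definition altsum k N s : R[i] := \sum_(0 <= n < N) (-1) ^+ n * fdiff k n.+1%:R s.

(* Euler's transform: [k] summations by parts turn the alternating series of
   the [n ^ - s] into a series that converges for [1 - k < Re s]. *)
Definition eta_part k N s : R[i] :=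
  \sum_(0 <= j < k) (2 ^+ j.+1)^-1 * fdiff j 1 s + (2 ^+ k)^-1 * altsum k N s.

Lemma altsumS k N s :
  altsum k.+1 N s = 2 * altsum k N s - fdiff k 1 s + (-1) ^+ N * fdiff k N.+1%:R s.
Proof.
rewrite /altsum; elim: N => [|N IH].
  by rewrite !big_nil expr0; ring.
rewrite !big_nat_recr//= IH natr1 exprS; ring.
Qed.

Lemma eta_partS k N s : eta_part k.+1 N s =
  eta_part k N s + (2 ^+ k.+1)^-1 * ((-1) ^+ N * fdiff k N.+1%:R s).
Proof.
rewrite /eta_part big_nat_recr//= altsumS exprS.
by field; rewrite expf_neq0.
Qed.

Lemma hol_eta_part k N s : hol (eta_part k N) s.
Proof.
apply: holD; first by apply: hol_sum => j; apply: holM (hol_fdiff _ _ _); exact: hol_cst.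
apply: holM; first exact: hol_cst.
by apply: hol_sum => j; apply: holM (hol_fdiff _ _ _); exact: hol_cst.
Qed.

Lemma cn_sign n : cn ((-1) ^+ n : R[i]) = 1.
Proof. by rewrite cnX cnN cn1 expr1n. Qed.

Lemma cn_pow2V k : cn ((2 ^+ k)^-1 : R[i]) <= 1.
Proof.
rewrite cnV cnX invf_le1; last by rewrite exprn_gt0// cn_gt0.
apply: exprn_ege1; rewrite -[2 in leRHS](rmorph_nat (real_complex R)) cn_real.
by rewrite ger0_norm// ler1n.
Qed.

(** The increments are at most [C / (m + 2) ^ 2], hence at most [C / (m + 1) - C / (m + 2)], which
    telescopes. *)
Lemma eta_part_cauchy k s (C : R) : 0 <= C ->
  (forall n, cn (fdiff k n.+1%:R s) <= C / n.+1%:R ^+ 2) ->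
  forall n m, cn (eta_part k n.+1 s - eta_part k m.+1 s) <= C / n.+1%:R + C / m.+1%:R.
Proof.
move=> C0 hC.
have le n m : (n <= m)%N -> cn (eta_part k m.+1 s - eta_part k n.+1 s) <=
    C / n.+1%:R - C / m.+1%:R.
  elim: m => [|m IH]; first by rewrite leqn0 => /eqP ->; rewrite !subrr cn0.
  rewrite leq_eqVlt => /orP[/eqP ->|]; first by rewrite !subrr cn0.
  rewrite ltnS => /IH h; apply: le_trans (cn_tri _ _ (eta_part k m.+1 s)) _.
  have E : eta_part k m.+2 s - eta_part k m.+1 s =
      (2 ^+ k)^-1 * ((-1) ^+ m.+1 * fdiff k m.+2%:R s).
    by rewrite /eta_part /altsum [in X in X - _]big_nat_recr//=; ring.
  have h2 : cn (eta_part k m.+2 s - eta_part k m.+1 s) <= C / m.+1%:R - C / m.+2%:R.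
    rewrite E !cnM cn_sign mul1r.
    apply: (@le_trans _ _ (1 * (C / m.+2%:R ^+ 2))).
      by apply: ler_pM; rewrite ?cn_ge0// cn_pow2V.
    have m1 : 0 < m.+1%:R :> R by rewrite ltr0n.
    have m2 : 0 < m.+2%:R :> R by rewrite ltr0n.
    have -> : C / m.+1%:R - C / m.+2%:R = C * (m.+1%:R * m.+2%:R)^-1.
      rewrite -[m.+2%:R]natr1; rewrite -[m.+2%:R]natr1 in m2.
      by field; rewrite !gt_eqF.
    rewrite mul1r ler_wpM2l// lef_pV2 ?posrE ?mulr_gt0 ?exprn_gt0//.
    by rewrite expr2 ler_wpM2r ?(ltW m2)// ler_nat.
  move: h h2; move: (C / n.+1%:R) (C / m.+1%:R) (C / m.+2%:R) => x y t; lra.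
move=> n m.
have P i : 0 <= C / i.+1%:R by rewrite divr_ge0.
have := P n; have := P m => pm pn.
case/orP: (leq_total n m) => /le; rewrite ?[cn (eta_part k n.+1 s - _)]cnBC;
  move: pm pn; move: (C / n.+1%:R) (C / m.+1%:R) => x y; lra.
Qed.

Lemma expR_natN2 n : expR (- (2 * ln n.+1%:R)) = (n.+1%:R ^+ 2)^-1 :> R.
Proof. by rewrite expRN expRM_natl lnK// posrE ltr0n. Qed.

(** The bound depends on the centre [a] and not on [s], as the uniform convergence in [hol_lim]
    requires. *)
Lemma fdiff_bound2 k s a : cn (s - a) < 1 -> 2 <= complex.Re s + k%:R ->
  forall n, cn (fdiff k n.+1%:R s) <= (cn a + 1 + k%:R) ^+ k / n.+1%:R ^+ 2.
Proof.
move=> sa sk n; have n0 : 0 < n.+1%:R :> R by rewrite ltr0n.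
have sk0 : 0 <= complex.Re s + k%:R by apply: le_trans sk.
apply: le_trans (fdiff_bound n0 sk0) _; apply: ler_pM.
- by apply: prodr_ge0 => j _; exact: cn_ge0.
- exact: expR_ge0.
- rewrite -[k in _ ^+ k]card_ord -prodr_const; apply: ler_prod => j _.
  rewrite cn_ge0/=; apply: le_trans (cnD _ _) _.
  apply: lerD.
    by apply: le_trans (cn_leD s a) _; rewrite lerD2l ltW.
  rewrite -(rmorph_nat (real_complex R)) cn_real ger0_norm//.
  by rewrite ler_nat ltnW.
- rewrite -expR_natN2 ler_expR lerN2 ler_wpM2r// ln_ge0//.
  by rewrite ler1n.
Qed.

Lemma expR_small (c e : R) : 0 < c -> 0 < e ->
  exists N, forall n, (N <= n)%N -> expR (- (c * ln n.+1%:R)) <= e.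
Proof.
move=> c0 e0; pose X := - ln e / c.
exists (Num.bound (expR X)) => n hn.
have : expR X <= n.+1%:R.
  apply: le_trans (ltW (archi_boundP (expR_ge0 _))) _.
  by rewrite ler_nat; apply: leq_trans hn _.
rewrite -[leRHS]lnK ?posrE ?ltr0n// ler_expR => h.
rewrite -[e]lnK ?posrE// ler_expR lerNl.
by move: h; rewrite /X ler_pdivrMr// mulrC.
Qed.

Lemma fdiff_to0 k s : 0 < complex.Re s + k%:R ->
  clim (fun N => (2 ^+ k.+1)^-1 * ((-1) ^+ N * fdiff k N.+1%:R s)) 0.
Proof.
move=> sk e e0.
pose C := 1 + \prod_(j < k) cn (s + j%:R).
have P0 : 0 <= \prod_(j < k) cn (s + j%:R) by apply: prodr_ge0 => j _; exact: cn_ge0.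
have C0 : 0 < C by rewrite ltr_wpDr.
have [N hN] := expR_small sk (divr_gt0 e0 C0).
exists N => n /hN h; rewrite subr0 !cnM cn_sign mul1r.
have n0 : 0 < n.+1%:R :> R by rewrite ltr0n.
have := fdiff_bound n0 (ltW sk) => h2.
rewrite -[e]mul1r; apply: ler_pM; rewrite ?cn_ge0 ?cn_pow2V//.
apply: le_trans h2 _; apply: (@le_trans _ _ (C * (e / C))).
  by apply: ler_pM; rewrite ?expR_ge0// /C lerDr.
by rewrite mulrC divfK// gt_eqF.
Qed.

Lemma clim_eta_partS k s l : 0 < complex.Re s + k%:R ->
  clim (fun N => eta_part k N s) l <-> clim (fun N => eta_part k.+1 N s) l.
Proof.
move=> /fdiff_to0 h0; split=> h.
  have := climD h h0; rewrite addr0; apply: (@clim_near _ _ _ _ 0%N) => n _.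
  by rewrite eta_partS.
have := climD h (climZ (-1) h0); rewrite mulr0 addr0.
by apply: (@clim_near _ _ _ _ 0%N) => n _; rewrite eta_partS mulN1r addrK.
Qed.

(** Any order [k] for which the boundary terms of the summations by parts tend to 0 may be used;
    [clim_eta_part_le] shows that the limit does not depend on it. *)
Definition eta s : R[i] :=
  xget 0 [set l | exists2 k, 0 < complex.Re s + k%:R &
                  clim (fun N => eta_part k N s) l].

Lemma clim_eta_part_le k k' s l : (k <= k')%N -> 0 < complex.Re s + k%:R ->
  clim (fun N => eta_part k N s) l <-> clim (fun N => eta_part k' N s) l.
Proof.
move=> kk' sk; elim: k' kk' => [|k' IH]; first by rewrite leqn0 => /eqP ->.
rewrite leq_eqVlt => /orP[/eqP -> //|]; rewrite ltnS => kk'.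
rewrite (IH kk'); apply: clim_eta_partS; apply: lt_le_trans sk _.
by rewrite lerD2l ler_nat.
Qed.

Lemma clim_eta k s : 0 < complex.Re s + k%:R -> clim (fun N => eta_part k N s) (eta s).
Proof.
move=> sk.
have [K [kK sK]] : exists K, (k <= K)%N /\ 2 <= complex.Re s + K%:R.
  exists (k + 2)%N; split; first exact: leq_addr.
  rewrite natrD addrA; lra.
have ss : cn (s - s) < 1 by rewrite subrr cn0.
have C0 : 0 <= (cn s + 1 + K%:R) ^+ K by rewrite exprn_ge0// !addr_ge0// cn_ge0.
have [l hl] := cauchy_squeezeC (eta_part_cauchy C0 (fdiff_bound2 ss sK)).
have : clim (fun N => eta_part K N s) l.
  move=> e e0; set C := (_ ^+ K) in C0 hl.
  exists (Num.bound (2 * C / e)).+1 => -[//|n] nB.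
  apply: le_trans (hl n) _; rewrite mulrA ler_pdivrMr// [e * _]mulrC -ler_pdivrMr//.
  apply: le_trans (ltW (archi_boundP _)) _.
    by rewrite divr_ge0 ?(ltW e0)// mulr_ge0.
  by rewrite ler_nat; exact: ltnW.
rewrite -(clim_eta_part_le l kK sk) => {}hl.
have : [set l | exists2 k, 0 < complex.Re s + k%:R &
                  clim (fun N => eta_part k N s) l] (eta s).
  by apply: xgetPex; exists l; exists k.
move=> [k' sk' hk'].
case/orP: (leq_total k k') => h.
  by rewrite (clim_eta_part_le _ h sk).
by rewrite -(clim_eta_part_le _ h sk').
Qed.

Lemma hol_eta a : hol eta a.
Proof.
(* The bound 3 at [a] leaves 2 on the unit disc around [a], where the terms are then dominated by a
   series of inverse squares. *)
have [k ak] : exists k, 3 <= complex.Re a + k%:R.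
  exists (Num.bound `|3 - complex.Re a|).
  have := archi_boundP (normr_ge0 (3 - complex.Re a)).
  have := ler_norm (3 - complex.Re a); lra.
have hs s : cn (s - a) < 1 -> 2 <= complex.Re s + k%:R.
  by move=> sa; have := Re_cn (s - a); rewrite ReB ler_norml; lra.
pose C := (cn a + 1 + k%:R) ^+ k.
have C0 : 0 <= C by rewrite exprn_ge0// !addr_ge0// cn_ge0.
have [|||l hl _] := @hol_lim R eta (fun N => eta_part k N.+1) a 1
   (fun N => C / N.+1%:R) ltr01; last by exists l.
- by move=> n w _; exact: hol_eta_part.
- move=> n w wa.
  have P i : 0 <= C / i.+1%:R by rewrite divr_ge0.
  have lim_eta : clim (fun N => eta_part k N w) (eta w).
    by apply: clim_eta; apply: lt_le_trans (hs w wa).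
  apply/ler_addgt0Pr => e e0.
  have e20 : 0 < e / 2 by rewrite divr_gt0.
  have [N hN] := lim_eta _ e20.
  pose M := maxn N (Num.bound (2 * C / e)).
  have h1 := eta_part_cauchy C0 (fdiff_bound2 wa (hs w wa)) n M.
  have h2 := hN M.+1 (leqW (leq_maxl _ _)).
  have h3 : C / M.+1%:R <= e / 2.
    rewrite ler_pdivrMr// [_ * M.+1%:R]mulrC -ler_pdivrMr//.
    have -> : C / (e / 2) = 2 * C / e by field; rewrite gt_eqF.
    apply: le_trans (ltW (archi_boundP _)) _; first by rewrite divr_ge0 ?(ltW e0)// mulr_ge0.
    by rewrite ler_nat; apply: leqW; exact: leq_maxr.
  apply: le_trans (cn_tri _ _ (eta_part k M.+1 w)) _.
  by move: h1 h2 h3; move: (C / n.+1%:R) (C / M.+1%:R) => x y; lra.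
- move=> d d0; exists (Num.bound (C / d)).
  rewrite ler_pdivrMr// [d * _]mulrC -ler_pdivrMr//.
  apply: le_trans (ltW (archi_boundP _)) _; first by rewrite divr_ge0// ltW.
  by rewrite ler_nat.
Qed.

End Eta.

(** * The zeta function and its pole at 1 *)

Section Zeta.
Variable R : realType.
Implicit Types (s a z : R[i]) (e d r : R).

Definition psum n s : R[i] := \sum_(1 <= k < n.+1) rpow k%:R s.

Lemma psumS n s : psum n.+1 s = psum n s + rpow n.+1%:R s.
Proof. by rewrite /psum big_nat_recr. Qed.

Lemma altsum0S n s : altsum 0 n.+1 s = altsum 0 n s + (-1) ^+ n * rpow n.+1%:R s.
Proof. by rewrite /altsum big_nat_recr. Qed.

(** Changing the signs of the even terms takes away twice their sum, and the term of index [2 j] is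
    [2 ^ (- s)] times that of index [j]. *)
Lemma psum_half n s : psum n s = altsum 0 n s + 2 * rpow 2 s * psum n./2 s.
Proof.
have even m : psum m.*2 s = altsum 0 m.*2 s + 2 * rpow 2 s * psum m s.
  elim: m => [|m IH].
    by rewrite /psum /altsum !big_geq// mulr0 addr0.
  rewrite doubleS 2!psumS IH 2!altsum0S psumS.
  have -> : m.*2.+2%:R = 2 * m.+1%:R :> R by rewrite -natrM mul2n.
  rewrite rpowM ?ltr0n// exprS -signr_odd odd_double expr0.
  ring.
rewrite -(odd_double_half n); case: (odd n) => /=; last by rewrite add0n even doubleK.
rewrite add1n psumS altsum0S even uphalf_double -signr_odd odd_double expr0.
by ring.
Qed.

Lemma clim_altsum0 s : 0 < complex.Re s -> clim (fun n => altsum 0 n s) (eta s).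
Proof.
move=> s0; have := @clim_eta _ 0 s; rewrite addr0 => /(_ s0).
apply: (@clim_near _ _ _ _ 0%N) => n _.
by rewrite /eta_part big_geq// add0r expr0 invr1 mul1r.
Qed.

Definition dzeta s : R[i] := 1 - 2 * rpow 2 s.

(** At the zeros of [dzeta] the division convention gives the value 0; the statements about poles
    avoid these points. *)
Definition zeta s : R[i] := eta s / dzeta s.

Lemma cn2 : cn (2 : R[i]) = 2.
Proof. by rewrite -[2 in LHS](rmorph_nat (real_complex R)) cn_real ger0_norm. Qed.

Lemma cn_2rpow2 s : cn (2 * rpow 2 s) = expR ((1 - complex.Re s) * ln 2).
Proof.
rewrite cnM cn2 cn_rpow -[X in X * _](@lnK R) ?posrE// -expRD; congr expR.
by rewrite mulrBl mul1r.
Qed.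

Lemma ln2_gt0 : 0 < ln 2 :> R.
Proof. by rewrite ln_gt0// ltr1n. Qed.

Lemma dzeta_eq0 s : dzeta s = 0 -> complex.Re s = 1.
Proof.
move=> /eqP; rewrite subr_eq0 => /eqP/(congr1 cn); rewrite cn1 cn_2rpow2 => h.
have : expR ((1 - complex.Re s) * ln 2) = expR 0 by rewrite expR0 -h.
move=> /expR_inj/eqP; rewrite mulf_eq0 (gt_eqF ln2_gt0) orbF.
by rewrite subr_eq0 => /eqP.
Qed.

(** By [psum_half], the error at [n] is that of the alternating sum plus [2 ^ (1 - s)] times the
    error at [n./2]. This factor has modulus less than 1, so convergence and the value of the limit
    are obtained together. *)
Lemma clim_psum s : 1 < complex.Re s -> clim (fun n => psum n s) (zeta s).
Proof.
move=> s1.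
have d0 : dzeta s != 0.
  by apply/eqP => /dzeta_eq0 h; move: s1; rewrite h ltxx.
have q1 : cn (2 * rpow 2 s) < 1.
  rewrite cn_2rpow2 -[ltRHS](@expR0 R) ltr_expR pmulr_llt0 ?ln2_gt0//.
  by rewrite subr_lt0.
have step n : cn (psum n s - zeta s) <=
    cn (altsum 0 n s - eta s) + cn (2 * rpow 2 s) * cn (psum n./2 s - zeta s).
  rewrite psum_half -cnM.
  have -> : altsum 0 n s + 2 * rpow 2 s * psum n./2 s - zeta s =
    (altsum 0 n s - eta s) + 2 * rpow 2 s * (psum n./2 s - zeta s).
    have E : eta s = zeta s * dzeta s by rewrite /zeta divfK.
    by rewrite [X in _ = _ - X + _]E /dzeta; ring.
  exact: cnD.
have lim := clim_altsum0 (lt_trans ltr01 s1).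
exact: (halving_contraction (cn_ge0 _) q1 (fun n => cn_ge0 _) step lim).
Qed.

Lemma rpow2_1 : rpow 2 (1 : R[i]) = 2^-1 :> R[i].
Proof.
by rewrite -[LHS]/(rpow 2 1%:R) rpow_nat// expr1 rmorph_nat.
Qed.

(** The increments of [ln] lie between [1 / (k + 1)] and [1 / k] and telescope to [ln 2]; the two
    outer sums differ by less than [1 / (n + 1)]. *)
Lemma psum1_ln n :
  ln 2 - 1 / n.+1%:R <= \sum_(n.+1 <= k < n.+1.*2) (k.+1%:R)^-1 :> R /\
  \sum_(n.+1 <= k < n.+1.*2) (k.+1%:R)^-1 <= ln 2 :> R.
Proof.
have lnS k : (0 < k)%N -> (k.+1%:R)^-1 <= ln k.+1%:R - ln k%:R :> R /\
    ln k.+1%:R - ln k%:R <= (k%:R)^-1 :> R.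
  move=> k0; have kp : 0 < k%:R :> R by rewrite ltr0n.
  have kp1 : 0 < k.+1%:R :> R by rewrite ltr0n.
  split.
    have E : ln k%:R - ln k.+1%:R = ln (1 + - (k.+1%:R)^-1) :> R.
      have -> : 1 + - (k.+1%:R)^-1 = k%:R / k.+1%:R :> R.
        rewrite -natr1; rewrite -natr1 in kp1.
        by field; rewrite gt_eqF.
      by rewrite lnM ?posrE ?invr_gt0// lnV ?posrE.
    have : - 1 < - (k.+1%:R)^-1 :> R by rewrite ltrN2 invf_lt1// ltr1n ltnS.
    by move=> /le_ln1Dx; rewrite -E lerNr opprB.
  have E : ln k.+1%:R - ln k%:R = ln (1 + (k%:R)^-1) :> R.
    have -> : 1 + (k%:R)^-1 = k.+1%:R / k%:R :> R.
      by rewrite -natr1; field; rewrite gt_eqF.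
    by rewrite lnM ?posrE ?invr_gt0// lnV ?posrE.
  rewrite E; apply: le_ln1Dx; have : 0 < (k%:R)^-1 :> R by rewrite invr_gt0.
  lra.
have n0 : 0 < n.+1%:R :> R by rewrite ltr0n.
have tel m : (n.+1 <= m)%N -> \sum_(n.+1 <= k < m) (ln k.+1%:R - ln k%:R) =
    ln m%:R - ln n.+1%:R :> R.
  by move=> nm; rewrite (telescope_sumr (fun k => ln k%:R)).
have le2 : (n.+1 <= n.+1.*2)%N by rewrite -addnn leq_addr.
have ln2E : ln 2 = \sum_(n.+1 <= k < n.+1.*2) (ln k.+1%:R - ln k%:R) :> R.
  rewrite tel// -mul2n natrM lnM ?posrE// addrK//.
split; last first.
  rewrite ln2E; apply: ler_sum_nat => k /andP[nk _].
  by have [] := lnS k (leq_trans (ltn0Sn n) nk).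
have : ln 2 <= \sum_(n.+1 <= k < n.+1.*2) (k%:R)^-1 :> R.
  rewrite ln2E; apply: ler_sum_nat => k /andP[nk _].
  by have [] := lnS k (leq_trans (ltn0Sn n) nk).
have -> : \sum_(n.+1 <= k < n.+1.*2) (k%:R)^-1 =
    \sum_(n.+1 <= k < n.+1.*2) (k.+1%:R)^-1 + (n.+1%:R)^-1 - (n.+1.*2%:R)^-1 :> R.
  apply/eqP; rewrite -subr_eq0 -addrA opprD addrA -sumrB.
  rewrite (eq_bigr (fun k : nat => - ((k.+1%:R)^-1 - (k%:R)^-1))); last first.
    by move=> k _; rewrite opprB.
  rewrite sumrN (telescope_sumr (fun k => (k%:R)^-1))//; apply/eqP; ring.
have : 0 < (n.+1.*2%:R)^-1 :> R by rewrite invr_gt0 ltr0n double_gt0.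
rewrite div1r; move: (_^-1) (_^-1) (bigop _ _ _) => x y t; lra.
Qed.

(** At [s = 1] the factor in [psum_half] is 1, so the alternating harmonic sum of length [2 n + 2]
    is the sum of the [1 / k] for [n + 2 <= k <= 2 n + 2]. *)
Lemma eta1 : eta 1 = (ln 2)%:C :> R[i].
Proof.
apply/eqP; rewrite -subr_eq0 -cn_eq0 eq_le cn_ge0 andbT.
apply/ler_addgt0Pr => e e0; rewrite add0r.
have re1 : 0 < complex.Re (1 : R[i]) by exact: ltr01.
have e20 : 0 < e / 2 by rewrite divr_gt0.
have [N hN] := clim_altsum0 re1 e20.
pose n := maxn N (Num.bound (2 / e)).
have /hN h1 : (N <= n.+1.*2)%N.
  have : (N <= n)%N by exact: leq_maxl.
  by move: (n) => k; lia.
have h2 : 1 / n.+1%:R <= e / 2.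
  rewrite ler_pdivrMr// mulrC -ler_pdivrMr// div1r invf_div.
  apply: le_trans (ltW (archi_boundP _)) _; first by rewrite divr_ge0// ltW.
  by rewrite ler_nat; apply: leqW; exact: leq_maxr.
have E : altsum 0 n.+1.*2 1 = (\sum_(n.+1 <= k < n.+1.*2) (k.+1%:R)^-1)%:C :> R[i].
  have := psum_half n.+1.*2 1; rewrite doubleK rpow2_1 mulfV ?mul1r ?pnatr_eq0//.
  move=> /esym/eqP; rewrite eq_sym -subr_eq => /eqP <-.
  have le2 : (n.+2 <= n.+1.*2.+1)%N by move: (n) => k; lia.
  have -> : psum n.+1.*2 1 = psum n.+1 1 + \sum_(n.+2 <= k < n.+1.*2.+1) rpow k%:R 1.
    by rewrite /psum (@big_cat_nat _ _ _ n.+2).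
  rewrite addrAC subrr add0r big_add1 /= rmorph_sum /=; apply: eq_bigr => k _.
  by rewrite -[rpow _ 1]/(rpow k.+1%:R 1%:R) rpow_nat ?ltr0n// expr1 fmorphV.
have [h3 h4] := psum1_ln n.
have h5 : cn (altsum 0 n.+1.*2 1 - (ln 2)%:C) <= e / 2.
  rewrite E -rmorphB cn_real ler_norml; move: h2 h3 h4.
  by move: (1 / n.+1%:R) (bigop _ _ _) => x y; lra.
apply: le_trans (cn_tri _ _ (altsum 0 n.+1.*2 1)) _.
by rewrite (cnBC (eta 1)); lra.
Qed.

Lemma hol_dzeta s : hol dzeta s.
Proof.
apply: holB; first exact: hol_cst.
by apply: holM; [exact: hol_cst|exact: hol_rpow].
Qed.

Lemma cder_dzeta s : cder dzeta s ((ln 2)%:C * (2 * rpow 2 s)).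
Proof.
have := cderB (cder_cst 1 s) (cderZ 2 (cder_rpow 2 s)).
by have -> : 0 - 2 * (- (ln 2)%:C * rpow 2 s) = (ln 2)%:C * (2 * rpow 2 s) :> R[i] by ring.
Qed.

Lemma hol_zeta s : dzeta s != 0 -> hol zeta s.
Proof. by move=> d0; apply: holM; [exact: hol_eta|exact: holV (hol_dzeta s) d0]. Qed.

Lemma ccont_neq0 (f : R[i] -> R[i]) a : ccont f a -> f a != 0 ->
  exists2 r, 0 < r & forall w, cn (w - a) < r -> f w != 0.
Proof.
move=> cf f0; have c0 : 0 < cn (f a) / 2 by rewrite divr_gt0// cn_gt0.
have [d d0 hd] := cf _ c0; exists d => // w /hd h.
by rewrite -cn_gt0; have := cn_leD (f a) (f w); rewrite cnBC; lra.
Qed.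

(* [dzeta] has only simple zeros, since its derivative there is [ln 2]. *)
Lemma zeta_simple_pole a : exists2 r, 0 < r & exists g,
  [/\ forall w, cn (w - a) < r -> hol g w,
      forall w, cn (w - a) < r -> w != a -> (w - a) * zeta w = g w
    & dzeta a = 0 -> g a = eta a / (ln 2)%:C].
Proof.
have [da|da] := eqVneq (dzeta a) 0; last first.
  have [r r0 hr] := ccont_neq0 (hol_ccont (hol_dzeta a)) da.
  exists r => //; exists (fun w => (w - a) * zeta w); split=> //; last by move/eqP: da.
  move=> w /hr dw; apply: holM; last exact: hol_zeta.
  by apply: holB; [exact: hol_id|exact: hol_cst].
(* The zero is factored out: [dzeta w = (w - a) * v w], where [v a] is the derivative of [dzeta] at
   [a]. *)
have [v [hv vE]] := removable ltr01 (fun w (_ : cn (w - a) < 1) => hol_dzeta w).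
have aa r : 0 < r -> cn (a - a) < r by rewrite subrr cn0.
have va : v a = (ln 2)%:C.
  have [l hl] := hv a (aa _ ltr01).
  have h1 := cderM (cderB (cder_id a) (cder_cst a a)) hl.
  have h2 : cder dzeta a ((1 - 0) * v a + (a - a) * l).
    by apply: (cder_near ltr01 _ h1) => w _; rewrite [RHS]vE da add0r.
  have := cder_uniq h2 (cder_dzeta a).
  have -> : 2 * rpow 2 a = 1.
    by move: da => /eqP; rewrite subr_eq0 => /eqP <-.
  by rewrite subr0 mul1r subrr mul0r addr0 mulr1.
have va0 : v a != 0 by rewrite va -cn_gt0 cn_real normr_gt0 gt_eqF// ln2_gt0.
have [r r0 hr] := ccont_neq0 (hol_ccont (hv a (aa _ ltr01))) va0.
exists (Num.min r 1); first by rewrite lt_min r0 ltr01.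
exists (fun w => eta w / v w); split; last by rewrite va.
  move=> w; rewrite lt_min => /andP[/hr vw /hv hvw].
  by apply: holM; [exact: hol_eta|exact: holV].
move=> w; rewrite lt_min => /andP[/hr vw _] wa.
have wa0 : w - a != 0 by rewrite subr_eq0.
by rewrite /zeta vE da add0r; field; rewrite vw.
Qed.

(** The residue is [eta 1 / ln 2 = 1]; a second factorisation by [removable] isolates the
    holomorphic part. *)
Lemma zeta_pole1 : exists2 r, 0 < r & exists g,
  (forall w, cn (w - 1) < r -> hol g w) /\
  forall w, cn (w - 1) < r -> w != 1 -> zeta w = (w - 1)^-1 + g w.
Proof.
have [r r0 [g [hg gE g1]]] := zeta_simple_pole 1.
have d1 : dzeta 1 = 0 by rewrite /dzeta rpow2_1 mulfV ?subrr// pnatr_eq0.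
have l0 : (ln 2)%:C != 0 :> R[i] by rewrite -cn_gt0 cn_real normr_gt0 gt_eqF// ln2_gt0.
have {}g1 : g 1 = 1 by rewrite (g1 d1) eta1 divff.
have [k [hk kE]] := removable r0 hg.
exists r => //; exists k; split=> // w wr w1.
have w10 : w - 1 != 0 by rewrite subr_eq0.
apply: (mulfI w10); rewrite gE// kE g1 mulrDr divff//.
Qed.

End Zeta.

(** * The Hilbert-Samuel polynomial and the residue *)

Section PolynomialDifferences.
Variable R : realType.
Implicit Types (P Q : {poly R}) (f g : nat -> R) (x c : R).

(** A backward difference, to match the coefficients of [(1 - t)] times a series. *)
Definition pdiff P : {poly R} := P - (P \Po ('X - 1)).

Lemma horner_pdiff P x : (pdiff P).[x] = P.[x] - P.[x - 1].
Proof. by rewrite /pdiff !(hornerE, horner_comp). Qed.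

Lemma pdiffD P Q : pdiff (P + Q) = pdiff P + pdiff Q.
Proof. by rewrite /pdiff comp_polyD; ring. Qed.

Lemma pdiffZ c P : pdiff (c *: P) = c *: pdiff P.
Proof. by rewrite /pdiff comp_polyZ scalerBr. Qed.

(** The factorisation of ['X ^ (n + 1) - ('X - 1) ^ (n + 1)] is a sum of [n + 1] monic polynomials
    of degree [n]. *)
Lemma pdiff_Xn n : (pdiff 'X^(n.+1))`_n = n.+1%:R /\ (size (pdiff 'X^(n.+1)) <= n.+1)%N.
Proof.
have E : pdiff 'X^(n.+1) = \sum_(i < n.+1) 'X^(n - i) * ('X - 1) ^+ i.
  rewrite /pdiff comp_Xn_poly subrXX.
  have -> : 'X - ('X - 1) = 1 :> {poly R} by ring.
  by rewrite mul1r.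
have monI (i : 'I_n.+1) : 'X^(n - i) * ('X - 1) ^+ i \is @monic R.
  by rewrite monicMl ?monicXn// monic_exp// -[1]/(1%:P) monicXsubC.
have sizeI (i : 'I_n.+1) : size ('X^(n - i) * ('X - 1) ^+ i : {poly R}) = n.+1.
  rewrite size_Mmonic ?monic_neq0 ?monicXn//; last first.
    by rewrite monic_exp// -[1]/(1%:P) monicXsubC.
  rewrite -['X - 1]/('X - 1%:P) size_exp_XsubC size_polyXn addSn /= addnS subnK//.
  by rewrite -ltnS.
rewrite E; split.
  rewrite coef_sum (eq_bigr (fun=> 1)).
    by rewrite sumr_const card_ord.
  move=> i _; have /monicP := monI i; rewrite lead_coefE sizeI; exact.
by apply: (leq_trans (size_sum _ _ _)); apply/bigmax_leqP => i _; rewrite sizeI.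
Qed.

Lemma size_pdiff P n : (size P <= n.+1)%N -> (size (pdiff P) <= n)%N.
Proof.
move=> sP; rewrite -[P]coefK poly_def; elim/big_ind: _ => [|P1 P2 h1 h2|[[|i] ip] _ /=].
- by rewrite /pdiff comp_poly0 subrr size_poly0.
- by rewrite pdiffD; apply: leq_trans (size_polyD _ _) _; rewrite geq_max h1.
- rewrite pdiffZ expr0 /pdiff -[1 \Po _]/(1%:P \Po _) comp_polyC subrr scaler0.
  by rewrite size_poly0.
- rewrite pdiffZ; apply: leq_trans (size_scale_leq _ _) _.
  by have [_ h] := pdiff_Xn i; apply: leq_trans h _; lia.
Qed.

Lemma coef_pdiff P n : (size P <= n.+2)%N -> (pdiff P)`_n = P`_n.+1 *+ n.+1.
Proof.
move=> sP; have sQ : (size (P - P`_n.+1 *: 'X^(n.+1))%R <= n.+1)%N.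
  apply/leq_sizeP => j; rewrite leq_eqVlt => /orP[/eqP <-|nj].
    by rewrite coefB coefZ coefXn eqxx mulr1 subrr.
  rewrite coefB coefZ coefXn gtn_eqF// mulr0 subr0.
  by apply: nth_default; exact: leq_trans nj.
rewrite -[in LHS](subrK (P`_n.+1 *: 'X^(n.+1)) P) pdiffD pdiffZ coefD coefZ.
have [-> _] := pdiff_Xn n; rewrite (nth_default _ (size_pdiff sQ)) add0r.
by rewrite mulr_natr.
Qed.

Lemma antidifference Q : exists P, pdiff P = Q /\ (size P <= (size Q).+1)%N.
Proof.
have [n] := ubnP (size Q); elim: n Q => // n IH Q; rewrite ltnS => sQ.
have [->|Q0] := eqVneq Q 0.
  by exists 0; rewrite /pdiff comp_poly0 subrr size_poly0.
pose k := (size Q).-1; have kE : size Q = k.+1 by rewrite /k prednK// size_poly_gt0.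
pose P1 : {poly R} := (Q`_k / k.+1%:R) *: 'X^(k.+1).
have sP1 : (size P1 <= k.+2)%N.
  by apply: leq_trans (size_scale_leq _ _) _; rewrite size_polyXn.
have sQ1 : (size (Q - pdiff P1)%R <= k)%N.
  apply/leq_sizeP => j; rewrite leq_eqVlt => /orP[/eqP <-|kj].
    rewrite coefB coef_pdiff// coefZ coefXn eqxx mulr1 -(mulr_natr (_ / _)).
    by rewrite divfK ?subrr// pnatr_eq0.
  rewrite coefB !nth_default ?subrr//; last by rewrite kE.
  by apply: leq_trans kj; apply: size_pdiff.
have [|P2 [P2E sP2]] := IH (Q - pdiff P1).
  by apply: leq_ltn_trans sQ1 _; rewrite -kE.
exists (P2 + P1); rewrite pdiffD P2E subrK; split=> //.
apply: leq_trans (size_polyD _ _) _; rewrite geq_max kE sP1 andbT.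
by apply: leq_trans sP2 _; lia.
Qed.

Lemma cprod1BXS f n : cprod (1 - 'X) f n.+1 = f n.+1 - f n.
Proof. by rewrite cprod1BX cprodXS. Qed.

Lemma eventually_poly e f N : (forall n, (N <= n)%N -> cprod ((1 - 'X) ^+ e) f n = 0) ->
  exists P, (size P <= e)%N /\ exists M, forall n, (M <= n)%N -> f n = P.[n%:R].
Proof.
elim: e f N => [|e IH] f N h.
  exists 0; rewrite size_poly0; split=> //; exists N => n /h.
  by rewrite expr0 cprod1 horner0.
have [|Q [sQ [M hM]]] := IH (cprod (1 - 'X) f) N.
  by move=> n /h; rewrite exprSr cprodM.
have [P [PE sP]] := antidifference Q.
exists (P + (f M - P.[M%:R])%:P); split.
  apply: leq_trans (size_polyD _ _) _; rewrite geq_max (leq_trans sP)//=.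
  by apply: leq_trans (size_polyC_leq1 _) _.
exists M => n /subnKC <-; elim: (n - M)%N => [|k IHk].
  by rewrite addn0 hornerD hornerC addrC subrK.
have := hM (M + k.+1)%N (leq_addr _ _).
rewrite addnS cprod1BXS IHk -PE horner_pdiff -natr1 addrK !hornerD !hornerC.
by lra.
Qed.

Lemma cprod_eventually_poly m P f N : (size P <= m.+1)%N ->
  (forall n, (N <= n)%N -> f n = P.[n%:R]) ->
  forall n, (N + m <= n)%N -> cprod ((1 - 'X) ^+ m) f n = P`_m *+ m`!.
Proof.
elim: m P f N => [|m IH] P f N sP h n.
  rewrite addn0 => /h fn; rewrite expr0 cprod1 fn mulr1n.
  by rewrite (size1_polyC sP) hornerC coefC.
rewrite addnS => nN; rewrite exprSr cprodM (IH (pdiff P) _ N.+1).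
- by rewrite coef_pdiff// -mulrnA factS.
- exact: size_pdiff.
- case=> // k; rewrite ltnS => Nk; rewrite cprod1BXS (h k.+1) ?leqW// (h k)//.
  by rewrite horner_pdiff -natr1 addrK.
- by rewrite addSn.
Qed.

Lemma poly_nat_uniq P Q N : (forall n, (N <= n)%N -> P.[n%:R] = Q.[n%:R]) -> P = Q.
Proof.
move=> h; apply/eqP; rewrite -subr_eq0; apply/negPn/negP => PQ0.
pose s : seq R := [seq (N + i)%:R | i <- iota 0 (size (P - Q)%R)].
have := @max_poly_roots _ (P - Q) s PQ0.
rewrite size_map size_iota ltnn => /(_ _ _)/negP; apply=> //.
- apply/allP => x /mapP[i _ ->]; rewrite /root !hornerE h ?leq_addr//.
  by rewrite subrr.
- rewrite map_inj_uniq ?iota_uniq// => i j /eqP.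
  by rewrite eqr_nat eqn_add2l => /eqP.
Qed.

(** The terms below the leading one are at most [B * n ^ (d - 1)] in total, which is at most half of
    the leading term once [n >= 2 B / L]. *)
Lemma poly_lower_bound P : P != 0 -> exists c N, 0 < c /\
  forall n, (N <= n)%N -> c * n%:R ^+ (size P).-1 <= `|P.[n%:R]|.
Proof.
move=> P0; pose d := (size P).-1.
have dE : size P = d.+1 by rewrite /d prednK// size_poly_gt0.
pose L := `|P`_d|; have L0 : 0 < L by rewrite normr_gt0 -[P`_d]/(lead_coef P) lead_coef_eq0.
pose B := \sum_(i < d) `|P`_i|; have B0 : 0 <= B by exact: sumr_ge0.
exists (L / 2), (Num.bound (2 * B / L)).+1; split; first by rewrite divr_gt0.
move=> n hn; have n1 : (1 <= n)%N by lia.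
have n0 : 0 < n%:R :> R by rewrite ltr0n.
have Bn : B <= L / 2 * n%:R.
  have : 2 * B / L <= n%:R.
    apply: le_trans (ltW (archi_boundP _)) _; first by rewrite divr_ge0 ?(ltW L0)// mulr_ge0.
    by rewrite ler_nat; lia.
  by rewrite ler_pdivrMr// => h; lra.
rewrite horner_coef dE big_ord_recr /=.
set T := \sum_(i < d) _.
have TB : `|T| <= L / 2 * n%:R ^+ d.
  case: (posnP d) => [d0|dp].
    rewrite /T; move: (P) => P'; rewrite d0 big_ord0 normr0 expr0 mulr1.
    by rewrite divr_ge0// ltW.
  have -> : n%:R ^+ d = n%:R * n%:R ^+ d.-1 :> R by rewrite -exprS prednK.
  apply: (@le_trans _ _ (B * n%:R ^+ d.-1)); last first.
    by rewrite mulrA ler_wpM2r// exprn_ge0// ltW.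
  apply: le_trans (ler_norm_sum _ _ _) _; rewrite /B mulr_suml; apply: ler_sum => i _.
  rewrite normrM ler_wpM2l// normrX ger0_norm ?(ltW n0)//.
  by apply: ler_weXn2l; [rewrite ler1n|have := ltn_ord i; lia].
have := lerB_normD (P`_d * n%:R ^+ d) T; rewrite addrC.
have -> : `|P`_d * n%:R ^+ d| = L * n%:R ^+ d.
  by rewrite normrM normrX [`|n%:R|]ger0_norm// ltW.
rewrite [P`_d * _ + T]addrC; lra.
Qed.

End PolynomialDifferences.

(** * Numerators of the series and the Hilbert-Samuel polynomial *)

Section HilbertSamuelPolynomial.
Variables (R : realType) (H : nat -> nat).

Let chi n := (\sum_(0 <= i < n.+1) H i)%N.
Let fH n : R := (H n)%:R.
Let fchi n : R := (chi n)%:R.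

Lemma cprod_chi n : cprod (1 - 'X) fchi n = fH n.
Proof.
case: n => [|n]; last first.
  by rewrite cprod1BXS /fchi /chi big_nat_recr//= natrD addrC addKr.
by rewrite cprod1BX cprodX0 subr0 /fchi /chi big_nat1.
Qed.

Lemma hilbert_series_eqR m h : hilbert_series_eq H m h ->
  forall n, cprod ((1 - 'X) ^+ m) fH n = (map_poly intr h)`_n :> R.
Proof.
move=> Hh n; rewrite coef_map /= -Hh rmorph_sum /=; apply: eq_bigr => i _.
rewrite rmorphM /=; congr (_ * _).
by rewrite -(coef_map intr) rmorphXn rmorphB /= rmorph1 map_polyX.
Qed.

Lemma hilbert_samuel_poly m h : hilbert_series_eq H m h ->
  exists P : {poly R}, (size P <= m.+1)%N /\
    exists N, forall n, (N <= n)%N -> fchi n = P.[n%:R].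
Proof.
move=> /hilbert_series_eqR Hh; apply: (@eventually_poly _ _ _ (size (map_poly intr h : {poly R}))) => n hn.
by rewrite exprSr cprodM (eq_cprod _ cprod_chi) Hh nth_default.
Qed.

Variables (P : {poly R}) (N : nat).
Hypothesis hP : forall n, (N <= n)%N -> fchi n = P.[n%:R].

Lemma hilbert_series_deg m h : hilbert_series_eq H m h -> (size P <= m.+1)%N.
Proof.
move=> /hilbert_samuel_poly[Q [sQ [M hM]]].
rewrite (@poly_nat_uniq _ P Q (maxn N M))// => n; rewrite geq_max => /andP[Nn Mn].
by rewrite -hP// hM.
Qed.

(** The series with numerator [h], divided by [1 - t], has the [m]-th difference of [chi] as
    coefficients on one side and the partial sums of the coefficients of [h] on the other. Both
    become constant. *)
Lemma hilbert_series_h1 m h : hilbert_series_eq H m h -> h.[1]%:~R = P`_m *+ m`! :> R.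
Proof.
move=> Hh; have sP := hilbert_series_deg Hh.
have {}Hh := hilbert_series_eqR Hh; pose hR : {poly R} := map_poly intr h.
have g n : cprod ((1 - 'X) ^+ m) fchi n = \sum_(0 <= i < n.+1) hR`_i.
  have D k : cprod (1 - 'X) (cprod ((1 - 'X) ^+ m) fchi) k = hR`_k.
    by rewrite -cprodM mulrC cprodM (eq_cprod _ cprod_chi) Hh.
  elim: n => [|n IH]; first by have := D 0%N; rewrite cprod1BX cprodX0 subr0 big_nat1.
  have Dn := D n.+1; rewrite cprod1BXS IH in Dn.
  by rewrite big_nat_recr//= -Dn addrC subrK.
pose n := maxn (N + m) (size hR).
rewrite -(cprod_eventually_poly sP hP (leq_maxl (N + m) (size hR))) -/n g.
have -> : h.[1]%:~R = hR.[1] by rewrite /hR -[1 in RHS](rmorph1 intr) horner_map.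
rewrite (@horner_coef_wide _ n.+1); last by apply: leqW; exact: leq_maxr.
by rewrite big_mkord; apply: eq_bigr => i _; rewrite expr1n mulr1.
Qed.

(** The [m]-th difference of [H] is the difference of order [m + 1] of [chi], so it vanishes beyond
    [N + m] and its values form a polynomial. The vanishing is checked in [R], where [P] lives, and
    pulled back to the integers. *)
Lemma hilbert_series_exists m : (size P <= m.+1)%N -> exists h, hilbert_series_eq H m h.
Proof.
move=> sP.
pose fZ n : int := (H n)%:Z.
have Z0 n : (N + m < n)%N -> cprod ((1 - 'X) ^+ m) fZ n = 0.
  case: n => // n; rewrite ltnS => hn.
  suff : (cprod ((1 - 'X) ^+ m) fZ n.+1)%:~R = 0 :> R by move/eqP; rewrite intr_eq0 => /eqP.
  have -> : (cprod ((1 - 'X) ^+ m) fZ n.+1)%:~R = cprod ((1 - 'X) ^+ m) fH n.+1 :> R.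
    rewrite rmorph_sum; apply: eq_bigr => i _; rewrite rmorphM; congr (_ * _).
    by rewrite -(coef_map intr) rmorphXn rmorphB /= rmorph1 map_polyX.
  rewrite -(eq_cprod _ cprod_chi) -cprodM mulrC cprodM cprod1BXS.
  by rewrite !(cprod_eventually_poly sP hP) ?subrr// leqW.
exists (\poly_(i < (N + m).+1) cprod ((1 - 'X) ^+ m) fZ i) => n.
by rewrite coef_poly ltnS; case: leqP => // /Z0.
Qed.

End HilbertSamuelPolynomial.

(** * Uniqueness of residues and of the extension *)

Section Residues.
Variable R : realType.
Implicit Types (F G g : R[i]^o -> R[i]^o) (a z : R[i]) (r d : R).

Lemma hol_poly (p : {poly R[i]}) z : hol (horner p) z.
Proof.
elim/poly_ind: p => [|p c IH].
  by apply: hol_near ltr01 _ (hol_cst 0 z) => w _; rewrite horner0.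
apply: hol_near ltr01 _ (holD (holM IH (hol_id z)) (hol_cst c z)) => w _.
by rewrite hornerMXaddC.
Qed.

(* If [q.[1 / w]] is bounded near [0], then [w ^ n q.[1 / w]], with [n] the
   degree of [q], tends to the leading coefficient of [q] and to [0]. *)
Lemma poly_inv_bounded (q : {poly R[i]}) d M : 0 < d ->
  (forall w, w != 0 -> cn w < d -> cn q.[w^-1] <= M) -> (size q <= 1)%N.
Proof.
move=> d0 hM; rewrite leqNgt; apply/negP => q1.
pose n := (size q).-1; have nE : size q = n.+1 by rewrite /n prednK// (leq_trans _ q1).
have n0 : (0 < n)%N by rewrite -ltnS -nE.
pose rev : {poly R[i]} := \poly_(i < n.+1) q`_(n - i).
have revE w : w != 0 -> rev.[w] = w ^+ n * q.[w^-1].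
  move=> w0; rewrite /rev horner_poly horner_coef nE mulr_sumr.
  rewrite (reindex_inj rev_ord_inj) /=; apply: eq_bigr => i _.
  have i_n : (i <= n)%N by rewrite -ltnS.
  rewrite subSS subKn// mulrCA; congr (_ * _).
  have -> : w ^+ n = w ^+ (n - i) * w ^+ i by rewrite -exprD subnK.
  by rewrite -mulrA exprVn mulfV ?mulr1// expf_neq0.
have rev0 : rev.[0] = lead_coef q.
  by rewrite horner_coef0 coef_poly /= subn0 lead_coefE.
have : lead_coef q != 0 by rewrite lead_coef_eq0 -size_poly_gt0 nE.
rewrite -rev0 => /eqP; apply; apply/eqP; rewrite -cn_eq0 eq_le cn_ge0 andbT.
apply/ler_addgt0Pr => e e0; rewrite add0r.
have e20 : 0 < e / 2 by rewrite divr_gt0.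
have [d' d'0 hd'] := hol_ccont (hol_poly rev 0) e20.
pose L := 1 + `|M|; have L0 : 0 < L by rewrite ltr_wpDr.
pose t := Num.min (Num.min (d / 2) (d' / 2)) (Num.min 1 (e / 2 / L)).
have t0 : 0 < t by rewrite !lt_min ltr01 !divr_gt0.
have [[td td'] [t1 te]] : (t <= d / 2 /\ t <= d' / 2) /\ (t <= 1 /\ t <= e / 2 / L).
  by rewrite /t !ge_min !lexx !orbT.
have cnt : cn t%:C = t by rewrite cn_real gtr0_norm.
have tC0 : t%:C != 0 by rewrite -cn_gt0 cnt.
have h1 := hd' t%:C; rewrite subr0 cnt in h1.
have {}h1 : cn (rev.[t%:C] - rev.[0]) <= e / 2 by apply: h1; lra.
have h2 : cn rev.[t%:C] <= e / 2.
  rewrite revE// cnM cnX cnt.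
  have h3 : cn q.[t%:C^-1] <= L.
    apply: le_trans (hM _ tC0 _) _; first by rewrite cnt; lra.
    by apply: le_trans (ler_norm _) _; rewrite /L lerDr.
  have h4 : t ^+ n <= t.
    rewrite -(prednK n0) exprS ler_piMr ?(ltW t0)//.
    by apply: exprn_ile1 => //; exact: ltW.
  apply: (@le_trans _ _ (e / 2 / L * L)); last by rewrite divfK// gt_eqF.
  apply: ler_pM; rewrite ?cn_ge0 ?exprn_ge0 ?(ltW t0)//.
  exact: le_trans te.
have := cn_leD rev.[0] rev.[t%:C]; rewrite cnBC; lra.
Qed.

(** Two principal parts differ by a difference of functions holomorphic at [a], which is bounded
    near [a]; by [poly_inv_bounded] they differ by a constant. *)
Lemma is_residue_uniq F a (r1 r2 : R[i]) :
  is_residue F a r1 -> is_residue F a r2 -> r1 = r2.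
Proof.
move=> [p1 [g1 [/holomorphic_nearP[s1 s10 h1] /dnearC[t1 t10 E1] ->]]].
move=> [p2 [g2 [/holomorphic_nearP[s2 s20 h2] /dnearC[t2 t20 E2] ->]]].
have aa s : 0 < s -> cn (a - a) < s by rewrite subrr cn0.
have [u1 /andP[u10 _] [M1 _ b1]] := ccont_bounded s10 (hol_ccont (h1 a (aa _ s10))).
have [u2 /andP[u20 _] [M2 _ b2]] := ccont_bounded s20 (hol_ccont (h2 a (aa _ s20))).
pose d := Num.min (Num.min t1 t2) (Num.min u1 u2).
have d0 : 0 < d by rewrite !lt_min t10 t20 u10.
have sz : (size (p1 - p2)%R <= 1)%N.
  apply: (@poly_inv_bounded _ d (M1 + M2)) => // w w0.
  rewrite !lt_min => /andP[/andP[w1 w2] /andP[w3 w4]].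
  have Ew : w + a - a = w by rewrite addrK.
  have wa : w + a != a by rewrite -subr_eq0 Ew.
  have e1 := E1 (w + a); rewrite Ew in e1; have e2 := E2 (w + a); rewrite Ew in e2.
  have c1 := b1 (w + a); rewrite Ew in c1; have c2 := b2 (w + a); rewrite Ew in c2.
  rewrite hornerD hornerN.
  have -> : p1.[w^-1] - p2.[w^-1] = g2 (w + a) - g1 (w + a).
    have := e1 w1 wa; rewrite (e2 w2 wa) => e.
    have -> : p1.[w^-1] = p2.[w^-1] + g2 (w + a) - g1 (w + a) by rewrite e addrK.
    by ring.
  by apply: le_trans (cnB _ _) _; have := c1 w3; have := c2 w4; lra.
apply/eqP; rewrite -subr_eq0 -coefB; apply/eqP; exact: nth_default.
Qed.

Lemma residueE F a (r : R[i]) : is_residue F a r -> residue F a = r.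
Proof.
move=> h; apply: (is_residue_uniq _ h); apply: (@xgetPex _ 0 (is_residue F a)).
by exists r.
Qed.

Lemma is_residue_near F G a (r : R[i]) : (\forall z \near (a : R[i]^o)^', F z = G z) ->
  is_residue F a r -> is_residue G a r.
Proof.
move=> /dnearC[s s0 FG] [p [g [hg /dnearC[t t0 E] rE]]].
exists p, g; split=> //; apply/dnearC; exists (Num.min s t); first by rewrite lt_min s0.
move=> z; rewrite lt_min => /andP[zs zt] za.
by rewrite -FG// E.
Qed.

(** The point [a] is on the boundary of the half-plane where the functions agree, so a single local
    use of [identity_half_plane] is enough. It is applied to [h], which is [F - G] with the poles
    cleared. *)
Lemma meromorphic_eq_near F G a : meromorphic F -> meromorphic G ->
  (forall z, complex.Re a < complex.Re z -> F z = G z) ->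
  \forall z \near (a : R[i]^o)^', F z = G z.
Proof.
move=> /(_ a)[k [f [/holomorphic_nearP[r1 r10 hf] /dnearC[s1 s10 Ef]]]].
move=> /(_ a)[l [g [/holomorphic_nearP[r2 r20 hg] /dnearC[s2 s20 Eg]]]] FG.
pose r := Num.min (Num.min r1 r2) (Num.min s1 s2).
have r0 : 0 < r by rewrite !lt_min r10 r20 s10.
pose h z : R[i] := (z - a) ^+ l * f z - (z - a) ^+ k * g z.
have hX n z : hol (fun z => (z - a) ^+ n) z.
  by apply: holX; apply: holB; [exact: hol_id|exact: hol_cst].
have [||s s0 hs] := @identity_half_plane _ h a r r0.
- move=> w; rewrite !lt_min => /andP[/andP[w1 w2] _].
  apply: holB; apply: holM; try exact: hX; [exact: hf|exact: hg].
- move=> w; rewrite !lt_min => /andP[_ /andP[w3 w4]] wa.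
  have wna : w != a by apply/eqP => E; move: wa; rewrite E ltxx.
  by rewrite /h -Ef// -Eg// FG//; ring.
apply/dnearC; exists (Num.min s (Num.min s1 s2)); first by rewrite !lt_min s0 s10.
move=> z; rewrite !lt_min => /andP[zs /andP[z1 z2]] za.
have := hs z zs; rewrite /h -Ef// -Eg// !mulrA -!exprD addnC -mulrBr => /eqP.
rewrite mulf_eq0 expf_eq0 subr_eq0 (negbTE za) andbF /= subr_eq0 => /eqP //.
Qed.

End Residues.

(** * Continuation of the Dirichlet series *)

Section Extension.
Variables (R : realType) (chi : nat -> nat) (P : {poly R}) (N m : nat).
Hypothesis hP : forall n, (N <= n)%N -> (chi n)%:R = P.[n%:R] :> R.
Implicit Types (z a : R[i]) (r : R).

(** The finitely many terms before [chi] becomes polynomial; they form an entire function. *)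
Let corr z : R[i] := \sum_(1 <= k < N) ((chi k)%:R - (P.[k%:R])%:C) * rpow k%:R z.

Definition dirichlet_ext : R[i]^o -> R[i]^o := fun z =>
  \sum_(j < m.+1) (P`_j)%:C * zeta (z - j%:R) + corr z.

Lemma ReBnat z n : complex.Re (z - n%:R) = complex.Re z - n%:R.
Proof. by rewrite ReB -(rmorph_nat (real_complex R)). Qed.

Lemma clim_dirichlet z : (size P <= m.+1)%N -> m.+1%:R < complex.Re z ->
  clim (fun n => \sum_(1 <= k < n.+1) (chi k)%:R / natcpow k z) (dirichlet_ext z).
Proof.
move=> sP zm.
have h1 (j : 'I_m.+1) : clim (fun n => (P`_j)%:C * psum n (z - j%:R))
    ((P`_j)%:C * zeta (z - j%:R)).
  apply: climZ; apply: clim_psum; rewrite ReBnat ltrBrDr.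
  by apply: le_lt_trans zm; rewrite nat1r ler_nat ltnS -ltnS.
have := climD (clim_sum (index_enum 'I_m.+1) h1) (clim_cst (corr z)).
apply: (@clim_near _ _ _ _ N) => n Nn.
have -> : \sum_(j < m.+1) (P`_j)%:C * psum n (z - j%:R) =
    \sum_(1 <= k < n.+1) (P.[k%:R])%:C * rpow k%:R z.
  under eq_bigr do rewrite /psum mulr_sumr.
  rewrite exchange_big /=; apply: eq_big_nat => k /andP[k1 _].
  rewrite (horner_coef_wide _ sP) rmorph_sum /= mulr_suml; apply: eq_bigr => j _.
  by rewrite rpow_natB ?ltr0n// mulrA rmorphM rmorphXn.
have -> : corr z = \sum_(1 <= k < n.+1) ((chi k)%:R - (P.[k%:R])%:C) * rpow k%:R z.
  rewrite /corr; case: (posnP N) => [N0|Np].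
    rewrite N0 big_geq//; rewrite big_nat big1// => k _.
    by rewrite -(rmorph_nat (real_complex R)) hP ?N0// subrr mul0r.
  rewrite (@big_cat_nat _ _ _ N 1 n.+1)//=; last exact: leqW.
  rewrite [X in _ = _ + X]big_nat [X in _ = _ + X]big1 ?addr0// => k /andP[Nk _].
  by rewrite -(rmorph_nat (real_complex R)) hP// subrr mul0r.
rewrite -big_split /=; apply: eq_bigr => k _.
by rewrite natcpowV -mulrDl addrC subrK.
Qed.

Lemma hol_corr z : hol corr z.
Proof.
by apply: hol_sum => k; apply: holM; [exact: hol_cst|exact: hol_rpow].
Qed.

Lemma hol_subr (f : R[i] -> R[i]) z c : hol f (z - c) -> hol (fun w => f (w - c)) z.
Proof.
move=> h; apply: (@hol_comp _ (fun w => w - c) f) => //.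
by apply: holB; [exact: hol_id|exact: hol_cst].
Qed.

(** A factor [z - a] suffices at every point, because each translate of [zeta] has at most simple
    poles. *)
Lemma meromorphic_dirichlet : meromorphic dirichlet_ext.
Proof.
move=> a; exists 1%N.
have /choice[r hr] : forall j : 'I_m.+1, exists r : R, 0 < r /\ exists g : R[i] -> R[i],
    (forall w, cn (w - a) < r -> hol g w) /\
    (forall w, cn (w - a) < r -> w != a -> (w - a) * zeta (w - j%:R) = g w).
  move=> j; have [r r0 [g [hg gE _]]] := zeta_simple_pole (a - j%:R).
  exists r; split=> //; exists (fun w => g (w - j%:R)); split=> w wr.
    by apply: hol_subr; apply: hg; rewrite opprB addrA subrK.
  move=> wa; rewrite -gE ?opprB ?addrA ?subrK//.
  by rewrite -subr_eq0 opprB addrA subrK subr_eq0.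
have /choice[g hg] : forall j : 'I_m.+1, exists g : R[i] -> R[i],
    (forall w, cn (w - a) < r j -> hol g w) /\
    (forall w, cn (w - a) < r j -> w != a -> (w - a) * zeta (w - j%:R) = g w).
  by move=> j; have [_ [g hg]] := hr j; exists g.
have [s s0 hs] : exists2 s, 0 < s & forall j : 'I_m.+1, s <= r j.
  exists (\big[Num.min/1]_(j < m.+1) r j).
    by apply/bigmin_gtP; split=> // j _; have [] := hr j.
  by move=> j; apply: bigmin_le_cond.
exists (fun z => \sum_(j < m.+1) (P`_j)%:C * g j z + (z - a) * corr z); split.
  apply/holomorphic_nearP; exists s => // z za.
  apply: holD; last first.
    by apply: holM (hol_corr z); apply: holB; [exact: hol_id|exact: hol_cst].
  have hz (j : 'I_m.+1) : hol (g j) z.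
    by have [h _] := hg j; apply: h; exact: lt_le_trans (hs j).
  by apply: hol_sum => j; apply: holM => //; exact: hol_cst.
apply/dnearC; exists s => // z zs za.
rewrite expr1 /dirichlet_ext mulrDr; congr (_ + _).
rewrite mulr_sumr; apply: eq_bigr => j _.
by have [_ <-] := hg j; [rewrite mulrCA|exact: lt_le_trans (hs j)|].
Qed.

(** Only the term [j = m] has a pole at [m + 1]: for [j < m] the argument [m + 1 - j] has real part
    greater than 1, where [dzeta] has no zero. *)
Lemma residue_dirichlet : is_residue dirichlet_ext m.+1%:R (P`_m)%:C.
Proof.
have [r0 r00 [g0 [hg0 g0E]]] := zeta_pole1 R.
have dz (j : 'I_m) : dzeta (m.+1%:R - j%:R : R[i]) != 0.
  apply/eqP => /dzeta_eq0; rewrite ReBnat -(rmorph_nat (real_complex R)) /=.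
  rewrite -natrB; last by rewrite ltnW// ltnW// ltnS.
  move=> /eqP; rewrite pnatr_eq1 subSn; last exact: ltnW.
  by rewrite eqSS subn_eq0 leqNgt ltn_ord.
have /choice[r hr] : forall j : 'I_m, exists r, 0 < r /\
    forall w, cn (w - (m.+1%:R - j%:R : R[i])) < r -> dzeta w != 0.
  by move=> j; have [r rp h] := ccont_neq0 (hol_ccont (hol_dzeta _)) (dz j); exists r.
have [s s0 hs] : exists2 s, 0 < s & forall j : 'I_m, s <= r j.
  exists (\big[Num.min/1]_(j < m) r j).
    by apply/bigmin_gtP; split=> // j _; have [] := hr j.
  by move=> j; apply: bigmin_le_cond.
have E z : z - m.+1%:R = z - m%:R - 1 :> R[i] by rewrite -natr1; ring.
exists ((P`_m)%:C *: 'X), (fun z => \sum_(j < m) (P`_j)%:C * zeta (z - j%:R) +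
  (P`_m)%:C * g0 (z - m%:R) + corr z); split.
- apply/holomorphic_nearP; exists (Num.min s r0); first by rewrite lt_min s0.
  move=> z; rewrite lt_min => /andP[zs zr].
  apply: holD (hol_corr z); apply: holD.
    have hz (j : 'I_m) : hol (fun z => zeta (z - j%:R)) z.
      apply: hol_subr; apply: hol_zeta; have [_ h] := hr j; apply: h.
      by rewrite opprB addrA subrK; exact: lt_le_trans (hs j).
    by apply: hol_sum => j; apply: holM => //; exact: hol_cst.
  apply: holM; first exact: hol_cst.
  by apply: hol_subr; apply: hg0; rewrite -E.
- apply/dnearC; exists r0 => // z zr za.
  rewrite /dirichlet_ext big_ord_recr /= hornerZ hornerX.
  rewrite (g0E (z - m%:R)); last 2 first.
  + by rewrite -E.
  + by rewrite -subr_eq0 -E subr_eq0.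
  by rewrite -E; ring.
- by rewrite coefZ coefX eqxx mulr1.
Qed.

End Extension.

(** * Divergence when the degree is too large *)

Section Divergence.
Variables (R : realType) (chi : nat -> nat) (P : {poly R}) (N m : nat).
Hypothesis hP : forall n, (N <= n)%N -> (chi n)%:R = P.[n%:R] :> R.

(** At [m + 3 / 2] the terms are at least [c / sqrt k] for large [k], so the block from [n + 1] to
    [2 n] is at least [c n / sqrt (2 n)], which is unbounded. A convergent series has bounded
    blocks. *)
Lemma dirichlet_diverges (l : R[i]) : (m.+1 < size P)%N ->
  ~ clim (fun n => \sum_(1 <= k < n.+1) (chi k)%:R / natcpow k (m%:R + 3 / 2)%:C) l.
Proof.
move=> mP hl.
have P0 : P != 0 by rewrite -size_poly_gt0; exact: leq_trans mP.
have [c [N1 [c0 hc]]] := poly_lower_bound P0.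
have lower k : (maxn (maxn N N1) 1 <= k)%N -> c * k%:R ^+ m.+1 <= (chi k)%:R.
  rewrite !geq_max => /andP[/andP[Nk N1k] k1].
  rewrite -[leRHS]ger0_norm// hP//; apply: le_trans (hc k N1k).
  rewrite ler_wpM2l ?(ltW c0)//; apply: ler_weXn2l; first by rewrite ler1n.
  by rewrite -ltnS prednK ?size_poly_gt0.
pose T k : R := (chi k)%:R * expR (- ((m%:R + 3 / 2) * ln k%:R)).
have TE k : (chi k)%:R / natcpow k (m%:R + 3 / 2)%:C = (T k)%:C :> R[i].
  rewrite natcpowV rmorphM rmorph_nat; congr (_ * _).
  by rewrite /rpow /cexp /=; simpc; rewrite cos0 sin0 mulr0 mulr1 mulrC.
have [n0 hn0] := hl _ (ltr01 : 0 < 1 :> R).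
pose K := maxn (maxn N N1) 1.
(* The block estimate [n * (c * t) <= 2], with [t = 1 / sqrt (2 n)], squares to [n <= 8 / c ^ 2],
   which this choice of [n] contradicts. *)
pose n := maxn (maxn K n0) (Num.bound (8 / c ^+ 2)).+1.
have [Kn n0n Bn] : [/\ (K <= n)%N, (n0 <= n)%N & (Num.bound (8 / c ^+ 2) < n)%N].
  split; last exact: leq_maxr.
    by apply: leq_trans (leq_maxl _ _); exact: leq_maxl.
  by apply: leq_trans (leq_maxl _ _); exact: leq_maxr.
have np : (0 < n)%N by apply: leq_ltn_trans Bn.
have n0' : 0 < n%:R :> R by rewrite ltr0n.
have n20 : 0 < n.*2%:R :> R by rewrite ltr0n double_gt0.
pose t : R := expR (- (ln n.*2%:R / 2)).
have t0 : 0 < t by exact: expR_gt0.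
have tt : t ^+ 2 * n.*2%:R = 1.
  rewrite /t -expRM_natl.
  have -> : 2 * - (ln n.*2%:R / 2) = - ln n.*2%:R :> R by field.
  by rewrite expRN lnK ?posrE// mulVf// gt_eqF.
have Tlow k : (n < k <= n.*2)%N -> c * t <= T k.
  move=> /andP[nk k2].
  have k0 : 0 < k%:R :> R by rewrite ltr0n; exact: leq_ltn_trans nk.
  have Kk : (K <= k)%N by apply: leq_trans Kn _; exact: ltnW.
  apply: (@le_trans _ _ (c * k%:R ^+ m.+1 * expR (- ((m%:R + 3 / 2) * ln k%:R)))); last first.
    by rewrite ler_wpM2r ?expR_ge0// lower.
  rewrite -mulrA ler_wpM2l ?(ltW c0)//.
  rewrite -[X in X ^+ _]lnK ?posrE// -expRM_natl -expRD ler_expR.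
  have -> : m.+1%:R * ln k%:R + - ((m%:R + 3 / 2) * ln k%:R) = - (ln k%:R / 2) :> R.
    by rewrite -natr1; field.
  by rewrite lerN2 ler_pM2r// ler_ln ?posrE// ler_nat.
pose U k : R[i] := \sum_(1 <= j < k.+1) (chi j)%:R / natcpow j (m%:R + 3 / 2)%:C.
have UE : U n.*2 - U n = (\sum_(n.+1 <= k < n.*2.+1) T k)%:C.
  have n2 : (n.+1 <= n.*2.+1)%N by rewrite ltnS -addnn leq_addr.
  rewrite /U (@big_cat_nat _ _ _ n.+1 1 n.*2.+1)//= addrAC subrr add0r rmorph_sum /=.
  by apply: eq_bigr => k _; exact: TE.
have Ub : cn (U n.*2 - U n) <= 2.
  have n02 : (n0 <= n.*2)%N by rewrite -addnn; apply: leq_trans n0n (leq_addr _ _).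
  have := hn0 _ n0n; have := hn0 _ n02; have := cn_tri (U n.*2) (U n) l.
  by rewrite (cnBC l) -/(U n) -/(U n.*2); lra.
have big : n%:R * (c * t) <= 2.
  apply: le_trans Ub; rewrite UE cn_real; apply: le_trans (ler_norm _).
  have -> : n%:R * (c * t) = \sum_(n.+1 <= k < n.*2.+1) (c * t).
    by rewrite sumr_const_nat subSS -addnn addnK mulr_natl.
  by apply: ler_sum_nat => k /andP[k1 k2]; apply: Tlow; rewrite k1.
have nct0 : 0 <= n%:R * (c * t) by rewrite !mulr_ge0// ltW.
have : (n%:R * (c * t)) ^+ 2 <= 2 ^+ 2 by rewrite lerXn2r ?nnegrE.
have -> : (n%:R * (c * t)) ^+ 2 = n%:R * c ^+ 2 / 2.
  have -> : n%:R * c ^+ 2 / 2 = n%:R * c ^+ 2 / 2 * (t ^+ 2 * n.*2%:R) by rewrite tt mulr1.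
  by rewrite -mul2n natrM; field.
have c20 : 0 < c ^+ 2 by rewrite exprn_gt0.
rewrite ler_pdivrMr// -ler_pdivlMr// => h.
have : n%:R <= 8 / c ^+ 2 by apply: le_trans h _; rewrite ler_wpM2r ?invr_ge0 ?(ltW c20)//; lra.
apply/negP; rewrite -ltNge; apply: lt_trans (archi_boundP _) _.
  by rewrite divr_ge0// ltW.
by rewrite ltr_nat.
Qed.

End Divergence.

Theorem proposition4p1 (R : realType) (S : comNzRingType) (mm : set S)
    (M : lmodType S) (m : nat) (I : set S) :
  noetherian_ring S ->
  local_ring mm ->
  finitely_generated M ->
  krull_dim M m ->
  is_proper_ideal I ->
  (exists2 n : nat, (1 <= n)%N &
     ideal_smul (ideal_exp mm n) [set: M] `<=` ideal_smul I [set: M]) ->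
  (multiplicity M I m)%:~R
    = m`!%:R * residue (zeta1 R M I m) m.+1%:R :> R[i].
Proof.
move=> noeS locS fgM _ pI mI.
have [d [h0 Hh0]] := hilbert_gr_rational noeS locS fgM pI mI.
pose chi := hilbert_samuel M I.
have [P [_ [N hP]]] := hilbert_samuel_poly R Hh0.
have {}hP n : (N <= n)%N -> (chi n)%:R = P.[n%:R] by exact: hP.
have [sP|sP] := leqP (size P) m.+1.
  have -> : residue (zeta1 R M I m) m.+1%:R = (P`_m)%:C.
    apply: residueE.
    have extF : zeta1_extension M I m (dirichlet_ext chi P N m).
      split; first exact: meromorphic_dirichlet.
      by move=> z zm; apply/climP; exact: (clim_dirichlet hP sP zm).
    have [merZ eqZ] : zeta1_extension M I m (zeta1 R M I m).
      by apply: (@xgetPex _ (fun=> 0)); exists (dirichlet_ext chi P N m).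
    have [merF eqF] := extF.
    apply: is_residue_near (residue_dirichlet chi P N m).
    apply: meromorphic_eq_near => // z zm.
    have {}zm : m.+1%:R < complex.Re z.
      by move: zm; rewrite -(rmorph_nat (real_complex R)).
    apply: (@clim_uniq _ (fun n => \sum_(1 <= k < n.+1) (chi k)%:R / natcpow k z)).
      by apply/climP; exact: eqF.
    by apply/climP; exact: eqZ.
  suff : (multiplicity M I m)%:~R = P`_m *+ m`! :> R.
    move=> E; rewrite -[LHS](rmorph_int (real_complex R)) E rmorphMn /=.
    by rewrite mulr_natl.
  rewrite /multiplicity; case: xgetP => [e _ [h [Hh _ ->]]|no].
    exact: (hilbert_series_h1 hP Hh).
  have [h Hh] := hilbert_series_exists hP sP.
  have hE := hilbert_series_h1 hP Hh; rewrite -hE.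
  (* A numerator always exists here. If its value at 1 is 0, then [m! P_m] is 0 as well and agrees
     with the default value of [multiplicity]. *)
  have [->//|h10] := eqVneq h.[1] 0.
  by case: (no h.[1]); exists h.
have -> : multiplicity M I m = 0.
  rewrite /multiplicity; case: xgetP => // e _ [h [Hh _ _]].
  by have := hilbert_series_deg hP Hh; rewrite leqNgt sP.
have -> : zeta1 R M I m = fun=> 0.
  rewrite /zeta1; case: xgetP => // F _ [_ eqF].
  have /eqF/climP : m.+1%:R < complex.Re (m%:R + 3 / 2 : R)%:C by rewrite /= -natr1; lra.
  by case/(dirichlet_diverges hP sP).
rewrite (@residueE _ _ _ 0) ?mulr0//.
exists 0, (fun=> 0); split; last by rewrite coef0.
  by apply/holomorphic_nearP; exists 1 => // z _; exact: hol_cst.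
by apply/dnearC; exists 1 => // z _ _; rewrite horner0 addr0.
Qed.
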